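(* Let $\Omega\subset\mathbb{R}^3$ be a Jordan domain with fractal boundary $\Gamma$, $\Omega_+:=\Omega$, $\Omega_-:=\mathbb{R}^3\setminus(\Omega\cup\Gamma)$, and let $\theta\in[0,2\pi)$ be fixed. Let $\mathbf{f}=f_1\mathbf{i}+f_2\mathbf{j}+f_3\mathbf{k}\in \mathbf{Lip}_\mu(\Gamma,\mathbb{C}^3)$ with $\mu>\frac{\alpha(\Gamma)}{3}$ ($\mu\le 1$), where $\alpha(\Gamma)$ is the Minkowski dimension of $\Gamma$. Let $\mathbf{f}^w=\mathbf{f}^w_1\mathbf{i}+\mathbf{f}^w_2\mathbf{j}+\mathbf{f}^w_3\mathbf{k}$ be its truncated Whitney extension, and put $$\mathbf{V}:=\Big(\big(\tfrac{\partial \mathbf{f}^w_3}{\partial x_3}-\tfrac{\partial \mathbf{f}^w_2}{\partial x_2}\big)\cos\theta-\big(\tfrac{\partial \mathbf{f}^w_3}{\partial x_2}+\tfrac{\partial \mathbf{f}^w_2}{\partial x_3}\big)\sin\theta\Big)\mathbf{i}+\Big(-\tfrac{\partial \mathbf{f}^w_3}{\partial x_1}+\tfrac{\partial \mathbf{f}^w_1}{\partial x_3}\sin\theta+\tfrac{\partial \mathbf{f}^w_1}{\partial x_2}\cos\theta\Big)\mathbf{j}+\Big(\tfrac{\partial \mathbf{f}^w_2}{\partial x_1}-\tfrac{\partial \mathbf{f}^w_1}{\partial x_3}\cos\theta+\tfrac{\partial \mathbf{f}^w_1}{\partial x_2}\sin\theta\Big)\mathbf{k}$$ (the vector part of ${}^{\psi^\theta}D[\mathbf{f}^w]$).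 Let $\mathscr{M}^*_{\psi^\theta}$ be the class of all vector fields $\mathbf{g}\in C^1(\Omega,\mathbb{C}^3)\cap\mathbf{Lip}_\mu(\Gamma,\mathbb{C}^3)$ such that $$\int_{\Omega_+}\big\langle \mathscr{K}_{\psi^\theta}(x-\xi),\mathbf{g}(\xi)\big\rangle\,dm(\xi)=0\qquad\text{for all }x\in\Gamma .$$ If $\mathbf{V}\in\mathscr{M}^*_{\psi^\theta}$, then the reconstruction problem for $\mathbf{f}$ is solvable: $\mathbf{f}$ can be decomposed on $\Gamma$ as $\mathbf{f}(t)=\mathbf{f}^+(t)+\mathbf{f}^-(t)$ for all $t\in\Gamma$, where $\mathbf{f}^{\pm}$ are extendable to generalized Laplacian vector fields $\mathbf{F}^{\pm}$ in $\Omega_\pm$, with $\mathbf{F}^-(\infty)=0$.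
   Context: Quaternions: $\mathbb{H}(\mathbb{C})$ is the algebra of complex quaternions $a=a_0+a_1\mathbf{i}+a_2\mathbf{j}+a_3\mathbf{k}$, $a_k\in\mathbb{C}$, with the usual multiplication rules ($\mathbf{i}\mathbf{j}=\mathbf{k}$, etc.), the complex unit commuting with $\mathbf{i},\mathbf{j},\mathbf{k}$. Elements with $a_0=0$ are identified with vectors of $\mathbb{C}^3$; $\langle \vec a,\vec b\rangle=\sum_{k=1}^3a_kb_k$ (bilinear, no conjugation). For $\theta\in[0,2\pi)$ fixed, $e^{\mathbf{i}\theta}=\cos\theta+\mathbf{i}\sin\theta$ and ${}^{\psi^\theta}D[f]:=\mathbf{i}\,\partial_{x_1}f+\mathbf{i}e^{\mathbf{i}\theta}\mathbf{j}\,\partial_{x_2}f+e^{\mathbf{i}\theta}\mathbf{j}\,\partial_{x_3}f$. Kernel: $\mathscr{K}_{\psi^\theta}(x):=-\frac{1}{4\pi}\frac{(x)_{\psi^\theta}}{|x|^3}$, $x\in\mathbb{R}^3\setminus\{0\}$, where $(x)_{\psi^\theta}:=x_1\mathbf{i}+x_2\,\mathbf{i}e^{\mathbf{i}\theta}\mathbf{j}+x_3\,e^{\mathbf{i}\theta}\mathbf{j}$. $m$ is Lebesgue measure on $\mathbb{R}^3$. A smooth vector field $\mathbf{F}=F_1\mathbf{i}+F_2\mathbf{j}+F_3\mathbf{k}$ (complex-valued components) on an open set is a generalized Laplacian vector field if ${}^{\psi^\theta}D[\mathbf{F}]=0$ there, i.e. $-\partial_1F_1+(\partial_2F_2-\partial_3F_3)\sin\theta-(\partial_2F_3+\partial_3F_2)\cos\theta=0$,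 $(\partial_3F_3-\partial_2F_2)\cos\theta-(\partial_2F_3+\partial_3F_2)\sin\theta=0$, $-\partial_1F_3+\partial_3F_1\sin\theta+\partial_2F_1\cos\theta=0$, $\partial_1F_2-\partial_3F_1\cos\theta+\partial_2F_1\sin\theta=0$. A Jordan domain is a bounded connected open set whose boundary is a compact topological surface. The boundary $\Gamma$ is fractal (in the sense of Mandelbrot) if its Hausdorff dimension exceeds $2$. $\alpha(\Gamma)$ is the Minkowski, i.e. box, dimension. $\mathbf{Lip}_\mu(E,\mathbb{C}^3)$, $0<\mu\le1$, is the set of Hölder continuous $\mathbb{C}^3$-valued functions on $E$ with exponent $\mu$; $C^1(\Omega,\mathbb{C}^3)$ is the set of continuously differentiable $\mathbb{C}^3$-valued functions on $\Omega$. Whitney extension: Let $\mathcal{M}_1$ be the set of closed unit cubes of the lattice $\mathbb{Z}^3$ meeting $\Omega$, and $\mathcal{M}_k$ ($k\ge2$) the set obtained from $\mathcal{M}_{k-1}$ by bisecting the sides of its cubes (side length $2^{-k+1}$). $\mathcal{W}^k$ is the set of $Q\in\mathcal{M}_k$ such that $Q$ and every cube of $\mathcal{M}_k$ touching $Q$ are contained in $\Omega$ and $Q$ is not contained in any cube of $\mathcal{W}^{j}$, $j<k$. Then $\mathcal{W}=\bigcup_k\mathcal{W}^k=\{Q_k\}$ consists of cubes with disjoint interiors whose union is $\Omega$. Fix $\varepsilon\in(0,\frac14)$; let $Q_0$ be the unit cube centred at $0$, $Q_0^*=(1+\varepsilon)Q_0$, and fix $\varphi\in C^\infty(\mathbb{R}^3)$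 with $0\le\varphi\le1$, $\varphi=1$ on $Q_0$, $\varphi=0$ off $Q_0^*$. With $x^k$ and $l_k$ the centre and side length of $Q_k$, put $\varphi_k(x)=\varphi((x-x^k)/l_k)$ and $\varphi_k^*=\varphi_k/\sum_j\varphi_j$ on $\Omega$. For each $k$ fix $p_k\in\Gamma$ with $\mathrm{dist}(Q_k,\Gamma)=\mathrm{dist}(Q_k,p_k)$. The Whitney operator is $\mathcal{E}_0(f)(x)=f(x)$ for $x\in\Gamma$ and $\mathcal{E}_0(f)(x)=\sum_kf(p_k)\varphi_k^*(x)$ for $x\in\Omega$. The truncated Whitney extension of $f$ is $f^w:=\mathcal{X}\,\mathcal{E}_0(f)$ with $\mathcal{X}$ the characteristic function of $\Omega_+\cup\Gamma$ (so $f^w=0$ in $\Omega_-$). It is $C^\infty$ in $\Omega_+$. *)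

(* Defs.v *)
From HB Require Import structures.
From mathcomp Require Import all_boot all_order all_algebra ring.
From mathcomp Require Import all_classical all_reals all_analysis.
From mathcomp Require Import complex.

Set Implicit Arguments.
Unset Strict Implicit.
Unset Printing Implicit Defensive.

Import Order.TTheory GRing.Theory Num.Theory.
Import numFieldNormedType.Exports.

Local Open Scope classical_set_scope.
Local Open Scope complex_scope.
Local Open Scope ring_scope.

Record quat (A : Type) := Quat { q0 : A; q1 : A; q2 : A; q3 : A }.

Section QuatRing.
Variable A : comNzRingType.
Implicit Types a b c : quat A.

Definition quat_to_prod a := (q0 a, q1 a, q2 a, q3 a).
Definition prod_to_quat (p : A * A * A * A) :=
  let: (a0, a1, a2, a3) := p in Quat a0 a1 a2 a3.
Fact quat_to_prodK : cancel quat_to_prod prod_to_quat.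
Proof. by case. Qed.
HB.instance Definition _ := Choice.copy (quat A) (can_type quat_to_prodK).

Definition qadd a b :=
  Quat (q0 a + q0 b) (q1 a + q1 b) (q2 a + q2 b) (q3 a + q3 b).
Definition qopp a := Quat (- q0 a) (- q1 a) (- q2 a) (- q3 a).
Definition qscale (k : A) a := Quat (k * q0 a) (k * q1 a) (k * q2 a) (k * q3 a).
Definition qmul a b := Quat
  (q0 a * q0 b - q1 a * q1 b - q2 a * q2 b - q3 a * q3 b)
  (q0 a * q1 b + q1 a * q0 b + q2 a * q3 b - q3 a * q2 b)
  (q0 a * q2 b - q1 a * q3 b + q2 a * q0 b + q3 a * q1 b)
  (q0 a * q3 b + q1 a * q2 b - q2 a * q1 b + q3 a * q0 b).

Fact qaddA : associative qadd.
Proof. by move=> a b c; rewrite /qadd /= !addrA. Qed.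
Fact qaddC : commutative qadd.
Proof. by move=> a b; congr Quat; rewrite addrC. Qed.
Fact qadd0 : left_id (Quat 0 0 0 0) qadd.
Proof. by case=> *; rewrite /qadd /= !add0r. Qed.
Fact qaddN : left_inverse (Quat 0 0 0 0) qopp qadd.
Proof. by case=> *; rewrite /qadd /= !addNr. Qed.
HB.instance Definition _ :=
  GRing.isZmodule.Build (quat A) qaddA qaddC qadd0 qaddN.

Fact qmulA : associative qmul.
Proof. by move=> [????] [????] [????]; congr Quat => /=; ring. Qed.
Fact qmul_1l : left_id (Quat 1 0 0 0) qmul.
Proof. by move=> [????]; congr Quat => /=; ring. Qed.
Fact qmul_1r : right_id (Quat 1 0 0 0) qmul.
Proof. by move=> [????]; congr Quat => /=; ring. Qed.
Fact qmulDl : left_distributive qmul +%R.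
Proof. by move=> [????] [????] [????]; congr Quat => /=; ring. Qed.
Fact qmulDr : right_distributive qmul +%R.
Proof. by move=> [????] [????] [????]; congr Quat => /=; ring. Qed.
Fact qone_neq0 : Quat 1 0 0 0 != 0 :> quat A.
Proof. by apply/eqP => -[] /eqP; rewrite oner_eq0. Qed.
HB.instance Definition _ := GRing.Zmodule_isNzRing.Build (quat A)
  qmulA qmul_1l qmul_1r qmulDl qmulDr qone_neq0.

Fact qscaleA k l a : qscale k (qscale l a) = qscale (k * l) a.
Proof. by congr Quat => /=; ring. Qed.
Fact qscale1 : left_id 1 qscale.
Proof. by case=> *; rewrite /qscale /= !mul1r. Qed.
Fact qscaleDr : right_distributive qscale +%R.
Proof. by move=> k a b; congr Quat => /=; ring. Qed.
Fact qscaleDl a : {morph qscale^~ a : k l / k + l}.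
Proof. by move=> k l; congr Quat => /=; ring. Qed.
HB.instance Definition _ := GRing.Zmodule_isLmodule.Build A (quat A)
  qscaleA qscale1 qscaleDr qscaleDl.

Definition qi : quat A := Quat 0 1 0 0.
Definition qj : quat A := Quat 0 0 1 0.
Definition qk : quat A := Quat 0 0 0 1.

Definition vec_to_quat (v : 'rV[A]_3) : quat A :=
  v 0 0 *: qi + v 0 1 *: qj + v 0 2 *: qk.
Definition vec_part (q : quat A) : 'rV[A]_3 := \row_k [:: q1 q; q2 q; q3 q]`_k.

Definition bilin (a b : 'rV[A]_3) : A := \sum_k a 0 k * b 0 k.

End QuatRing.
Arguments qi {A}.
Arguments qj {A}.
Arguments qk {A}.

Section Field.
Variable R : realType.
Local Notation pt := 'rV[R]_3.
Local Notation C3 := 'rV[R[i]]_3.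
Local Notation HC := (quat R[i]).
Implicit Types (x y xi : pt) (E U Omega Gamma : set pt) (s mu theta : R).

(* Euclidean norms; the library norm on row vectors is the sup norm. *)
Definition enorm x : R := Num.sqrt (\sum_k x 0 k ^+ 2).
Definition cnorm (v : C3) : R :=
  Num.sqrt (\sum_k (complex.Re (v 0 k) ^+ 2 + complex.Im (v 0 k) ^+ 2)).

Definition setdist E U : R := inf [set enorm (x - y) | x in E & y in U].

Definition frontier E : set pt := closure E `\` interior E.

Definition topological_surface E : Prop :=
  forall x, E x -> exists (U : set pt) (h : pt -> 'rV[R]_2) (g : 'rV[R]_2 -> pt),
    [/\ open U, U x,
        {within E `&` U, continuous h} /\ continuous g,
        (forall y, (E `&` U) y -> g (h y) = y) &
        (forall z, (E `&` U) (g z) /\ h (g z) = z)].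

Definition jordan_domain Omega : Prop :=
  [/\ bounded_set Omega, connected Omega, open Omega,
      compact (frontier Omega) & topological_surface (frontier Omega)].

(* 0%E is added so that the empty set has diameter 0.                         *)
Definition ediam E : \bar R :=
  ereal_sup (0%E |` [set (enorm (x - y))%:E | x in E & y in E]).

Definition hausdorff_content s (d : R) E : \bar R :=
  ereal_inf [set (\sum_(0 <= k <oo) ediam (U k) `^ s)%E |
    U in [set U : nat -> set pt | E `<=` \bigcup_k U k /\
                                  forall k, (ediam (U k) <= d%:E)%E]].

Definition hausdorff_measure s E : \bar R :=
  ereal_sup [set hausdorff_content s d E | d in [set d | 0 < d]].

Definition hausdorff_dim E : \bar R :=
  ereal_inf [set s%:E | s in [set s | 0 < s /\ hausdorff_measure s E = 0%E]].

Definition fractal E : Prop := (2%:E < hausdorff_dim E)%E.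

(* Least number of closed balls of radius r that cover E. *)
Definition covering_number E (r : R) : R :=
  inf [set n%:R | n in [set n : nat | exists c : 'I_n -> pt,
    E `<=` [set x | exists k, enorm (x - c k) <= r]]].

(* Upper box dimension. *)
Definition minkowski_dim E : \bar R :=
  limf_esup (fun r : R => (ln (covering_number E r) / - ln r)%:E) (0^'+).

Definition pd (k : 'I_3) (g : pt -> R) x : R := 'D_(delta_mx 0 k) g x.

(* Class C^n on an open set U. The total function pd k g is only meaningful    *)
(* on U, and only its germs at points of U are used.                          *)
Fixpoint Cn n U (g : pt -> R) : Prop :=
  (forall x, U x -> {for x, continuous g}) /\
  if n is n'.+1 then
    forall k, (forall x, U x -> derivable g x (delta_mx 0 k)) /\
              Cn n' U (pd k g)
  else True.

Definition Re_comp (F : pt -> C3) k x : R := complex.Re (F x 0 k).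
Definition Im_comp (F : pt -> C3) k x : R := complex.Im (F x 0 k).

Definition CnV n U (F : pt -> C3) : Prop :=
  forall k, Cn n U (Re_comp F k) /\ Cn n U (Im_comp F k).

Definition smoothV U (F : pt -> C3) : Prop := forall n, CnV n U F.

Definition LipV mu E (F : pt -> C3) : Prop :=
  exists c : R, forall x y, E x -> E y ->
    cnorm (F x - F y) <= c * enorm (x - y) `^ mu.

(* R[i] carries no normed R-module structure in the library, hence the        *)
(* separate treatment of real and imaginary parts.                            *)
Definition pdC (k : 'I_3) (g : pt -> R[i]) x : R[i] :=
  pd k (fun y => complex.Re (g y)) x +i* pd k (fun y => complex.Im (g y)) x.

Definition pdH (k : 'I_3) (f : pt -> HC) x : HC :=
  Quat (pdC k (fun y => q0 (f y)) x) (pdC k (fun y => q1 (f y)) x)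
       (pdC k (fun y => q2 (f y)) x) (pdC k (fun y => q3 (f y)) x).

Definition qexp theta : HC := (cos theta)%:C *: (1 : HC) + (sin theta)%:C *: qi.

Definition psiD theta (f : pt -> HC) x : HC :=
  qi * pdH 0 f x + qi * qexp theta * qj * pdH 1 f x
  + qexp theta * qj * pdH 2 f x.

Definition psi_var theta x : HC :=
  (x 0 0)%:C *: qi + (x 0 1)%:C *: (qi * qexp theta * qj)
  + (x 0 2)%:C *: (qexp theta * qj).

Definition psi_kernel theta x : HC :=
  (- (4 * pi)^-1 / enorm x ^+ 3)%:C *: psi_var theta x.

Definition generalized_laplacian theta U (F : pt -> C3) : Prop :=
  smoothV U F /\ forall x, U x -> psiD theta (fun y => vec_to_quat (F y)) x = 0.

(* Cubes: (k, z) stands for the closed cube of side 2^-k with least corner    *)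
(* 2^-k z. Levels start at 0, so level k here is the k+1-st generation.       *)
Definition dcube : Type := (nat * 'rV[int]_3)%type.

Definition side (Q : dcube) : R := 2 ^- Q.1.
Definition cube (Q : dcube) : set pt := [set x | forall k,
  (Q.2 0 k)%:~R * side Q <= x 0 k <= (Q.2 0 k + 1)%:~R * side Q].
Definition centre (Q : dcube) : pt :=
  \row_k (((Q.2 0 k)%:~R + 2^-1) * side Q).

Fixpoint grid Omega (n : nat) : set 'rV[int]_3 :=
  if n is n'.+1 then
    [set z | exists2 w, grid Omega n' w &
       forall k, z 0 k = 2 * w 0 k \/ z 0 k = 2 * w 0 k + 1]
  else [set z | cube (0%N, z) `&` Omega !=set0].

Definition whitney_candidate Omega (n : nat) (z : 'rV[int]_3) : Prop :=
  [/\ grid Omega n z, cube (n, z) `<=` Omega &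
      forall w, grid Omega n w -> cube (n, w) `&` cube (n, z) !=set0 ->
        cube (n, w) `<=` Omega].

Fixpoint whitney_below Omega (n : nat) : set dcube :=
  if n is n'.+1 then
    whitney_below Omega n' `|`
    [set Q | [/\ Q.1 = n', whitney_candidate Omega n' Q.2 &
       forall P, whitney_below Omega n' P -> ~ (cube Q `<=` cube P)]]
  else set0.

Definition whitney Omega : set dcube := \bigcup_n whitney_below Omega n.

Definition whitney_bump (eps : R) (phi : pt -> R) : Prop :=
  [/\ forall n, Cn n setT phi,
      forall x, 0 <= phi x <= 1,
      forall x, (forall k, `|x 0 k| <= 2^-1) -> phi x = 1 &
      forall x, ~ (forall k, `|x 0 k| <= (1 + eps) / 2) -> phi x = 0].

Definition nearest_points Omega Gamma (p : dcube -> pt) : Prop :=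
  forall Q, whitney Omega Q ->
    Gamma (p Q) /\ setdist (cube Q) Gamma = setdist (cube Q) [set p Q].

Definition bump_at (phi : pt -> R) (Q : dcube) x : R :=
  phi ((side Q)^-1 *: (x - centre Q)).

Definition partition_fun Omega (phi : pt -> R) (Q : dcube) x : R :=
  bump_at phi Q x / \sum_(P \in whitney Omega) bump_at phi P x.

(* \sum_(Q \in A) is the sum over the support, here finite at each point.     *)
Definition whitney_op Omega Gamma phi p (f : pt -> C3) x : C3 :=
  if `[< Gamma x >] then f x
  else \sum_(Q \in whitney Omega) ((partition_fun Omega phi Q x)%:C *: f (p Q)).

Definition truncated_ext Omega Gamma phi p (f : pt -> C3) x : C3 :=
  if `[< Omega x \/ Gamma x >] then whitney_op Omega Gamma phi p f x else 0.

(* d k l is the derivative of the component with index k in direction l;      *)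
(* indices run over 0, 1, 2.                                                  *)
Definition V_field theta (fw : pt -> C3) x : C3 :=
  let d k l := pdC l (fun y => fw y 0 k) x in
  let c := (cos theta)%:C in
  let s := (sin theta)%:C in
  \row_k [:: (d 2 2 - d 1 1) * c - (d 2 1 + d 1 2) * s;
             - d 2 0 + d 0 2 * s + d 0 1 * c;
             d 1 0 - d 0 2 * c + d 0 1 * s]`_k.

Definition leb := @lebesgue_measure R.
Definition leb3 := (leb \x (leb \x leb))%E.

Definition point_of (q : R * (R * R)) : pt :=
  \row_k [:: q.1; q.2.1; q.2.2]`_k.

(* Convergence is required: the library integral is total.                    *)
Definition zero_integral3 E (g : pt -> R) : Prop :=
  let D := point_of @^-1` E in
  leb3.-integrable D (EFin \o g \o point_of) /\
  (\int[leb3]_(q in D) (g (point_of q))%:E = 0)%E.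

(* Only values of g on Omega and on Gamma matter, and no continuity across    *)
(* Gamma is required.                                                         *)
Definition Mstar theta mu Omega Gamma (g : pt -> C3) : Prop :=
  [/\ CnV 1 Omega g, LipV mu Gamma g &
      forall x, Gamma x ->
        let h xi := bilin (vec_part (psi_kernel theta (x - xi))) (g xi) in
        zero_integral3 Omega (fun xi => complex.Re (h xi)) /\
        zero_integral3 Omega (fun xi => complex.Im (h xi))].

Definition continuousV_on E (F : pt -> C3) : Prop :=
  forall k, {within E, continuous (Re_comp F k)} /\
            {within E, continuous (Im_comp F k)}.

Definition laplacian_extension theta U Gamma (f F : pt -> C3) : Prop :=
  [/\ generalized_laplacian theta U F, continuousV_on (U `|` Gamma) F &
      forall t, Gamma t -> F t = f t].

Definition vanishes_at_infinity U (F : pt -> C3) : Prop :=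
  forall e : R, 0 < e -> exists M : R, forall x, U x -> M < enorm x ->
    cnorm (F x) < e.

End Field.

(* Main.v *)
(** The structure constants of the problem are real, so the real and imaginary
parts of f^w separate. For a real triple w = (w_1, w_2, w_3), let rho^m be the
gradient of w_m on Omega, extended by 0. The hypothesis mu > alpha(Gamma)/3 puts
rho^m in L^p for some p > 3: a Whitney cube of side l contributes
|grad w_m| <= C l^(mu-1), and Gamma is covered by about 2^(ks) balls of radius
2^-k, with s < 3 mu. Convolving rho^m with the gradient of the Newton kernel then
gives functions that are continuous on the whole space and vanish at infinity:
a scalar t_m and a vector B_m. These satisfy grad t_m = curl B_m, div B_m = 0 off
the closure of Omega. On Omega the same holds with t_m - c w_m in place of t_m,
c = 4 pi.

Hence T = sum_m (t_m + psi . B_m) e_m is annihilated by psi^D outside and T - c w is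
annihilated inside. Only the scalar part T_0 of T prevents the vector parts from being
solutions. T_0 is a combination of the B_m, hence harmonic on both sides and
continuous across Gamma; it vanishes at infinity, and on Gamma by the hypothesis
on V. By the maximum principle T_0 = 0, and F^- = vec T / c, F^+ = f^w - F^-
solve the problem. *)

From HB Require Import structures.
Require Import Defs.
From mathcomp Require Import all_boot all_order all_algebra.
From mathcomp Require Import all_classical all_reals all_analysis.
From mathcomp Require Import measurable_realfun complex lra ring.

Set Implicit Arguments.
Unset Strict Implicit.
Unset Printing Implicit Defensive.

Import Order.TTheory GRing.Theory Num.Theory.
Import numFieldNormedType.Exports.

Local Open Scope classical_set_scope.
Local Open Scope ring_scope.

(** A fractal boundary has no surface measure and no normal, so neither Stokes' theorem nor a
    boundary integral is available. Integration by parts is used only for compactly supported C^1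
    functions, where it reduces to translation invariance of Lebesgue measure. For the gradient of
    such a function u, t = c u and B = 0. Near a point of Omega, w coincides with such a u, and the
    difference of the two densities vanishes there; so every interior statement is about potentials
    off their support, and no singular integral is differentiated. The bound p > 3 comes from
    Young's inequality: the kernel has size |y|^-2, which is in L^q near 0 exactly for q < 3/2. It
    makes the contribution near the pole small uniformly in x, hence the continuity across Gamma
    that the maximum principle needs. The structural set is left-handed, psi_1 psi_2 = - psi_3,
    which is why t + psi . B, with this sign, is annihilated. The pairing of the kernel with V is
    -1/(4 pi) times the integrand of T_0, whence the boundary values of T_0. The value of c is never
    computed; its positivity suffices. *)

Section Coordinates.
Variable R : realType.
Local Notation pt := 'rV[R]_3.
Implicit Types (x y : pt).

Lemma ord3P (k : 'I_3) : [\/ k = 0, k = 1 | k = 2].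
Proof.
case: k => -[|[|[|//]]] ik; [apply: Or31|apply: Or32|apply: Or33]; exact/val_inj.
Qed.

Lemma sum3 (V : nmodType) (F : 'I_3 -> V) : \sum_k F k = F 0 + F 1 + F 2.
Proof.
rewrite !big_ord_recl big_ord0 addr0 addrA.
by congr (_ + _ + _); congr F; exact/val_inj.
Qed.

Lemma norm_rVleP x (r : R) : 0 <= r -> reflect (forall k, `|x 0 k| <= r) (`|x| <= r).
Proof.
move=> r0; have -> : `|x| = mx_norm x by []; rewrite mx_normrE.
apply: (iffP (bigmax_leP _ _ _ _)) => [[_ h] k|h]; first exact: (h (0, k)).
by split => // -[i k] _; rewrite ord1; exact: h.
Qed.

Lemma norm_rVltP x (r : R) : 0 < r -> reflect (forall k, `|x 0 k| < r) (`|x| < r).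
Proof.
move=> r0; have -> : `|x| = mx_norm x by []; rewrite mx_normrE.
apply: (iffP (bigmax_ltP _ _ _ _)) => [[_ h] k|h]; first exact: (h (0, k)).
by split => // -[i k] _; rewrite ord1; exact: h.
Qed.

Lemma coord_le_norm x k : `|x 0 k| <= `|x|.
Proof. by have /norm_rVleP := lexx `|x|; apply. Qed.

Lemma nbhs_normP (x : pt) (A : set pt) :
  nbhs x A <-> exists2 r : R, 0 < r & forall y, `|y - x| < r -> A y.
Proof.
split=> [/nbhs_ballP[r /= r0 rA]|[r r0 rA]].
  exists r => // y yx; apply: rA; rewrite mx_norm_ball /ball_ /= distrC//.
apply/nbhs_ballP; exists r => //= y; rewrite mx_norm_ball /ball_ /= distrC.
exact: rA.
Qed.

Lemma open_normP (A : set pt) :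
  open A <-> forall x, A x -> exists2 r : R, 0 < r & forall y, `|y - x| < r -> A y.
Proof.
rewrite openE; split=> [h x /h|h x /h]; rewrite /interior; by move/nbhs_normP.
Qed.

Lemma closed_norm_le (c : pt) (r : R) : closed [set x | `|x - c| <= r].
Proof.
rewrite -openC; apply/open_normP => x /= /negP; rewrite -ltNge => h.
exists (`|x - c| - r) => [|y yx]; first by rewrite subr_gt0.
apply/negP; rewrite -ltNge; rewrite ltrBrDl -ltrBrDr in yx.
apply: (lt_le_trans yx); rewrite lerBlDr.
have -> : x - c = (y - c) - (y - x) by rewrite opprB [RHS]addrC subrKA.
exact: ler_normB.
Qed.

Lemma floor_cube (n : nat) x :
  cube (n, \row_k Num.floor (x 0 k * 2 ^+ n)) x.
Proof.
move=> k /=; rewrite /side /= mxE.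
have p2 : 0 < (2 : R) ^+ n by exact: exprn_gt0.
by rewrite ler_pdivrMr// ler_pdivlMr// floor_le /= ltW// floorD1_gt.
Qed.

Lemma side_gt0 (Q : dcube) : 0 < side R Q.
Proof. by rewrite /side invr_gt0 exprn_gt0. Qed.

Lemma cube_dist (Q : dcube) x y : cube Q x -> cube Q y -> `|x - y| <= side R Q.
Proof.
move=> Qx Qy; apply/norm_rVleP; first exact/ltW/side_gt0.
move=> k; rewrite !mxE; have /andP[x1 x2] := Qx k; have /andP[y1 y2] := Qy k.
rewrite intrD mulrDl mul1r in x2 y2.
rewrite ler_norml; apply/andP; split; lra.
Qed.

Lemma exp2inv_lt (r : R) : 0 < r -> exists n : nat, forall m, (n <= m)%N -> (2 : R) ^- m < r.
Proof.
move=> r0; exists (Num.truncn r^-1).+1 => m nm.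
have h : r^-1 < 2 ^+ m.
  have [_ h] : True /\ r^-1 < (Num.truncn r^-1).+1%:R.
    by split => //; rewrite truncnS_gt.
  apply: (lt_le_trans h); rewrite -natrX ler_nat (leq_trans nm)//.
  by rewrite ltnW// ltn_expl.
by rewrite -[ltRHS]invrK ltf_pV2 ?posrE ?invr_gt0// exprn_gt0.
Qed.

(** Dyadic cubes are indexed by the countable type [dcube], so this reduces measurability of open
    sets to that of cubes. *)
Lemma open_bigcup_cube (U : set pt) : open U ->
  U = \bigcup_(Q in [set Q : dcube | cube Q `<=` U]) cube Q.
Proof.
move=> /open_normP oU; apply/seteqP; split=> [x Ux|x [Q QU Qx]]; last exact: QU.
have [r r0 rU] := oU _ Ux.
have [n nr] := exp2inv_lt r0.
exists (n, \row_k Num.floor (x 0 k * 2 ^+ n)); last exact: floor_cube.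
move=> y Qy; apply: rU.
by rewrite (le_lt_trans (cube_dist Qy (floor_cube n x)))// nr.
Qed.

End Coordinates.

(** * Lebesgue measure on the space and integrals over it *)

Section ProductMeasure.
Local Open Scope ereal_scope.
Variables (d1 d2 : measure_display) (T1 : measurableType d1)
  (T2 : measurableType d2) (R : realType).
Variables (m1 : {sigma_finite_measure set T1 -> \bar R})
  (m2 : {sigma_finite_measure set T2 -> \bar R}).

(* A copy of the product measure that carries a sigma-finite structure, so that the
   product can be iterated. *)
Definition prodm : set (T1 * T2)%type -> \bar R := m1 \x m2.

Let M := lebesgue_integral_fubini_product_measure1__canonical__measure_function_Measure m1 m2.

HB.instance Definition _ := isMeasure.Build _ _ _ prodm
  (measure0 M) (measure_ge0 M) (@measure_semi_sigma_additive _ _ _ M).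

Lemma prodm_sigma_finite : sigma_finite setT prodm.
Proof.
have /sigma_finiteP[F [TF ndF Foo]] := sigma_finiteT m1.
have /sigma_finiteP[G [TG ndG Goo]] := sigma_finiteT m2.
exists (fun n => F n `*` G n).
  rewrite -setXTT TF TG predeqE => -[x y]; split.
    move=> [/= [n _ Fnx] [k _ Gky]]; exists (maxn n k) => //; split.
    - by move: x Fnx; exact/subsetPset/ndF/leq_maxl.
    - by move: y Gky; exact/subsetPset/ndG/leq_maxr.
  by move=> [n _ []/= ? ?]; split; exists n.
move=> k; have [? ?] := Foo k; have [? ?] := Goo k.
split; first exact: measurableX.
by rewrite /prodm product_measure1E// lte_mul_pinfty// ge0_fin_numE.
Qed.

HB.instance Definition _ := Measure_isSigmaFinite.Build _ _ _ prodm prodm_sigma_finite.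

(** The pushforward and the product measure agree on measurable rectangles, which determine a
    product of sigma-finite measures. Applied twice, this carries translation invariance from the
    line to the space. *)
Lemma prodm_preserved (f1 : T1 -> T1) (f2 : T2 -> T2) :
  measurable_fun setT f1 -> measurable_fun setT f2 ->
  (forall A, measurable A -> m1 (f1 @^-1` A) = m1 A) ->
  (forall A, measurable A -> m2 (f2 @^-1` A) = m2 A) ->
  forall A, measurable A -> prodm ((fun q => (f1 q.1, f2 q.2)) @^-1` A) = prodm A.
Proof.
move=> mf1 mf2 h1 h2 A mA.
have mf : measurable_fun setT (fun q : T1 * T2 => (f1 q.1, f2 q.2)).
  by apply: measurable_fun_pair; apply: measurableT_comp.
have := @product_measure_unique _ _ _ _ _ m1 m2 (pushforward prodm (fun q => (f1 q.1, f2 q.2))).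
move=> /(_ mf) PU; rewrite [RHS](PU _ A mA)// => {PU} B C mB mC.
transitivity ((m1 \x m2) ((f1 @^-1` B) `*` (f2 @^-1` C))); first by [].
have mB' : measurable (f1 @^-1` B) by rewrite -[_ @^-1` _]setTI; exact: mf1.
have mC' : measurable (f2 @^-1` C) by rewrite -[_ @^-1` _]setTI; exact: mf2.
rewrite product_measure1E//; congr (_ * _); [exact: h1|exact: h2].
Qed.

End ProductMeasure.

Section Lebesgue3.
Local Open Scope ereal_scope.
Variable R : realType.
Local Notation mR := (measurableTypeR R).

Definition lam : set (mR * (mR * mR)) -> \bar R :=
  prodm (@lebesgue_measure R) (prodm (@lebesgue_measure R) (@lebesgue_measure R)).

HB.instance Definition _ := SigmaFiniteMeasure.on lam.

Lemma lamE (A B C : set R) : measurable A -> measurable B -> measurable C ->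
  lam (A `*` (B `*` C)) = lebesgue_measure A * (lebesgue_measure B * lebesgue_measure C).
Proof.
move=> mA mB mC; rewrite /lam /prodm product_measure1E //; last exact: measurableX.
by rewrite /= /prodm product_measure1E.
Qed.

Lemma lebesgue_measure_shift (a : R) (A : set R) : measurable A ->
  lebesgue_measure ((fun x => x + a)%R @^-1` A) = lebesgue_measure A.
Proof.
move=> mA.
have ms : measurable_fun setT (fun x : mR => (x + a)%R : mR).
  by apply: measurable_funD => //.
have := @lebesgue_measure_unique R (pushforward (@lebesgue_measure R) (fun x : mR => (x + a)%R : mR)).
move=> /(_ ms) PU; rewrite [RHS](PU _ A mA)// => {PU} _ [[b c]] _ <-.
transitivity (lebesgue_measure (`](b - a)%R, (c - a)%R]%classic : set R)).
  rewrite !lebesgue_measure_itv /= !lte_fin ltrD2r; case: ifP => // _.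
  by rewrite -!EFinB; congr (_%:E); ring.
congr (lebesgue_measure _).
by apply/seteqP; split=> x /=; rewrite !in_itv /= => /andP[? ?]; apply/andP; split; lra.
Qed.

Definition shift3 (a : R * (R * R)) (q : mR * (mR * mR)) : mR * (mR * mR) :=
  (q.1 + a.1, (q.2.1 + a.2.1, q.2.2 + a.2.2))%R.

Lemma measurable_shift3 a : measurable_fun setT (shift3 a).
Proof.
have ms b : measurable_fun setT (fun x : mR => (x + b)%R : mR).
  by apply: measurable_funD.
apply: measurable_fun_pair => /=.
  by apply: (measurableT_comp (ms _)).
apply: measurable_fun_pair => /=.
  apply: (measurableT_comp (ms _)).
  exact: (measurableT_comp measurable_fst measurable_snd).
apply: (measurableT_comp (ms _)).
exact: (measurableT_comp measurable_snd measurable_snd).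
Qed.

Lemma lam_shift3 a (A : set (mR * (mR * mR))) : measurable A ->
  lam (shift3 a @^-1` A) = lam A.
Proof.
move=> mA.
have ms b : measurable_fun setT (fun x : mR => (x + b)%R : mR).
  by apply: measurable_funD.
apply: (@prodm_preserved _ _ _ _ _ _ _ (fun x : mR => (x + a.1)%R : mR)
  (fun q : mR * mR => (q.1 + a.2.1, q.2 + a.2.2)%R : mR * mR)) => //.
- apply: measurable_fun_pair; [exact: (measurableT_comp (ms _) measurable_fst)|exact: (measurableT_comp (ms _) measurable_snd)].
- by move=> B mB; exact: lebesgue_measure_shift.
- move=> B mB.
  apply: (@prodm_preserved _ _ _ _ _ _ _ (fun x : mR => (x + a.2.1)%R : mR)
    (fun x : mR => (x + a.2.2)%R : mR)) => // C mC; exact: lebesgue_measure_shift.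
Qed.

End Lebesgue3.

Section Integral.
Variable R : realType.
Local Notation pt := 'rV[R]_3.
Local Notation P := (@point_of R).
Implicit Types (f g h : pt -> R) (U : set pt) (x a : pt).

(* Functions on row vectors are measured and integrated through the bijection
   [point_of] with R * (R * R). *)
Definition msr g := measurable_fun setT (g \o P).
Definition msrs U := measurable (P @^-1` U).
Definition itg g := (@lam R).-integrable setT (EFin \o (g \o P)).
Definition intg g : R := \int[@lam R]_q g (P q).

Lemma point_of0 q : P q 0 0 = q.1. Proof. by rewrite mxE. Qed.
Lemma point_of1 q : P q 0 1 = q.2.1. Proof. by rewrite mxE. Qed.
Lemma point_of2 q : P q 0 2 = q.2.2. Proof. by rewrite mxE. Qed.

Definition of_point x : R * (R * R) := (x 0 0, (x 0 1, x 0 2)).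
Lemma msr_cst c : msr (fun=> c).
Proof. exact: measurable_cst. Qed.

Lemma msr_coord k : msr (fun x => x 0 k).
Proof.
rewrite /msr.
have h (F : R * (R * R) -> R) : (forall q, P q 0 k = F q) -> measurable_fun setT (F : measurableTypeR R * (measurableTypeR R * measurableTypeR R) -> measurableTypeR R) ->
    measurable_fun setT ((fun x : pt => x 0 k) \o P).
  by move=> FE; apply: eq_measurable_fun => q _; rewrite /= FE.
case: (ord3P k) h => -> h.
- exact: (h _ point_of0 measurable_fst).
- exact: (h _ point_of1 (measurableT_comp measurable_fst measurable_snd)).
- exact: (h _ point_of2 (measurableT_comp measurable_snd measurable_snd)).
Qed.

Lemma msrD f g : msr f -> msr g -> msr (fun x => f x + g x).
Proof. exact: measurable_funD. Qed.

Lemma msrB f g : msr f -> msr g -> msr (fun x => f x - g x).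
Proof. exact: measurable_funB. Qed.

Lemma msrM f g : msr f -> msr g -> msr (fun x => f x * g x).
Proof. exact: measurable_funM. Qed.

Lemma msr_comp (F : R -> R) g : measurable_fun setT F -> msr g -> msr (fun x => F (g x)).
Proof. by move=> mF mg; exact: (measurableT_comp mF mg). Qed.

Lemma msr_norm g : msr g -> msr (fun x => `|g x|).
Proof. by apply: msr_comp; exact: normr_measurable. Qed.

Lemma msr_powR g p : msr g -> msr (fun x => g x `^ p).
Proof. by apply: (msr_comp (F := fun t => t `^ p)); exact: measurable_powR. Qed.

Lemma msrs_cube (Q : dcube) : msrs (cube Q).
Proof.
rewrite /msrs.
have h (k : 'I_3) : measurable (P @^-1` [set x | (Q.2 0 k)%:~R * side R Q <= x 0 k <= (Q.2 0 k + 1)%:~R * side R Q]).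
  have := @msr_coord k measurableT _ (measurable_itv `[(Q.2 0 k)%:~R * side R Q, (Q.2 0 k + 1)%:~R * side R Q]).
  by rewrite setTI; congr (measurable _); apply/seteqP; split=> q /=; rewrite in_itv.
have := measurableI _ _ (measurableI _ _ (h 0) (h 1)) (h 2).
congr (measurable _); apply/seteqP; split=> q /=; first by move=> [[? ?] ?] k; case: (ord3P k) => ->.
by move=> Qq; split; first split; apply: Qq.
Qed.

Lemma msrs_open U : open U -> msrs U.
Proof.
move=> oU; rewrite /msrs (open_bigcup_cube oU) preimage_bigcup bigcup_mkcond.
apply: countable_bigcupT_measurable => [|Q]; first exact: countableP.
by case: ifP => // _; exact: msrs_cube.
Qed.

Lemma msrs_closed U : closed U -> msrs U.
Proof.
by rewrite -openC => /msrs_open h; rewrite /msrs -[U]setCK preimage_setC; exact: measurableC.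
Qed.

Lemma indic_point_of U : \1_U \o P = \1_(P @^-1` U) :> (_ -> R).
Proof.
by apply/funext => q; rewrite /= !indicE; congr (_%:R); apply/idP/idP; rewrite !inE.
Qed.

Lemma msr_indic U : msrs U -> msr \1_U.
Proof. by move=> mU; rewrite /msr indic_point_of; exact: measurable_indic. Qed.

Lemma msr_gtP g : (forall c, msrs [set x | c < g x]) -> msr g.
Proof.
move=> h; apply: (measurability _ (RGenOInfty.measurableE R)) => //.
move=> /= _ [_ [c ->] <-]; rewrite setTI; have := h c.
by congr (measurable _); apply/seteqP; split=> q /=; rewrite in_itv /= andbT.
Qed.

(** Superlevel sets at levels c >= 0 are open; for c < 0 they also contain the whole complement of
    [U], where the patched function is 0. *)
Lemma msr_open_patch U g : open U -> (forall x, U x -> {for x, continuous g}) ->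
  msr (g \_ U).
Proof.
move=> oU cg; apply: msr_gtP => c.
have mV : msrs [set x | U x /\ c < g x].
  apply: msrs_open; apply/open_normP => x [Ux cgx].
  have := cg x Ux; rewrite /continuous_at => /(cvgr_gt (g x)) /(_ _ cgx) cgy.
  have /nbhs_normP[r r0 rU] : nbhs x (fun y => U y /\ c < g y).
    apply: filterI => //; apply: open_nbhs_nbhs; split => //.
  by exists r.
case: (ltP c 0) => c0.
  have -> : [set x | c < (g \_ U) x] = [set x | U x /\ c < g x] `|` ~` U.
    apply/seteqP; split=> x /=; rewrite patchE; case: ifPn; rewrite ?inE ?notin_setE => Ux //.
    - by move=> ?; left.
    - by right.
    - by case=> [[]|].
  by rewrite /msrs preimage_setU preimage_setC; apply: measurableU => //; apply: measurableC; exact: msrs_open.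
have -> : [set x | c < (g \_ U) x] = [set x | U x /\ c < g x] => //.
apply/seteqP; split=> x /=; rewrite patchE; case: ifPn; rewrite ?inE ?notin_setE => Ux //.
- by rewrite ltNge c0.
- by case.
- by case.
Qed.

Lemma msr_cont g : continuous g -> msr g.
Proof.
move=> cg; have := @msr_open_patch setT g openT (fun x _ => cg x).
by congr msr; apply/funext => x; rewrite patchE in_setT.
Qed.

Lemma itg_msr g : itg g -> msr g.
Proof. by move=> /measurable_int /measurable_EFinP. Qed.

Lemma itgD f g : itg f -> itg g -> itg (fun x => f x + g x).
Proof.
move=> mf mg; have := integrableD measurableT mf mg.
by apply: eq_integrable => // q _; rewrite /= EFinD.
Qed.

Lemma itgZ c g : itg g -> itg (fun x => c * g x).
Proof.
move=> mg; have := integrableZl measurableT c mg.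
by apply: eq_integrable => // q _; rewrite /= EFinM.
Qed.

Lemma itgN g : itg g -> itg (fun x => - g x).
Proof.
by move=> /(itgZ (-1)); congr itg; apply/funext => x; rewrite mulN1r.
Qed.

Lemma itgB f g : itg f -> itg g -> itg (fun x => f x - g x).
Proof. by move=> mf mg; apply: itgD => //; exact: itgN. Qed.

Lemma itg_le f g : msr f -> (forall x, `|f x| <= g x) -> itg g -> itg f.
Proof.
move=> mf fg ig; apply: (le_integrable measurableT _ _ ig) => [|q _] /=.
  exact/measurable_EFinP.
by rewrite lee_fin (le_trans (fg _))// ler_norm.
Qed.

Lemma itg_norm g : itg g -> itg (fun x => `|g x|).
Proof. by move=> ig; exact: (integrable_norm ig). Qed.

Lemma intg0 : intg (fun=> 0) = 0.
Proof. by rewrite /intg /Rintegral integral0. Qed.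

Lemma intgD f g : itg f -> itg g -> intg (fun x => f x + g x) = intg f + intg g.
Proof. by move=> mf mg; rewrite /intg RintegralD. Qed.

Lemma intgZ c g : itg g -> intg (fun x => c * g x) = c * intg g.
Proof. by move=> mg; rewrite /intg RintegralZl. Qed.

Lemma intgB f g : itg f -> itg g -> intg (fun x => f x - g x) = intg f - intg g.
Proof. by move=> mf mg; rewrite /intg RintegralB. Qed.

Lemma intgN g : itg g -> intg (fun x => - g x) = - intg g.
Proof. by move=> ig; rewrite -[RHS]mulN1r -intgZ//; congr intg; apply/funext => x; rewrite mulN1r. Qed.

Lemma intg_le f g : itg f -> itg g -> (forall x, f x <= g x) -> intg f <= intg g.
Proof. by move=> mf mg fg; rewrite /intg; apply: le_Rintegral. Qed.

Lemma intg_ge0 g : (forall x, 0 <= g x) -> 0 <= intg g.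
Proof. by move=> g0; apply: Rintegral_ge0. Qed.

Lemma intg_norm g : itg g -> `|intg g| <= intg (fun x => `|g x|).
Proof. by move=> ig; exact: le_normr_Rintegral. Qed.

Lemma eq_intg f g : f =1 g -> intg f = intg g.
Proof. by move=> /funext ->. Qed.

Lemma eq_itg f g : f =1 g -> itg f -> itg g.
Proof. by move=> /funext ->. Qed.

Lemma EFin_intg g : itg g -> (intg g)%:E = (\int[@lam R]_q (g (P q))%:E)%E.
Proof. by move=> ig; rewrite /intg /Rintegral fineK//; exact: integrable_fin_num. Qed.

Lemma intg_dct (f : nat -> pt -> R) g h :
  (forall n, msr (f n)) -> (forall x, f n x @[n --> \oo] --> g x) ->
  itg h -> (forall n x, `|f n x| <= h x) ->
  itg g /\ intg (f n) @[n --> \oo] --> intg g.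
Proof.
move=> mf fg ih fh.
have mf' n : measurable_fun setT (EFin \o (f n \o P)) by apply/measurable_EFinP; exact: mf.
have fg' q : setT q -> (EFin \o (f n \o P)) q @[n --> \oo] --> (EFin \o (g \o P)) q.
  by move=> _; apply: cvg_EFin; [exact: nearW|exact: fg].
have fh' n q : setT q -> (`|(EFin \o (f n \o P)) q| <= (EFin \o (h \o P)) q)%E.
  by move=> _; rewrite /= lee_fin.
have mg : measurable_fun setT (EFin \o (g \o P)) by exact: (emeasurable_fun_cvg _ _ mf' fg').
have [] := @dominated_convergence _ _ _ (@lam R) setT measurableT (fun n => EFin \o (f n \o P)) (EFin \o (g \o P)) (EFin \o (h \o P)) mf' mg.
- by apply: aeW => q; exact: fg'.
- exact: ih.
- by apply: aeW => q n; exact: fh'.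
move=> ig _ cv; split => //.
apply: fine_cvg; rewrite fineK; first exact: cv.
exact: integrable_fin_num.
Qed.

End Integral.

Section Boxes.
Variable R : realType.
Local Notation pt := 'rV[R]_3.
Local Notation P := (@point_of R).
Implicit Types (f g h : pt -> R) (U : set pt) (x a : pt).

Lemma point_of_shift a q : P (shift3 (of_point a) q) = P q + a.
Proof. by apply/rowP => k; case: (ord3P k) => ->; rewrite !mxE. Qed.

Lemma msr_shift g a : msr g -> msr (fun x => g (x + a)).
Proof.
move=> mg; have := measurableT_comp mg (@measurable_shift3 R (of_point a)).
by apply: eq_measurable_fun => q _; rewrite /= point_of_shift.
Qed.

(** The change of variables is made for nonnegative functions first; positive and negative parts
    then give the signed case. *)
Lemma shift_pushforward g a : itg g ->
  itg (fun x => g (x + a)) /\ intg (fun x => g (x + a)) = intg g.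
Proof.
move=> ig; pose s := shift3 (of_point a).
have ms : measurable_fun setT s by exact: measurable_shift3.
have mg : measurable_fun setT (EFin \o (g \o P)) by apply/measurable_EFinP; exact: itg_msr.
have E F : (forall q, (0 <= F q)%E) -> measurable_fun setT F ->
    (\int[@lam R]_q F (s q) = \int[@lam R]_q F q)%E.
  move=> F0 mF.
  have := @ge0_integral_pushforward _ _ _ _ _ s ms (@lam R) setT F measurableT mF (fun q _ => F0 q).
  rewrite preimage_setT => /= <-.
  by apply: eq_measure_integral => A mA _; exact: lam_shift3.
have ig' : itg (fun x => g (x + a)).
  apply/integrableP; split; first by apply/measurable_EFinP; exact: msr_shift (itg_msr ig).
  rewrite (_ : (\int[_]_(q in _) _ = \int[@lam R]_q `|(g (P q))%:E|)%E).
    by case/integrableP: ig.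
  rewrite -[RHS]E//; last exact: measurableT_comp.
  by apply: eq_integral => q _; rewrite /= point_of_shift.
split => //.
apply: (@EFin_inj R); rewrite !EFin_intg//.
rewrite [LHS]integralE [RHS]integralE; congr (_ - _)%E.
- rewrite -[RHS]E//; last exact: measurable_funepos.
  by apply: eq_integral => q _; rewrite !funeposE /= point_of_shift.
- rewrite -[RHS]E//; last exact: measurable_funeneg.
  by apply: eq_integral => q _; rewrite !funenegE /= point_of_shift.
Qed.

Lemma itg_shift g a : itg g -> itg (fun x => g (x + a)).
Proof. by move=> /(shift_pushforward a)[]. Qed.

Lemma intg_shift g a : itg g -> intg (fun x => g (x + a)) = intg g.
Proof. by move=> /(shift_pushforward a)[]. Qed.

Definition box (c : pt) (r : R) : set pt := [set x | `|x - c| <= r].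

Lemma msrs_box c r : msrs (box c r).
Proof. by apply: msrs_closed; exact: closed_norm_le. Qed.

Lemma lam_box c r : 0 <= r -> @lam R (P @^-1` box c r) = ((2 * r) ^+ 3)%:E.
Proof.
move=> r0.
pose I k : set R := `[c 0 k - r, c 0 k + r]%classic.
have mI k : @lebesgue_measure R (I k) = (2 * r)%:E.
  rewrite lebesgue_measure_itv /= lte_fin; case: ltP => h.
    by rewrite -EFinB; congr (_%:E); ring.
  by congr (_%:E); lra.
have -> : P @^-1` box c r = I 0 `*` (I 1 `*` I 2).
  apply/seteqP; split=> q /=.
    move=> /norm_rVleP -/(_ r0) h; have := (h 0, (h 1, h 2)).
    rewrite !mxE /= !ler_norml => -[/andP[? ?] [/andP[? ?] /andP[? ?]]].
    by rewrite /I /= !in_itv /=; split; [|split] => /=; apply/andP; split; lra.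
  rewrite /I /= !in_itv /= => -[/andP[? ?] [/andP[? ?] /andP[? ?]]].
  apply/norm_rVleP => // k; case: (ord3P k) => ->;
   by rewrite !mxE ler_norml /=; apply/andP; split; lra.
by rewrite lamE ?mI//; exact: measurable_itv.
Qed.

Lemma integral_indic_point U : msrs U ->
  (\int[@lam R]_q (\1_U (P q))%:E = @lam R (P @^-1` U))%E.
Proof.
move=> mU; transitivity (\int[@lam R]_q (\1_(P @^-1` U) q)%:E)%E.
  by apply: eq_integral => q _; rewrite -indic_point_of.
by have := integral_indic (@lam R) measurableT mU; rewrite setIT.
Qed.

Lemma itg_box c r : 0 <= r -> itg (\1_(box c r)).
Proof.
move=> r0; apply/integrableP; split.
  by apply/measurable_EFinP; apply: msr_indic; exact: msrs_box.
have -> : (\int[@lam R]_q `|(EFin \o (\1_(box c r) \o P)) q| = \int[@lam R]_q (\1_(box c r) (P q))%:E)%E.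
  by apply: eq_integral => q _; rewrite /= ger0_norm// indicE.
by rewrite integral_indic_point ?lam_box ?ltry//; exact: msrs_box.
Qed.

Lemma intg_box c r : 0 <= r -> intg (\1_(box c r)) = (2 * r) ^+ 3.
Proof.
move=> r0; apply: EFin_inj; rewrite EFin_intg ?itg_box//.
by rewrite integral_indic_point ?lam_box//; exact: msrs_box.
Qed.

Lemma itg_bounded g c r (M : R) : 0 <= r -> msr g -> (forall x, `|g x| <= M) ->
  (forall x, ~ box c r x -> g x = 0) -> itg g.
Proof.
move=> r0 mg gM g0; apply: (itg_le mg _ (itgZ M (itg_box c r0))) => x.
rewrite indicE; have [xb|xb] := boolP (x \in box c r); first by rewrite mulr1.
by rewrite mulr0 g0 ?normr0// => xb'; rewrite mem_set in xb.
Qed.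

(** Monotone convergence for the majorant sum_k [a k] 1_([E k]), one term of which already dominates
    |g| wherever g is nonzero. It serves both the dyadic shells around the pole of the kernel and
    the dyadic collars of the boundary. *)
Lemma itg_series (E : nat -> set pt) (a m : nat -> R) (S : R) g :
  (forall k, msrs (E k)) -> (forall k, 0 <= a k) ->
  (forall k, (@lam R (P @^-1` E k) <= (m k)%:E)%E) ->
  (forall n, \sum_(0 <= k < n) a k * m k <= S) ->
  msr g -> (forall x, g x != 0 -> exists2 k, E k x & `|g x| <= a k) ->
  itg g /\ intg (fun x => `|g x|) <= S.
Proof.
move=> mE a0 lm aS mg gE.
pose F k q := ((a k)%:E * (\1_(E k) (P q))%:E)%E.
have F0 k q : (0 <= F k q)%E by rewrite mule_ge0 ?lee_fin// indicE.
have mF k : measurable_fun setT (F k).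
  apply: emeasurable_funM => //; apply/measurable_EFinP; exact: msr_indic.
have B : (\int[@lam R]_q `|(g (P q))%:E| <= S%:E)%E.
  apply: (@le_trans _ _ (\int[@lam R]_q (\sum_(0 <= k <oo) F k q))%E).
    apply: ge0_le_integral => //.
    - by apply/measurable_EFinP; exact: msr_norm.
    - exact: (@ge0_emeasurable_sum _ _ _ setT F xpredT (fun k q _ _ => F0 k q) (fun k _ => mF k)).
    - move=> q _; have [->|/gE[k Ek gk]] := eqVneq (g (P q)) 0.
        by rewrite abse0; apply: nneseries_ge0.
      apply: (@le_trans _ _ (F k q)).
        by rewrite /F indicE mem_set// mule1 lee_fin.
      apply: (le_trans _ (nneseries_lim_ge k.+1 (fun n _ _ => F0 n (q)))).
      by rewrite big_nat_recr//= leeDr// sume_ge0.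
  rewrite integral_nneseries//.
  apply: lime_le; first by apply: is_cvg_nneseries => k _ _; apply: integral_ge0.
  apply: nearW => n.
  apply: (@le_trans _ _ (\sum_(0 <= k < n) a k * m k)%:E); last by rewrite lee_fin.
  rewrite -sumEFin; apply: lee_sum => k _.
  rewrite /F ge0_integralZl//; last 2 first.
  - by apply/measurable_EFinP; exact: msr_indic.
  - by rewrite lee_fin.
  rewrite EFinM; apply: lee_pmul => //; first by rewrite lee_fin.
    by apply: integral_ge0 => q _; rewrite lee_fin indicE.
  by rewrite integral_indic_point//; exact: lm.
have ig : itg g.
  apply/integrableP; split; first exact/measurable_EFinP.
  exact: (le_lt_trans B (ltry _)).
split => //; rewrite -lee_fin EFin_intg; last exact: itg_norm.
exact: B.
Qed.

(** Sequences suffice because the balls of radius 1/(n+1) form a base at x. This opens continuity in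
    a parameter to dominated convergence, which concerns sequences. *)
Lemma seq_cont (T : topologicalType) (g : pt -> T) x :
  (forall u : nat -> pt, u n @[n --> \oo] --> x -> g (u n) @[n --> \oo] --> g x) ->
  {for x, continuous g}.
Proof.
move=> h; apply: contrapT => /existsNP[A /not_implyP[gA nA]].
have H n : exists u : pt, `|u - x| < n.+1%:R^-1 /\ ~ A (g u).
  apply: contrapT => H; apply: nA; apply/nbhs_normP.
  exists n.+1%:R^-1; first by rewrite invr_gt0.
  by move=> y yx; apply: contrapT => nAy; apply: H; exists y.
have [u uP] := choice H.
have ux : u n @[n --> \oo] --> x.
  apply/cvgrPdist_lt => e e0; near=> n.
  rewrite distrC; apply: (lt_trans (uP n).1).
  near: n; exact: near_infty_natSinv_lt (PosNum e0).
have [N _ NA] := h u ux A gA.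
by have := NA N (leqnn _); exact: (uP N).2.
Unshelve. all: by end_near. Qed.

Lemma cont_intg (F : pt -> pt -> R) x h (r : R) : 0 < r -> itg h ->
  (forall y, `|y - x| < r -> msr (F y)) ->
  (forall y z, `|y - x| < r -> `|F y z| <= h z) ->
  (forall z, {for x, continuous (fun y => F y z)}) ->
  {for x, continuous (fun y => intg (F y))}.
Proof.
move=> r0 ih mF Fh cF; apply: seq_cont => u ux.
have [N _ Nr] : \forall n \near \oo, `|u n - x| < r.
  by move/cvgrPdist_lt : ux => /(_ r r0); apply: filterS => n; rewrite distrC.
(* Dropping the first [N] terms keeps the sequence inside the ball where the domination holds. *)
rewrite -(cvg_shiftn N).
have [||||] := @intg_dct _ (fun n => F (u (n + N)%N)) (F x) h => //.
- by move=> n; apply: mF; apply: Nr; exact: leq_addl.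
- move=> z; rewrite (cvg_shiftn N (fun n => F (u n) z)).
  exact: (cvg_comp u (fun y => F y z) ux (cF z)).
- by move=> n z; apply: Fh; apply: Nr; exact: leq_addl.
Qed.

End Boxes.

(** * Potentials of the Newton gradient kernel *)

Section Enorm.
Variable R : realType.
Local Notation pt := 'rV[R]_3.

Lemma enorm_ge0 (x : pt) : 0 <= enorm x. Proof. exact: sqrtr_ge0. Qed.

Lemma enorm_sqr (x : pt) : enorm x ^+ 2 = x 0 0 ^+ 2 + x 0 1 ^+ 2 + x 0 2 ^+ 2.
Proof. by rewrite /enorm sqr_sqrtr ?sum3// !addr_ge0// sqr_ge0. Qed.

Lemma coord_le_enorm (x : pt) k : `|x 0 k| <= enorm x.
Proof.
rewrite -(ler_pXn2r (n := 2)) ?nnegrE ?enorm_ge0// enorm_sqr real_normK ?num_real//.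
have := sqr_ge0 (x 0 0); have := sqr_ge0 (x 0 1); have := sqr_ge0 (x 0 2).
by case: (ord3P k) => ->; lra.
Qed.

Lemma norm_le_enorm (x : pt) : `|x| <= enorm x.
Proof. by apply/norm_rVleP => [|k]; [exact: enorm_ge0|exact: coord_le_enorm]. Qed.

Lemma enorm_le_norm (x : pt) : enorm x <= 2 * `|x|.
Proof.
rewrite -(ler_pXn2r (n := 2)) ?nnegrE ?enorm_ge0 ?mulr_ge0// enorm_sqr exprMn.
have h k : x 0 k ^+ 2 <= `|x| ^+ 2.
  by rewrite -real_normK ?num_real// ler_pXn2r ?nnegrE// coord_le_norm.
have := h 0; have := h 1; have := h 2; have := sqr_ge0 `|x|; lra.
Qed.

Lemma enormN (x : pt) : enorm (- x) = enorm x.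
Proof. by rewrite /enorm; congr Num.sqrt; apply: eq_bigr => k _; rewrite mxE sqrrN. Qed.

Lemma enorm0 : enorm (0 : pt) = 0.
Proof. by apply/eqP; rewrite eq_le enorm_ge0 andbT (le_trans (enorm_le_norm _))// normr0 mulr0. Qed.

Lemma enorm_gt0 (x : pt) : x != 0 -> 0 < enorm x.
Proof. by move=> x0; rewrite (lt_le_trans _ (norm_le_enorm x))// normr_gt0. Qed.

Lemma eq_continuous_for (T U : topologicalType) (f g : T -> U) (z : T) :
  f =1 g -> {for z, continuous f} -> {for z, continuous g}.
Proof. by move=> /funext ->. Qed.

Lemma continuous_sum (T : topologicalType) (V : normedModType R) (I : Type)
    (s : seq I) (f : I -> T -> V) (z : T) :
  (forall i, {for z, continuous (f i)}) ->
  {for z, continuous (fun t => \sum_(i <- s) f i t)}.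
Proof.
move=> cf; elim: s => [|i s IH].
  by apply: (@eq_continuous_for _ _ (fun=> 0)) => [t|]; [rewrite big_nil|exact: cst_continuous].
apply: (@eq_continuous_for _ _ (fun t => f i t + \sum_(i <- s) f i t)) => [t|].
  by rewrite big_cons.
by apply: continuousD; [exact: cf|exact: IH].
Qed.

Lemma enorm_continuous : continuous (@enorm R).
Proof.
move=> x; apply: (@continuous_comp _ _ _ (fun y : pt => \sum_k y 0 k ^+ 2) (@Num.sqrt R) x); last exact: sqrt_continuous.
apply: continuous_sum => k.
apply: (@continuous_comp _ _ _ (fun y : pt => y 0 k) (fun t : R => t ^+ 2) x); first exact: coord_continuous.
exact: exprn_continuous.
Qed.

Lemma msr_enorm : msr (@enorm R).
Proof. exact: msr_cont enorm_continuous. Qed.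

End Enorm.

(** * Integrability of powers of the distance near the pole *)

Section NearField.
Variable R : realType.
Local Notation pt := 'rV[R]_3.

Lemma geometric_le (q : R) n : 0 <= q < 1 -> \sum_(0 <= k < n) q ^+ k <= (1 - q)^-1.
Proof.
move=> /andP[q0 q1]; have q1' : 0 < 1 - q by rewrite subr_gt0.
rewrite -[leRHS]mul1r ler_pdivlMr// big_mkord mulrC -(opprB q) mulNr -subrX1 opprB.
by rewrite gerBl exprn_ge0.
Qed.

Lemma dyadic_shell (t r : R) : 0 < t -> t <= r ->
  exists k : nat, r * 2 ^- k.+1 < t <= r * 2 ^- k.
Proof.
move=> t0 tr; have r0 := lt_le_trans t0 tr.
have ex : exists n : nat, r * 2 ^- n < t.
  have [n nr] := exp2inv_lt (divr_gt0 t0 r0); exists n.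
  by rewrite mulrC -ltr_pdivlMr// nr.
case: (ex_minnP ex) => -[|n] nt nmin; first by move: nt; rewrite expr0 invr1 mulr1 ltNge tr.
exists n; rewrite nt /= leNgt; apply/negP => /nmin; by rewrite ltnn.
Qed.

(** Cut the box into sup-norm shells r 2^-(k+1) < |y| <= r 2^-k. The k-th contributes at most (r
    2^-(k+1))^(-s) (2 r 2^-k)^3 = 8 2^s r^(3-s) q^k, where q = 2^(s-3) < 1. *)
Lemma near_field (s : R) : 0 < s < 3 -> exists2 B : R, 0 <= B &
  forall r, 0 < r -> let g y := (\1_(box 0 r) y * enorm y `^ (- s)) : R in
    itg g /\ intg g <= B * r `^ (3 - s).
Proof.
move=> /andP[s0 s3].
pose q : R := 2 `^ (s - 3).
have q01 : 0 <= q < 1.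
  rewrite powR_ge0/= /q -(opprB 3 s) powRN invf_lt1 ?powR_gt0//.
  have := @gt0_ltr_powR _ (3 - s) _ 1 2; rewrite powR1 !nnegrE subr_gt0.
  by apply => //; rewrite ltr1n.
exists (8 * 2 `^ s * (1 - q)^-1) => [|r r0 g].
  by rewrite !mulr_ge0// ?powR_ge0// invr_ge0 subr_ge0; lra.
have p2 (k : nat) : 0 < (2 : R) ^- k by rewrite invr_gt0 exprn_gt0.
have mg : msr g.
  apply: msrM; first by apply: msr_indic; exact: msrs_box.
  by apply: msr_powR; exact: msr_enorm.
have g0 x : 0 <= g x by rewrite mulr_ge0 ?powR_ge0// indicE.
have := @itg_series R (fun k => box 0 (r * 2 ^- k)) (fun k => (r * 2 ^- k.+1) `^ (- s))
  (fun k => (2 * (r * 2 ^- k)) ^+ 3) (8 * 2 `^ s * (1 - q)^-1 * r `^ (3 - s)) g.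
case.
- by move=> k; exact: msrs_box.
- by move=> k; exact: powR_ge0.
- by move=> k; rewrite lam_box// mulr_ge0// ltW.
- move=> n.
  rewrite (eq_bigr (fun k => 8 * 2 `^ s * r `^ (3 - s) * q ^+ k)).
    rewrite -mulr_sumr -[leRHS]mulrA [_^-1 * _]mulrC mulrA.
    by rewrite ler_wpM2l ?geometric_le// !mulr_ge0 ?powR_ge0.
  move=> k _.
  have E3 (t : R) : 0 < t -> t ^+ 3 = t `^ 3 by move=> t0; rewrite -powR_mulrn// ltW.
  rewrite /q -powR_mulrn ?powR_ge0// -powRrM.
  have -> : (2 : R) ^- k.+1 = 2 `^ (- (k%:R + 1)).
    by rewrite powRN natr1 powR_mulrn.
  have -> : (2 : R) ^- k = 2 `^ (- k%:R) by rewrite powRN powR_mulrn.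
  rewrite exprMn; have -> : (2 : R) ^+ 3 = 8 by rewrite -natrX.
  rewrite E3 ?mulr_gt0 ?powR_gt0// !powRM ?powR_ge0 ?ltW// -!powRrM.
  have -> : r `^ (3 - s) = r `^ 3 * r `^ (- s) by rewrite -powRD// (gt_eqF r0) implybT.
  have -> : (s - 3) * k%:R = (- (k%:R + 1) * - s - s) + (- k%:R * 3) by ring.
  have pD (u v : R) : (2 : R) `^ (u + v) = 2 `^ u * 2 `^ v by rewrite powRD// pnatr_eq0 implybT.
  rewrite (pD (_ - s)) (pD _ (- s)).
  have h : (2 : R) `^ s * 2 `^ (- s) = 1.
    by rewrite -powRD ?subrr ?powRr0// pnatr_eq0 implybT.
  by transitivity (8 * (2 `^ s * 2 `^ (- s)) * (r `^ 3 * r `^ (- s)) * (2 `^ (- (k%:R + 1) * - s) * 2 `^ (- k%:R * 3))); [rewrite h; ring|ring].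
- exact: mg.
- move=> y; rewrite /g indicE; have [yb|] := boolP (y \in box 0 r); last by rewrite mul0r eqxx.
  rewrite mul1r => y0.
  (* The origin lies in no shell, but the function is 0 there, since [powR] of 0 with a nonzero
     exponent is 0 by convention. *)
  have {}y0 : y != 0.
    by apply: contraNneq y0 => ->; rewrite enorm0 powR0// oppr_eq0 gt_eqF.
  have yr : `|y| <= r by move: yb; rewrite inE /box /= subr0.
  have ny0 : 0 < `|y| by rewrite normr_gt0.
  have [k /andP[k1 k2]] := dyadic_shell ny0 yr.
  exists k; first by rewrite /box /= subr0.
  rewrite ger0_norm ?powR_ge0// !powRN lef_pV2 ?posrE ?powR_gt0 ?mulr_gt0//.
    by apply: ge0_ler_powR; rewrite ?nnegrE ?enorm_ge0 ?ltW ?mulr_gt0// (lt_le_trans k1)// norm_le_enorm.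
  by rewrite enorm_gt0.
move=> ig Ig; split => //.
by rewrite (eq_intg (g := fun x => `|g x|))// => x; rewrite ger0_norm.
Qed.

End NearField.

Section Potential.
Variable R : realType.
Local Notation pt := 'rV[R]_3.
Implicit Types (f g h rho k : pt -> R) (x xi : pt) (i j : 'I_3).

Lemma msr_refl g x : msr g -> msr (fun xi => g (x - xi)).
Proof.
pose mR := measurableTypeR R.
move=> mg; pose r (q : mR * (mR * mR)) : mR * (mR * mR) :=
  (x 0 0 - q.1, (x 0 1 - q.2.1, x 0 2 - q.2.2)).
have ms b : measurable_fun setT (fun t : mR => b - t : mR).
  by apply: measurable_funB.
have mr : measurable_fun setT r.
  apply: measurable_fun_pair => /=; first exact: (measurableT_comp (ms _) measurable_fst).
  apply: measurable_fun_pair => /=; apply: (measurableT_comp (ms _)).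
    exact: (measurableT_comp measurable_fst measurable_snd).
  exact: (measurableT_comp measurable_snd measurable_snd).
have := measurableT_comp mg mr; apply: eq_measurable_fun => q _ /=.
by congr g; apply/rowP => i; case: (ord3P i) => ->; rewrite !mxE.
Qed.

(* The gradient of the Newton kernel -1/|y|; its value at 0 is 0. *)
Definition kn i (y : pt) : R := y 0 i / enorm y ^+ 3.
Definition pot k rho x : R := intg (fun xi => k (x - xi) * rho xi).

Lemma norm_kn i y : `|kn i y| <= enorm y `^ (-2).
Proof.
have [->|y0] := eqVneq y 0.
  by rewrite /kn mxE mul0r normr0 powR_ge0.
have e0 := enorm_gt0 y0.
rewrite /kn normrM powR_invn ?(ltW e0)// normfV [`|enorm y ^+ 3|]gtr0_norm ?exprn_gt0//.
rewrite ler_pdivrMr ?exprn_gt0//.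
have -> : enorm y ^- 2 * enorm y ^+ 3 = enorm y by field; rewrite gt_eqF.
exact: coord_le_enorm.
Qed.

Lemma msr_kn i : msr (kn i).
Proof.
apply: msrM; first exact: msr_coord.
have -> : (fun y => (enorm y ^+ 3)^-1) = (fun y : pt => enorm y `^ (- 3%:R)).
  by apply/funext => y; rewrite powR_invn// enorm_ge0.
by apply: msr_powR; exact: msr_enorm.
Qed.

(** For p > 3 such a density has a potential that is defined at every point, not only almost
    everywhere, and continuous. *)
Definition dens (p L : R) rho :=
  [/\ msr rho, forall x, ~ box 0 L x -> rho x = 0 & itg (fun x => `|rho x| `^ p)].

Lemma dens_itg p L rho : 0 <= L -> 1 <= p -> dens p L rho -> itg rho.
Proof.
move=> L0 p1 [mr rL ir]; apply: (itg_le mr _ (itgD (itg_box 0 L0) ir)) => x.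
have [xb|/negP xb] := boolP (x \in box 0 L); last first.
  by rewrite rL ?normr0 ?addr_ge0 ?powR_ge0 ?indicE// => h; apply: xb; rewrite inE.
rewrite indicE xb; have [r1|/ltW r1] := lerP `|rho x| 1.
  by rewrite (le_trans r1)// lerDl powR_ge0.
by rewrite (le_trans (le1r_powR r1 p1))// lerDr.
Qed.

Lemma bounded_dens p L rho M : 0 <= L -> 0 <= p -> msr rho ->
  (forall x, `|rho x| <= M) -> (forall x, ~ box 0 L x -> rho x = 0) -> p != 0 -> dens p L rho.
Proof.
move=> L0 p0 mr rM rL pn; split => //.
apply: (@itg_bounded _ _ 0 L (M `^ p)) => //.
- by apply: msr_powR; exact: msr_norm.
- move=> x; rewrite ger0_norm ?powR_ge0//; apply: ge0_ler_powR; rewrite ?nnegrE//.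
  exact: le_trans (rM x).
- by move=> x xb; rewrite rL// normr0 powR0.
Qed.

Lemma even_shift g x : (forall y, g (- y) = g y) -> itg g ->
  itg (fun xi => g (x - xi)) /\ intg (fun xi => g (x - xi)) = intg g.
Proof.
move=> gE ig.
have -> : (fun xi => g (x - xi)) = (fun xi => g (xi + (- x))).
  by apply/funext => xi; rewrite -gE opprB.
by split; [exact: itg_shift|exact: intg_shift].
Qed.

(** Young's inequality for t a and b / t, with the factors 1/p and 1/q dropped. The weight lets the
    term with |rho|^p be made small before the region around the pole is shrunk. *)
Lemma young_weighted (p q t a b : R) : 0 < t -> 1 <= p -> 1 <= q -> p^-1 + q^-1 = 1 ->
  0 <= a -> 0 <= b -> b * a <= t `^ p * a `^ p + t `^ (- q) * b `^ q.
Proof.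
move=> t0 p1 q1 pq a0 b0.
have p0 : 0 < p by lra.
have q0 : 0 < q by lra.
have a0' : 0 <= t * a by rewrite mulr_ge0 // ltW.
have b0' : 0 <= t^-1 * b by rewrite mulr_ge0 // invr_ge0 ltW.
have := conjugate_powR a0' b0' p0 q0 pq.
have -> : t * a * (t^-1 * b) = b * a by field; rewrite gt_eqF.
move=> /le_trans; apply; apply: lerD.
  rewrite powRM ?(ltW t0)// -[leRHS]mulr1 ler_wpM2l ?mulr_ge0 ?powR_ge0//.
  by rewrite invf_le1.
rewrite powRM ?invr_ge0 ?(ltW t0)// -powR_inv1 ?(ltW t0)// -(powRrM t) mulN1r.
by rewrite -[leRHS]mulr1 ler_wpM2l ?mulr_ge0 ?powR_ge0// invf_le1.
Qed.

(** Young's inequality separates the kernel from the density. The bound is uniform in x because the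
    integral of an even kernel in x - xi does not depend on x. *)
Lemma pot_near p L rho (e : R) : 0 <= L -> 3 < p -> dens p L rho -> 0 < e ->
  exists2 d : R, 0 < d & forall x,
   let g xi := \1_(box 0 d) (x - xi) * enorm (x - xi) `^ (-2) * `|rho xi| in
   itg g /\ intg g <= e.
Proof.
move=> L0 p3 [mr rL ir] e0.
pose q := p / (p - 1).
have p1 : 0 < p - 1 by lra.
have p0 : 0 < p by lra.
have q0 : 0 < q by rewrite divr_gt0.
have p1' : 1 <= p by lra.
have q1 : 1 <= q by rewrite /q ler_pdivlMr//; lra.
(* The q-th power of |y|^-2 is |y|^(-s), with s = 2p/(p-1); the requirement s < 3 of [near_field] is
   exactly p > 3. *)
pose s := 2 * q.
have s3 : 0 < s < 3.
  by rewrite mulr_gt0//= /s /q mulrA ltr_pdivrMr//; lra.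
have pq : p^-1 + q^-1 = 1.
  by rewrite /q invf_div; field; rewrite gt_eqF.
have [B B0 nB] := near_field s3.
set A := intg (fun x => `|rho x| `^ p) in ir *.
have A0 : 0 <= A by apply: intg_ge0 => x; exact: powR_ge0.
(* First [t] brings the term with |rho|^p below e/2, then [d] the kernel term, whose constant
   depends on [t]. The 1 added to [A] and [B] avoids a division by 0. *)
have [t t0 tA] : exists2 t, 0 < t & t `^ p * A <= e / 2.
  exists ((e / 2 / (A + 1)) `^ p^-1); first by rewrite powR_gt0// !divr_gt0//; lra.
  rewrite -powRrM mulVf ?gt_eqF// powRr1; last by rewrite !divr_ge0//; lra.
  by rewrite mulrAC ler_pdivrMr; [rewrite ler_wpM2l//; lra|lra].
have [d d0 dB] : exists2 d, 0 < d & t `^ (- q) * (B * d `^ (3 - s)) <= e / 2.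
  exists ((e / 2 / (B + 1) * t `^ q) `^ (3 - s)^-1).
    by rewrite powR_gt0// mulr_gt0 ?powR_gt0// !divr_gt0//; lra.
  rewrite -(powRrM _ (_^-1)) mulVf; last by rewrite gt_eqF//; lra.
  rewrite powRr1; last by rewrite mulr_ge0 ?powR_ge0// !divr_ge0//; lra.
  have B1 : 0 < B + 1 by lra.
  rewrite powRN; have := powR_gt0 q t0; move: (t `^ q) => T T0.
  have -> : T^-1 * (B * (e / 2 / (B + 1) * T)) = B * (e / 2) / (B + 1).
    by field; rewrite !gt_eqF.
  by rewrite ler_pdivrMr// mulrC ler_wpM2l//; [rewrite divr_ge0// ltW|rewrite lerDl].
exists d => // x g.
have [ik Ik] := nB d d0.
set kk := (fun y => _) in ik Ik.
have mkk : msr (fun xi => kk (x - xi)).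
  exact: msr_refl (itg_msr ik).
have kkE xi : kk (- xi) = kk xi.
  by rewrite /kk enormN !indicE; congr ((_ : bool)%:R * _); apply/idP/idP; rewrite !inE /box /= !subr0 normrN.
have [ik' Ik'] := even_shift x kkE ik.
have g0 xi : 0 <= g xi by rewrite !mulr_ge0 ?powR_ge0// indicE.
have gle xi : g xi <= t `^ p * `|rho xi| `^ p + t `^ (- q) * kk (x - xi).
  rewrite /g /kk indicE; have [_|_] := boolP (x - xi \in box 0 d); last first.
    by rewrite !mul0r mulr0 addr0; apply: mulr_ge0; exact: powR_ge0.
  rewrite !mul1r; apply: le_trans (young_weighted t0 p1' q1 pq (normr_ge0 _) (powR_ge0 _ _)) _.
  by rewrite -powRrM mulNr.
have mg : msr g.
  apply: msrM; last exact: msr_norm.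
  apply: (msr_refl (g := fun y => \1_(box 0 d) y * enorm y `^ (-2))).
  by apply: msrM; [apply: msr_indic; exact: msrs_box|apply: msr_powR; exact: msr_enorm].
have ib : itg (fun xi => t `^ p * `|rho xi| `^ p + t `^ (- q) * kk (x - xi)).
  by apply: itgD; exact: itgZ.
have ig : itg g by apply: (itg_le mg _ ib) => xi; rewrite ger0_norm.
split; first exact: ig.
apply: le_trans (intg_le ig ib gle) _.
have ia := itgZ (t `^ p) ir; have ik2 := itgZ (t `^ (- q)) ik'.
rewrite (intgD ia ik2) (intgZ _ ir) (intgZ _ ik') Ik' [leRHS](_ : e = e / 2 + e / 2); last by field.
apply: lerD; first exact: tA.
by apply: le_trans dB; apply: ler_wpM2l; [exact: powR_ge0|exact: Ik].
Qed.

End Potential.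

(** * Continuity and decay of potentials *)

Section PotentialContinuity.
Variable R : realType.
Local Notation pt := 'rV[R]_3.
Implicit Types (f g h rho k : pt -> R) (x xi : pt) (i j : 'I_3).

Lemma cont_normP g x : {for x, continuous g} <->
  forall e : R, 0 < e -> exists2 r : R, 0 < r & forall y, `|y - x| < r -> `|g y - g x| < e.
Proof.
split=> [/cvgrPdist_lt h e e0|h].
  have /nbhs_normP[r r0 H] := h e e0.
  by exists r => // y /H; rewrite distrC.
rewrite /prop_for /continuous_at; apply/(@cvgrPdist_lt _ _ _ (nbhs x) (nbhs_filter x) g (g x)) => e e0; have [r r0 H] := h e e0.
by apply/nbhs_normP; exists r => // y /H; rewrite distrC.
Qed.

Lemma ltr_dist4 (a b c d e : R) : `|a - b| <= e / 4 -> `|c - d| <= e / 4 ->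
  `|b - d| < e / 4 -> `|a - c| < e.
Proof.
rewrite !ler_norml !ltr_norml => /andP[? ?] /andP[? ?] /andP[? ?].
by apply/andP; split; lra.
Qed.

(** Agrees with [kn] where |y| >= d, but is bounded and continuous at the pole as well. *)
Definition trunc_kn (d : R) i (y : pt) : R := y 0 i / (Num.max (enorm y) d) ^+ 3.

Lemma trunc_kn_continuous d i : 0 < d -> continuous (trunc_kn d i).
Proof.
move=> d0 y; apply: (@continuousM _ _ (fun y : pt => y 0 i) (fun y : pt => (Num.max (enorm y) d ^+ 3)^-1)); first exact: coord_continuous.
have m0 : 0 < Num.max (enorm y) d by rewrite lt_max d0 orbT.
apply: (@continuousV _ _ (fun y : pt => Num.max (enorm y) d ^+ 3)).
  by rewrite expf_neq0// gt_eqF.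
apply: (@continuous_comp _ _ _ (fun y : pt => Num.max (enorm y) d) (fun t : R => t ^+ 3)); last exact: exprn_continuous.
apply: (@continuous_max _ _ (@enorm R) (cst d)); last exact: cst_continuous.
exact: enorm_continuous.
Qed.

Lemma trunc_kn_bound d i y : 0 < d -> `|trunc_kn d i y| <= d ^- 2.
Proof.
move=> d0; rewrite /trunc_kn; set m := Num.max _ _.
have md : d <= m by rewrite le_max lexx orbT.
have m0 : 0 < m by rewrite (lt_le_trans d0).
rewrite normrM normfV [`|m ^+ 3|]gtr0_norm ?exprn_gt0// ler_pdivrMr ?exprn_gt0//.
have ym : `|y 0 i| <= m by rewrite le_max coord_le_enorm.
apply: (le_trans ym).
rewrite mulrC ler_pdivlMr ?exprn_gt0// [leRHS]exprS ler_wpM2l ?(ltW m0)//.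
by rewrite ler_pXn2r ?nnegrE ?(ltW m0) ?(ltW d0).
Qed.

Lemma kn_trunc d i y : 0 < d ->
  `|kn i y - trunc_kn d i y| <= \1_(box 0 d) y * enorm y `^ (-2).
Proof.
move=> d0; have [yd|yd] := leP (enorm y) d; last first.
  by rewrite /kn /trunc_kn max_l ?(ltW yd)// subrr normr0 mulr_ge0 ?powR_ge0// indicE.
have yb : y \in box 0 d by rewrite inE /box /= subr0 (le_trans (norm_le_enorm y)).
rewrite indicE yb mul1r; apply: le_trans (norm_kn i y).
have [->|y0] := eqVneq y 0.
  by rewrite /kn /trunc_kn mxE !mul0r subrr normr0.
have e0 := enorm_gt0 y0.
have h : d ^- 3 <= enorm y ^- 3.
  by rewrite lef_pV2 ?posrE ?exprn_gt0// ler_pXn2r ?nnegrE ?(ltW e0) ?(ltW d0).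
have h0 : 0 < d ^- 3 by rewrite invr_gt0 exprn_gt0.
rewrite /kn /trunc_kn max_r// -mulrBr !normrM; apply: ler_wpM2l => //.
by rewrite !ger0_norm ?subr_ge0 ?invr_ge0 ?exprn_ge0 ?(ltW e0)// gerBl ltW.
Qed.

Lemma itg_trunc d i rho x : 0 < d -> itg rho -> itg (fun xi => trunc_kn d i (x - xi) * rho xi).
Proof.
move=> d0 ir.
have mt : msr (fun xi => trunc_kn d i (x - xi)).
  by apply: msr_refl; apply: msr_cont; exact: trunc_kn_continuous.
apply: (itg_le (msrM mt (itg_msr ir)) _ (itgZ (d ^- 2) (itg_norm ir))) => xi.
by rewrite normrM ler_wpM2r// trunc_kn_bound.
Qed.

Lemma pot_trunc_continuous d i rho : 0 < d -> itg rho -> continuous (pot (trunc_kn d i) rho).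
Proof.
move=> d0 ir x.
apply: (@cont_intg _ (fun x xi => trunc_kn d i (x - xi) * rho xi) x (fun xi => d ^- 2 * `|rho xi|) 1) => //.
- exact/itgZ/itg_norm.
- by move=> y _; exact: itg_msr (itg_trunc i y d0 ir).
- by move=> y z _; rewrite normrM ler_wpM2r// trunc_kn_bound.
move=> z; apply: (@continuousM _ _ (fun y : pt => trunc_kn d i (y - z)) (fun=> rho z)); last exact: cst_continuous.
apply: (@continuous_comp _ _ _ (fun y : pt => y - z) (trunc_kn d i)); last exact: trunc_kn_continuous.
by apply: continuousB => //; exact: cst_continuous.
Qed.

(** The two kernels differ only near the pole and by at most |y|^-2, which [pot_near] controls
    uniformly in x. So the potential is a uniform limit of continuous functions. *)
Lemma pot_approx p L i rho e : 0 <= L -> 3 < p -> dens p L rho -> 0 < e ->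
  exists2 d : R, 0 < d & forall x,
    itg (fun xi => kn i (x - xi) * rho xi) /\
    `|pot (kn i) rho x - pot (trunc_kn d i) rho x| <= e.
Proof.
move=> L0 p3 dr e0.
have ir : itg rho by apply: (dens_itg L0 _ dr); lra.
have [d d0 H] := pot_near L0 p3 dr e0.
exists d => // x; have [ig Ig] := H x.
have it := itg_trunc i x d0 ir.
have mk : msr (fun xi => kn i (x - xi) * rho xi).
  by apply: msrM; [apply: msr_refl; exact: msr_kn|exact: itg_msr ir].
have le xi : `|kn i (x - xi) * rho xi - trunc_kn d i (x - xi) * rho xi| <=
   \1_(box 0 d) (x - xi) * enorm (x - xi) `^ (-2) * `|rho xi|.
  by rewrite -mulrBl normrM ler_wpM2r// kn_trunc.
have idf : itg (fun xi => kn i (x - xi) * rho xi - trunc_kn d i (x - xi) * rho xi).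
  by apply: (itg_le _ le ig); apply: msrB => //; exact: itg_msr it.
have ik : itg (fun xi => kn i (x - xi) * rho xi).
  by apply: (eq_itg _ (itgD idf it)) => xi; rewrite subrK.
split => //; rewrite /pot -(intgB ik it).
apply: le_trans (intg_norm idf) _; apply: le_trans Ig.
exact: intg_le (itg_norm idf) ig le.
Qed.

Lemma pot_itg p L i rho x : 0 <= L -> 3 < p -> dens p L rho ->
  itg (fun xi => kn i (x - xi) * rho xi).
Proof. by move=> L0 p3 dr; have [d _ /(_ x)[]] := pot_approx i L0 p3 dr ltr01. Qed.

Lemma pot_continuous p L i rho : 0 <= L -> 3 < p -> dens p L rho ->
  continuous (pot (kn i) rho).
Proof.
move=> L0 p3 dr x; apply/cont_normP => e e0.
have e4 : 0 < e / 4 by rewrite divr_gt0.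
have [d d0 H] := pot_approx i L0 p3 dr e4.
have ir : itg rho by apply: (dens_itg L0 _ dr); lra.
have /cont_normP/(_ _ e4)[r r0 hr] := @pot_trunc_continuous d i rho d0 ir x.
exists r => // y /hr; exact: ltr_dist4 (H y).2 (H x).2.
Qed.

Lemma pot_infty L i rho (e : R) : 0 <= L -> itg rho -> (forall x, ~ box 0 L x -> rho x = 0) ->
  0 < e -> exists M : R, forall x, M < enorm x -> `|pot (kn i) rho x| < e.
Proof.
move=> L0 ir rL e0.
pose A := intg (fun x => `|rho x|).
have A0 : 0 <= A by apply: intg_ge0.
(* For |x| > 2L every xi of the support has |x - xi| >= |x|/2, so the kernel is at most 4/|x|^2,
   hence at most 4/|x| as |x| > 1; the last entry makes 4A/|x| < e. The factor 2 in the threshold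
   passes from the Euclidean to the sup norm. *)
pose N := Num.max (2 * L) (Num.max 1 (8 * (A + 1) / e)).
exists (2 * N) => x Nx.
have {}Nx : N < `|x| by have := enorm_le_norm x; lra.
have [xL x1 xA] : [/\ 2 * L < `|x|, 1 < `|x| & 8 * (A + 1) / e < `|x| ].
  by move: Nx; rewrite /N !gt_max => /and3P[].
have x0 : 0 < `|x| by lra.
pose c := 4 * `|x| ^- 2.
have c0 : 0 <= c by rewrite mulr_ge0// invr_ge0 exprn_ge0.
have mk : msr (fun xi => kn i (x - xi) * rho xi).
  by apply: msrM; [apply: msr_refl; exact: msr_kn|exact: itg_msr ir].
have le xi : `|kn i (x - xi) * rho xi| <= c * `|rho xi|.
  have [->|r0] := eqVneq (rho xi) 0; first by rewrite mulr0 normr0 mulr0.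
  have xb : `|xi| <= L.
    rewrite leNgt; apply/negP => Lx; move/eqP: r0; apply; apply: rL.
    by rewrite /box /= subr0; apply/negP; rewrite -ltNge.
  rewrite normrM; apply: ler_wpM2r => //; apply: le_trans (norm_kn _ _) _.
  have h : `|x| / 2 <= enorm (x - xi).
    apply: le_trans (norm_le_enorm _); have := lerB_normD x (- xi); rewrite normrN; lra.
  rewrite powR_invn ?enorm_ge0//.
  have -> : c = (`|x| / 2) ^- 2 by rewrite /c; field; rewrite gt_eqF.
  have h0 : 0 < `|x| / 2 by rewrite divr_gt0.
  rewrite lef_pV2 ?posrE ?exprn_gt0//; last exact: lt_le_trans h.
  by rewrite ler_pXn2r ?nnegrE ?enorm_ge0// ltW.
have ik := itg_le mk le (itgZ c (itg_norm ir)).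
apply: le_lt_trans (intg_norm ik) _.
apply: le_lt_trans (intg_le (itg_norm ik) (itgZ c (itg_norm ir)) le) _.
rewrite (intgZ c (itg_norm ir)) -/A.
have cx : c <= 4 / `|x|.
  rewrite /c ler_wpM2l// lef_pV2 ?posrE ?exprn_gt0// expr2 ler_peMr ?(ltW x1)// ltW//.
apply: (@le_lt_trans _ _ (4 / `|x| * A)); first by rewrite ler_wpM2r.
rewrite mulrAC ltr_pdivrMr//; rewrite ltr_pdivrMr// in xA; rewrite mulrC in xA; lra.
Qed.

End PotentialContinuity.

(** * Partial derivatives and the classes C^n *)

Section Derivatives.
Variable R : realType.
Local Notation pt := 'rV[R]_3.
Implicit Types (f g h : pt -> R) (x y v : pt) (i j : 'I_3) (U V : set pt).

Definition ej j : pt := delta_mx 0 j.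

Lemma ejE j i : ej j 0 i = (i == j)%:R.
Proof. by rewrite mxE eqxx. Qed.

Lemma norm_ej j : `|ej j| <= 1.
Proof. by apply/norm_rVleP => // k; rewrite ejE; case: eqP => _; rewrite ?normr1 ?normr0. Qed.

Lemma line_quotient g x v t :
  (fun h : R => h^-1 *: ((g \o shift (x + t *: v)) (h *: v) - g (x + t *: v))) =
  (fun h : R => h^-1 *: (((fun s : R => g (x + s *: v)) \o shift t) (h *: 1) - g (x + t *: v))).
Proof.
apply/funext => h /=; congr (_ *: (g _ - _)).
by rewrite addrC -addrA -scalerDl [h *: 1]mulr1 addrC [t + h]addrC addrC.
Qed.

(** Reduces partial derivatives to one real variable, for the chain rule, the mean value theorem and
    derivatives at an extremum. *)
Lemma is_derive_line g x v (t d : R) :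
  is_derive (x + t *: v) v g d <-> is_derive t 1 (fun s : R => g (x + s *: v)) d.
Proof.
by split=> -[]; rewrite /derivable /derive => h1 h2; split; move: h1 h2;
  rewrite /derivable /derive line_quotient.
Qed.

Lemma is_derive_line0 g x v (d : R) :
  is_derive x v g d <-> is_derive (0 : R) 1 (fun s : R => g (x + s *: v)) d.
Proof. by rewrite -is_derive_line scale0r addr0. Qed.

Definition is_pd j g x d := is_derive x (ej j) g d.

Lemma is_pdP j g x d : is_pd j g x d <-> derivable g x (ej j) /\ pd j g x = d.
Proof. by split=> [[]|[]]. Qed.

Lemma pdP j g x : derivable g x (ej j) -> is_pd j g x (pd j g x).
Proof. by move=> h; exact/is_pdP. Qed.

Lemma is_pd_local j g h x d (r : R) : 0 < r -> (forall y, `|y - x| < r -> g y = h y) ->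
  is_pd j g x d -> is_pd j h x d.
Proof.
move=> r0 gh; apply: near_eq_is_derive.
by apply/nbhs_normP; exists r.
Qed.

Lemma is_pd_eq j g x d d' : d = d' -> is_pd j g x d -> is_pd j g x d'.
Proof. by move=> ->. Qed.

Lemma is_pd_cst j c x : is_pd j (fun=> c) x 0.
Proof. exact: is_derive_cst. Qed.

Lemma is_pd_coord j i x : is_pd j (fun y => y 0 i) x (i == j)%:R.
Proof.
apply/is_derive_line0.
have -> : (fun s : R => (x + s *: ej j) 0 i) = (fun s => x 0 i + s * (i == j)%:R).
  by apply/funext => s; rewrite !mxE ?eqxx.
by apply: is_derive_eq; rewrite /= !add0r mul1r scale0r add0r [_ *: _]mulr1.
Qed.

Lemma is_pdD j g h x d e : is_pd j g x d -> is_pd j h x e -> is_pd j (fun y => g y + h y) x (d + e).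
Proof. by move=> ? ?; apply: is_deriveD. Qed.

Lemma is_pdN j g x d : is_pd j g x d -> is_pd j (fun y => - g y) x (- d).
Proof. by move=> ?; apply: is_deriveN. Qed.

Lemma is_pdB j g h x d e : is_pd j g x d -> is_pd j h x e -> is_pd j (fun y => g y - h y) x (d - e).
Proof. by move=> ? ?; apply: is_deriveB. Qed.

Lemma is_pdM j g h x d e : is_pd j g x d -> is_pd j h x e ->
  is_pd j (fun y => g y * h y) x (d * h x + g x * e).
Proof.
move=> gd he; have := @is_deriveM _ _ g h x (ej j) d e gd he.
by apply: is_pd_eq; rewrite addrC ![_ *: _]mulrC [g x * e]mulrC mulrC [e * g x]mulrC.
Qed.

Lemma is_pdZ j c g x d : is_pd j g x d -> is_pd j (fun y => c * g y) x (c * d).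
Proof. by move=> /(is_pdM (is_pd_cst j c x)); rewrite mul0r add0r. Qed.

Lemma is_pd_sum j (I : Type) (s : seq I) (g : I -> pt -> R) (d : I -> R) x :
  (forall k, is_pd j (g k) x (d k)) ->
  is_pd j (fun y => \sum_(k <- s) g k y) x (\sum_(k <- s) d k).
Proof.
move=> gd; elim: s => [|k s IH].
  rewrite big_nil; have -> : (fun y => \sum_(k <- [::]) g k y) = (fun=> 0) by apply/funext => y; rewrite big_nil.
  exact: is_pd_cst.
rewrite big_cons; have -> : (fun y => \sum_(k <- k :: s) g k y) = (fun y => g k y + \sum_(k <- s) g k y).
  by apply/funext => y; rewrite big_cons.
exact: is_pdD.
Qed.

Lemma is_pd_comp j (F : R -> R) g x d e :
  is_pd j g x d -> is_derive (g x) 1 F e -> is_pd j (fun y => F (g y)) x (e * d).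
Proof.
move=> /is_derive_line0 gd Fe; apply/is_derive_line0.
apply: (@is_derive1_comp _ F (fun s : R => g (x + s *: ej j)) 0 e d).
by rewrite scale0r addr0.
Qed.

Lemma is_pdV j g x d : g x != 0 -> is_pd j g x d -> is_pd j (fun y => (g y)^-1) x (- d / g x ^+ 2).
Proof.
move=> g0 gd; apply: is_pd_eq (is_pd_comp gd (@is_deriveV _ id (g x) 1 1 g0 _)).
by rewrite [_ *: _]mulr1 !mulNr mulrC.
Qed.

Lemma is_pd_affine j g x a c d : is_pd j g (c *: (x - a)) d ->
  is_pd j (fun y => g (c *: (y - a))) x (c * d).
Proof.
move=> /is_derive_line0 gd; apply/is_derive_line0.
have -> : (fun s : R => g (c *: (x + s *: ej j - a))) =
   (fun s : R => g (c *: (x - a) + s *: ej j)) \o (fun s => c * s).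
  by apply/funext => s /=; rewrite addrAC scalerDr scalerA.
rewrite mulrC; apply: is_derive1_comp; first by rewrite mulr0.
by apply: is_derive_eq; rewrite [_ *: _]mulr1.
Qed.

Lemma is_pd_refl j g x a d : is_pd j g (a - x) d ->
  is_pd j (fun y => g (a - y)) x (- d).
Proof.
have E y : a - y = -1 *: (y - a) by rewrite scaleN1r opprB.
rewrite E => /is_pd_affine; rewrite mulN1r.
by have -> : (fun y => g (a - y)) = (fun y => g (-1 *: (y - a))) by apply/funext => y; rewrite E.
Qed.

Lemma is_pd_translate j g x a d : is_pd j g (x - a) d -> is_pd j (fun y => g (y - a)) x d.
Proof.
move=> gd; have := @is_pd_affine j g x a 1 d; rewrite scale1r => /(_ gd); rewrite mul1r.
by have -> : (fun y => g (y - a)) = (fun y => g (1 *: (y - a))) by apply/funext => y; rewrite scale1r.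
Qed.

Lemma mvt_line g x j (t M : R) :
  (forall s : R, `|s| <= `|t| -> derivable g (x + s *: ej j) (ej j)) ->
  (forall s : R, `|s| <= `|t| -> `|pd j g (x + s *: ej j)| <= M) ->
  `|g (x + t *: ej j) - g x| <= M * `|t|.
Proof.
move=> dg gM.
pose F s := g (x + s *: ej j); pose dF s := pd j g (x + s *: ej j).
have dF' (s : R) : `|s| <= `|t| -> is_derive s 1 F (dF s).
  by move=> st; apply/is_derive_line; exact: pdP (dg _ st).
suff H (a b : R) : a <= b -> (forall s, s \in `[a, b] -> `|s| <= `|t|) -> `|F b - F a| <= M * (b - a).
  have F0 : F 0 = g x by rewrite /F scale0r addr0.
  rewrite -/(F t) -F0; case: (leP 0 t) => t0.
    have := H 0 t t0; rewrite subr0 (ger0_norm t0); apply => s.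
    by rewrite in_itv /= => /andP[s0 st]; rewrite !ger0_norm.
  have := H t 0 (ltW t0); rewrite sub0r distrC (ltr0_norm t0); apply => s.
  by rewrite in_itv /= => /andP[s0 st]; rewrite ler0_norm// lerN2.
move=> ab abt.
have [|| c cab ->] := @MVT_segment _ F dF a b ab.
- by move=> s /subset_itv_oo_cc /abt; exact: dF'.
- apply: derivable_within_continuous => s /abt /dF'; by case.
have ba : 0 <= b - a by rewrite subr_ge0.
by rewrite normrM (ger0_norm ba) ler_wpM2r// gM// abt.
Qed.

End Derivatives.

Section Cn.
Variable R : realType.
Local Notation pt := 'rV[R]_3.
Implicit Types (f g h : pt -> R) (x y v : pt) (i j : 'I_3) (U V : set pt).

Lemma cont_local g h x (r : R) : 0 < r -> (forall y, `|y - x| < r -> g y = h y) ->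
  {for x, continuous g} -> {for x, continuous h}.
Proof.
move=> r0 gh /cont_normP cg; apply/cont_normP => e /cg[s s0 H].
exists (Num.min r s); first by rewrite lt_min r0.
move=> y; rewrite lt_min => /andP[yr ys].
by rewrite -!gh//; [exact: H|rewrite subrr normr0].
Qed.

Lemma Cn_eq n U g h : open U -> (forall x, U x -> g x = h x) -> Cn n U g -> Cn n U h.
Proof.
move=> /open_normP oU; elim: n g h => [|n IH] g h gh [cg dg].
  split=> // x Ux; have [r r0 rU] := oU x Ux.
  by apply: (cont_local r0 _ (cg x Ux)) => y /rU /gh.
split=> [x Ux|k].
  have [r r0 rU] := oU x Ux.
  by apply: (cont_local r0 _ (cg x Ux)) => y /rU /gh.
have H x : U x -> is_pd k h x (pd k g x).
  move=> Ux; have [r r0 rU] := oU x Ux.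
  by apply: (is_pd_local r0 _ (pdP ((dg k).1 _ Ux))) => y /rU /gh.
split=> [x /H /is_pdP[]//|].
apply: IH (dg k).2 => x /H /is_pdP[]//.
Qed.

Lemma Cn_sub n U V g : V `<=` U -> Cn n U g -> Cn n V g.
Proof.
move=> VU; elim: n g => [|n IH] g [cg dg]; first by split=> // x /VU /cg.
split=> [x /VU /cg//|k]; split=> [x /VU /(dg k).1//|].
exact: IH (dg k).2.
Qed.

(** [Cn] is a condition point by point on the total function and its total derivatives, so [V] may
    be any set and may vary with the point. Regularity on Omega is obtained chart by chart in this
    way. *)
Lemma Cn_local n U g : (forall x, U x -> exists2 V, V x & Cn n V g) -> Cn n U g.
Proof.
elim: n g => [|n IH] g H; first by split=> // x /H[V Vx [cg _]]; exact: cg.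
split=> [x /H[V Vx [cg _]]|k]; first exact: cg.
split=> [x /H[V Vx [_ /(_ k)[dg _]]]|]; first exact: dg.
by apply: IH => x /H[V Vx [_ /(_ k)[_ dg]]]; exists V.
Qed.

Lemma Cn_is_pd n U g j x : Cn n.+1 U g -> U x -> is_pd j g x (pd j g x).
Proof. by move=> [_ /(_ j)[dg _]] /dg; exact: pdP. Qed.

Lemma Cn_cst n U c : Cn n U (fun=> c).
Proof.
elim: n c => [|n IH] c; first by split=> // x _; exact: cst_continuous.
split=> [x _|k]; first exact: cst_continuous.
split=> [x _|]; first by have /is_pdP[] := is_pd_cst k c x.
have -> : pd k (fun=> c) = (fun=> 0) :> (pt -> R); last exact: IH.
by apply/funext => x; have /is_pdP[] := is_pd_cst k c x.
Qed.

Lemma CnD n U g h : open U -> Cn n U g -> Cn n U h -> Cn n U (fun x => g x + h x).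
Proof.
move=> oU; elim: n g h => [|n IH] g h cg ch.
  by split=> // x Ux; apply: continuousD; [exact: cg.1|exact: ch.1].
split=> [x Ux|k]; first by apply: continuousD; [exact: cg.1|exact: ch.1].
have H x : U x -> is_pd k (fun x => g x + h x) x (pd k g x + pd k h x).
  by move=> Ux; apply: is_pdD; [exact: Cn_is_pd cg Ux|exact: Cn_is_pd ch Ux].
split=> [x /H /is_pdP[]//|].
apply: (@Cn_eq _ _ (fun x => pd k g x + pd k h x)) => //.
  by move=> x /H /is_pdP[].
by apply: IH; [exact: (cg.2 k).2|exact: (ch.2 k).2].
Qed.

Lemma CnZ n U c g : open U -> Cn n U g -> Cn n U (fun x => c * g x).
Proof.
move=> oU; elim: n g => [|n IH] g cg.
  split=> // x Ux; apply: (@continuousM _ _ (fun=> c)); [exact: cst_continuous|exact: cg.1].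
split=> [x Ux|k].
  by apply: (@continuousM _ _ (fun=> c)); [exact: cst_continuous|exact: cg.1].
have H x : U x -> is_pd k (fun x => c * g x) x (c * pd k g x).
  by move=> Ux; apply: is_pdZ; exact: Cn_is_pd cg Ux.
split=> [x /H /is_pdP[]//|].
apply: (@Cn_eq _ _ (fun x => c * pd k g x)) => //.
  by move=> x /H /is_pdP[].
by apply: IH; exact: (cg.2 k).2.
Qed.

End Cn.

(** * Kernels smooth off the origin *)

Section Kernels.
Variable R : realType.
Local Notation pt := 'rV[R]_3.
Implicit Types (f g h k rho : pt -> R) (x y v : pt) (i j : 'I_3) (U V : set pt).

Definition einv (y : pt) : R := (enorm y)^-1.

(* Closed under partial derivatives off the origin, which makes potentials
   smooth off the support of their density. *)
Inductive kclass : (pt -> R) -> Prop :=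
| kclass_cst c : kclass (fun=> c)
| kclass_coord i : kclass (fun y => y 0 i)
| kclass_einv : kclass einv
| kclassD k k' : kclass k -> kclass k' -> kclass (fun y => k y + k' y)
| kclassM k k' : kclass k -> kclass k' -> kclass (fun y => k y * k' y).

Lemma is_pd_enorm j y : y != 0 -> is_pd j (@enorm R) y (y 0 j / enorm y).
Proof.
move=> y0; have e0 := enorm_gt0 y0.
have Q0 : 0 < \sum_l y 0 l ^+ 2 by rewrite -sqrtr_gt0.
have H : is_pd j (fun y : pt => \sum_l y 0 l ^+ 2) y (2 * y 0 j).
  have S := @is_pd_sum R j 'I_3 (index_enum _) (fun (l : 'I_3) z => z 0 l ^+ 2) (fun l : 'I_3 => 2 * y 0 l * (l == j)%:R) y.
  apply: is_pd_eq (S _) => [|l].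
    by rewrite (bigD1 j)//= eqxx mulr1 big1 ?addr0// => l /negPf ->; exact: mulr0.
  by apply: is_pd_eq (is_pdM (is_pd_coord j l y) (is_pd_coord j l y)); ring.
have := is_pd_comp H (is_derive1_sqrt Q0).
apply: is_pd_eq; rewrite -/(enorm y).
by field; rewrite gt_eqF.
Qed.

Lemma is_pd_einv j y : y != 0 -> is_pd j einv y (- (y 0 j * einv y ^+ 3)).
Proof.
move=> y0; have e0 := enorm_gt0 y0.
apply: (is_pd_eq _ (is_pdV (lt0r_neq0 e0) (is_pd_enorm j y0))).
by rewrite /einv; field; rewrite gt_eqF.
Qed.

Lemma kclassX k n : kclass k -> kclass (fun y => k y ^+ n).
Proof.
move=> kk; elim: n => [|n IH].
  have -> : (fun y => k y ^+ 0) = (fun=> 1) by apply/funext => y; rewrite expr0.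
  exact: kclass_cst.
have -> : (fun y => k y ^+ n.+1) = (fun y => k y * k y ^+ n) by apply/funext => y; rewrite exprS.
exact: kclassM.
Qed.

Lemma kclass_pd k j : kclass k ->
  exists k', kclass k' /\ forall y, y != 0 -> is_pd j k y (k' y).
Proof.
elim=> {k} [c|i||k k' kk [d [kd Hd]] kk' [d' [kd' Hd']]|k k' kk [d [kd Hd]] kk' [d' [kd' Hd']]].
- by exists (fun=> 0); split=> [|y _]; [exact: kclass_cst|exact: is_pd_cst].
- by exists (fun=> (i == j)%:R); split=> [|y _]; [exact: kclass_cst|exact: is_pd_coord].
- exists (fun y => -1 * (y 0 j * einv y ^+ 3)); split=> [|y y0].
    apply: kclassM; [exact: kclass_cst|apply: kclassM; [exact: kclass_coord|]].
    by apply: kclassX; exact: kclass_einv.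
  by rewrite mulN1r; exact: is_pd_einv.
- exists (fun y => d y + d' y); split=> [|y y0]; first exact: kclassD.
  by apply: is_pdD; [exact: Hd|exact: Hd'].
- exists (fun y => d y * k' y + k y * d' y); split=> [|y y0].
    by apply: kclassD; exact: kclassM.
  by apply: is_pdM; [exact: Hd|exact: Hd'].
Qed.

Lemma kclass_bound k (r M : R) : 0 < r -> kclass k ->
  exists C : R, forall y, r <= `|y| <= M -> `|k y| <= C.
Proof.
move=> r0; elim=> {k} [c|i||k k' kk [C HC] kk' [C' HC']|k k' kk [C HC] kk' [C' HC']].
- by exists `|c|.
- by exists M => y /andP[_]; apply: le_trans; exact: coord_le_norm.
- exists r^-1 => y /andP[ry _]; have re := le_trans ry (norm_le_enorm y).
  rewrite /einv normfV ger0_norm ?enorm_ge0// lef_pV2 ?posrE//.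
  exact: lt_le_trans re.
- exists (C + C') => y yr; apply: le_trans (ler_normD _ _) _.
  by apply: lerD; [exact: HC|exact: HC'].
- exists (C * C') => y yr; rewrite normrM.
  by apply: ler_pM => //; [exact: HC|exact: HC'].
Qed.

Lemma kclass_msr k : kclass k -> msr k.
Proof.
elim=> {k} [c|i||k k' kk mk kk' mk'|k k' kk mk kk' mk'].
- exact: msr_cst.
- exact: msr_coord.
- have -> : einv = (fun y => enorm y `^ (-1)) by apply/funext => y; rewrite powR_inv1// enorm_ge0.
  by apply: msr_powR; exact: msr_enorm.
- exact: msrD.
- exact: msrM.
Qed.

Lemma kclass_cont k y : y != 0 -> kclass k -> {for y, continuous k}.
Proof.
move=> y0; elim=> {k} [c|i||k k' kk mk kk' mk'|k k' kk mk kk' mk'].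
- exact: cst_continuous.
- exact: coord_continuous.
- by apply: continuousV; [rewrite gt_eqF// enorm_gt0|exact: enorm_continuous].
- exact: continuousD.
- exact: continuousM.
Qed.

End Kernels.

(** * Potentials off the support of their density *)

Section SmoothPotential.
Variable R : realType.
Local Notation pt := 'rV[R]_3.
Local Notation P := (@point_of R).
Implicit Types (f g h : pt -> R) (x y v : pt) (i j : 'I_3) (U V : set pt).
Variables (L : R) (rho : pt -> R) (V : set pt).
Hypotheses (irho : itg rho) (rhoL : forall x, ~ box 0 L x -> rho x = 0)
  (oV : open V) (rhoV : forall x, V x -> rho x = 0).

(** For y near x and [rho xi] nonzero, y - xi stays in an annulus around the origin: [rho] vanishes
    on a ball around x and off a box. On the annulus [k] is bounded. *)
Lemma kernel_bound k x : kclass k -> V x -> exists2 r : R, 0 < r & exists C : R,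
  forall y xi, `|y - x| < r -> `|k (y - xi) * rho xi| <= C * `|rho xi| /\
   (rho xi != 0 -> y - xi != 0).
Proof.
move=> kk Vx; have /open_normP/(_ x Vx)[r r0 rV] := oV.
have r20 : 0 < r / 2 by rewrite divr_gt0.
have [C HC] := kclass_bound (`|x| + r / 2 + L) r20 kk.
exists (r / 2) => //; exists C => y xi yx.
have [->|r1] := eqVneq (rho xi) 0; first by rewrite mulr0 normr0 mulr0.
have xi1 : `|xi| <= L.
  rewrite leNgt; apply/negP => Lx; move/eqP: r1; apply; apply: rhoL.
  by rewrite /box /= subr0; apply/negP; rewrite -ltNge.
have xi2 : r <= `|xi - x|.
  by rewrite leNgt; apply/negP => /rV /rhoV; exact/eqP.
have yxi : r / 2 <= `|y - xi|.
  have : `|xi - x| <= `|y - x| + `|y - xi|.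
    by rewrite -(subrKA y xi (- x)) [leRHS]addrC (distrC y xi) ler_normD.
  lra.
split; last by move=> _; rewrite -normr_gt0; lra.
rewrite normrM ler_wpM2r// HC// yxi /=.
have : `|y - xi| <= `|x| + `|y - x| + `|xi|.
  have -> : y - xi = x + (y - x) - xi by rewrite [x + _]addrC subrK.
  by apply: (le_trans (ler_normB _ _)); rewrite lerD2r ler_normD.
lra.
Qed.

Lemma msr_pot k x : kclass k -> msr (fun xi => k (x - xi) * rho xi).
Proof.
by move=> kk; apply: msrM; [apply: msr_refl; exact: kclass_msr|exact: itg_msr].
Qed.

Lemma itg_pot_off k x : kclass k -> V x -> itg (fun xi => k (x - xi) * rho xi).
Proof.
move=> kk Vx; have [r r0 [C H]] := kernel_bound kk Vx.
apply: (itg_le (msr_pot x kk) _ (itgZ C (itg_norm irho))) => xi.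
by have [] := H x xi; rewrite ?subrr ?normr0.
Qed.

Lemma pot_cont_off k x : kclass k -> V x -> {for x, continuous (pot k rho)}.
Proof.
move=> kk Vx; have [r r0 [C H]] := kernel_bound kk Vx.
apply: (@cont_intg _ (fun x xi => k (x - xi) * rho xi) x _ r r0 (itgZ C (itg_norm irho))).
- by move=> y _; exact: msr_pot.
- by move=> y xi /(H y xi)[].
move=> xi; have [->|r1] := eqVneq (rho xi) 0.
  apply: (@eq_continuous_for _ _ (fun=> 0)) => [y|]; first by rewrite mulr0.
  exact: cst_continuous.
apply: (@continuousM _ _ (fun y : pt => k (y - xi)) (fun=> rho xi)); last exact: cst_continuous.
apply: (@continuous_comp _ _ _ (fun y : pt => y - xi) k).
  by apply: continuousB => //; exact: cst_continuous.
apply: kclass_cont => //.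
by have [|_] := H x xi; [rewrite subrr normr0|apply].
Qed.

(** Differentiation under the integral sign along the line t -> x + t e_j; for |t| < s the
    derivative is dominated by a multiple of |rho|. *)
Lemma is_pd_pot k k' j x : kclass k -> kclass k' ->
  (forall y, y != 0 -> is_pd j k y (k' y)) -> V x ->
  is_pd j (pot k rho) x (pot k' rho x).
Proof.
move=> kk kk' kE Vx.
have [r r0 [C H]] := kernel_bound kk Vx.
have [r' r0' [C' H']] := kernel_bound kk' Vx.
pose s := Num.min r r'.
have s0 : 0 < s by rewrite lt_min r0.
pose F (t : R) q := k (x + t *: ej R j - P q) * rho (P q).
have near t : `]-s, s[%classic t -> `|x + t *: ej R j - x| < s.
  rewrite /= in_itv /= -ltr_norml addrAC subrr add0r normrZ => ts.
  by apply: le_lt_trans ts; rewrite ler_piMr// norm_ej.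
have nearr t : `]-s, s[%classic t -> `|x + t *: ej R j - x| < r.
  by move=> /near ts; apply: lt_le_trans ts _; rewrite ge_min lexx.
have nearr' t : `]-s, s[%classic t -> `|x + t *: ej R j - x| < r'.
  by move=> /near ts; apply: lt_le_trans ts _; rewrite ge_min lexx orbT.
have dF (t : R) q : `]-s, s[%classic t -> is_derive t 1 (F ^~ q) (k' (x + t *: ej R j - P q) * rho (P q)).
  move=> ts; have [r1|r1] := eqVneq (rho (P q)) 0.
    rewrite /F r1 mulr0; have -> : (fun t : R => k (x + t *: ej R j - P q) * 0) = (fun=> 0).
      by apply/funext => u; rewrite mulr0.
    exact: is_derive_cst.
  have nz : x + t *: ej R j - P q != 0 by have [_] := H _ (P q) (nearr t ts); apply.
  apply/(@is_derive_line _ (fun y => k (y - P q) * rho (P q))).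
  have := is_pdM (is_pd_translate (kE _ nz)) (is_pd_cst j (rho (P q)) (x + t *: ej R j)).
  by apply: is_pd_eq; rewrite mulr0 addr0.
have := @cvg_differentiation_under_integral R _ _ (@lam R) F setT measurableT 0 (-s) s.
move=> /(_ _ _ _ (fun q => C' * `|rho (P q)|)) cv.
have {}cv : h^-1 *: ((fun x' : R => \int[@lam R]_q F x' q) (h + 0) - (fun x' : R => \int[@lam R]_q F x' q) 0) @[h --> 0^'] -->
   \int[@lam R]_q partial1of2 F 0 q.
  apply: cv.
  - by rewrite /= in_itv /= oppr_lt0 s0.
  - move=> t ts.
    have := itg_le (msr_pot (x + t *: ej R j) kk) (fun xi => (H _ xi (nearr t ts)).1) (itgZ C (itg_norm irho)).
    by [].
  - by move=> t q ts _; have [] := dF t q ts.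
  - move=> q; have [] := H' x (P q); first by rewrite subrr normr0.
    by move=> /(le_trans (normr_ge0 _)).
  - exact: itgZ (itg_norm irho).
  - move=> t q ts _; rewrite partial1of2E.
    have [_ ->] := dF t q ts.
    by have [] := H' _ (P q) (nearr' t ts).
have E : \int[@lam R]_q partial1of2 F 0 q = pot k' rho x.
  apply: eq_Rintegral => q _; rewrite partial1of2E.
  have [|_ ->] := dF 0 q; first by rewrite /= in_itv /= oppr_lt0 s0.
  by rewrite scale0r addr0.
rewrite E in cv.
have E2 : (fun h : R => h^-1 *: ((pot k rho \o shift x) (h *: ej R j) - pot k rho x)) =
  (fun h : R => h^-1 *: ((fun x' : R => \int[@lam R]_q F x' q) (h + 0) - (fun x' : R => \int[@lam R]_q F x' q) 0)).
  apply/funext => h /=; congr (_ *: (_ - _)); apply: eq_Rintegral => q _; rewrite /F.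
    by rewrite addr0 [h *: _ + _]addrC.
  by rewrite scale0r addr0.
apply: DeriveDef.
  by rewrite /derivable E2; apply/cvg_ex; eexists; exact: cv.
by rewrite /derive E2; exact: cvg_lim cv.
Qed.

Lemma pot_Cn k n : kclass k -> Cn n V (pot k rho).
Proof.
elim: n k => [|n IH] k kk; first by split=> // x; exact: pot_cont_off.
split=> [x|j]; first exact: pot_cont_off.
have [k' [kk' kE]] := kclass_pd j kk.
have H x : V x -> is_pd j (pot k rho) x (pot k' rho x) by exact: is_pd_pot.
split=> [x /H /is_pdP[]//|].
apply: Cn_eq (IH _ kk') => // x /H /is_pdP[]//.
Qed.

End SmoothPotential.

(** * First and second derivatives of the Newton gradient *)

Section KernelIdentities.
Variable R : realType.
Local Notation pt := 'rV[R]_3.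
Implicit Types (x y : pt) (i j l : 'I_3).

Lemma knE i : kn i = (fun y : pt => y 0 i * einv y ^+ 3).
Proof. by apply/funext => y; rewrite /kn /einv exprVn. Qed.

Definition dkn i j (y : pt) : R :=
  (i == j)%:R * einv y ^+ 3 + -3 * (y 0 i * (y 0 j * einv y ^+ 5)).

Definition ddkn i j l (y : pt) : R :=
  -3 * (((i == j)%:R * y 0 l + (i == l)%:R * y 0 j + (j == l)%:R * y 0 i) * einv y ^+ 5)
  + 15 * (y 0 i * (y 0 j * (y 0 l * einv y ^+ 7))).

(** Stated for an abstract [N] with d_j N = - y_j N^3, since both 1/|y| and its regularisation
    [nreg] satisfy this equation. *)
Lemma is_pd_exprn_inv (N : pt -> R) j n y :
  is_pd j N y (- (y 0 j * N y ^+ 3)) ->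
  is_pd j (fun y => N y ^+ n) y (- n%:R * (y 0 j * N y ^+ n.+2)).
Proof.
move=> dN; elim: n => [|n IH].
  have -> : (fun y => N y ^+ 0) = (fun=> 1 : R) by apply/funext => z; rewrite expr0.
  by apply: is_pd_eq (is_pd_cst j 1 y); rewrite oppr0 mul0r.
have -> : (fun y => N y ^+ n.+1) = (fun y => N y * N y ^+ n :> R).
  by apply/funext => z; rewrite exprS.
apply: is_pd_eq (is_pdM dN IH).
by rewrite -natr1 !exprS; ring.
Qed.

Lemma is_pd_coord_inv (N : pt -> R) i j y :
  is_pd j N y (- (y 0 j * N y ^+ 3)) ->
  is_pd j (fun y => y 0 i * N y ^+ 3) y
    ((i == j)%:R * N y ^+ 3 + -3 * (y 0 i * (y 0 j * N y ^+ 5))).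
Proof.
move=> dN; apply: is_pd_eq (is_pdM (is_pd_coord j i y) (is_pd_exprn_inv 3 dN)).
ring.
Qed.

Lemma is_pd_einvX j n y : y != 0 ->
  is_pd j (fun y => einv y ^+ n) y (- n%:R * (y 0 j * einv y ^+ n.+2)).
Proof. by move=> y0; apply: is_pd_exprn_inv; exact: is_pd_einv. Qed.

Lemma is_pd_kn i j y : y != 0 -> is_pd j (kn i) y (dkn i j y).
Proof. by move=> y0; rewrite knE; apply: is_pd_coord_inv; exact: is_pd_einv. Qed.

Lemma is_pd_dkn i j l y : y != 0 -> is_pd l (dkn i j) y (ddkn i j l y).
Proof.
move=> y0.
have h1 := is_pdZ (i == j)%:R (is_pd_einvX l 3 y0).
have h2 := is_pdM (is_pd_coord l j y) (is_pd_einvX l 5 y0).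
have h3 := is_pdZ (-3) (is_pdM (is_pd_coord l i y) h2).
apply: is_pd_eq (is_pdD h1 h3).
by rewrite /ddkn; ring.
Qed.

Lemma kclass_kn i : kclass (kn i : pt -> R).
Proof.
rewrite knE; apply: kclassM; first exact: kclass_coord.
by apply: kclassX; exact: kclass_einv.
Qed.

Lemma kclass_dkn i j : kclass (dkn i j).
Proof.
apply: kclassD; apply: kclassM; try exact: kclass_cst.
  by apply: kclassX; exact: kclass_einv.
apply: kclassM; first exact: kclass_coord.
apply: kclassM; first exact: kclass_coord.
by apply: kclassX; exact: kclass_einv.
Qed.

Lemma kclass_ddkn i j l : kclass (ddkn i j l).
Proof.
have ke n : kclass (fun y => einv y ^+ n : R) by apply: kclassX; exact: kclass_einv.
apply: kclassD; apply: kclassM; try exact: kclass_cst.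
  apply: kclassM => //; apply: kclassD; first apply: kclassD.
  - by apply: kclassM; [exact: kclass_cst|exact: kclass_coord].
  - by apply: kclassM; [exact: kclass_cst|exact: kclass_coord].
  - by apply: kclassM; [exact: kclass_cst|exact: kclass_coord].
by do 3 (apply: kclassM; first exact: kclass_coord).
Qed.

Lemma dkn_sym i j : dkn i j = dkn j i.
Proof. by apply/funext => y; rewrite /dkn eq_sym; ring. Qed.

Lemma einv_sqr y : y != 0 -> (y 0 0 ^+ 2 + y 0 1 ^+ 2 + y 0 2 ^+ 2) * einv y ^+ 2 = 1.
Proof.
move=> y0; rewrite -enorm_sqr /einv exprVn mulfV// expf_neq0// gt_eqF//.
exact: enorm_gt0.
Qed.

(** The trace is the Laplacian of -1/|y|; [ddkn_trace] is the same fact for its derivatives. *)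
Lemma dkn_trace y : y != 0 -> \sum_i dkn i i y = 0.
Proof.
move=> /einv_sqr H; rewrite sum3 /dkn !eqxx /=.
transitivity (3 * einv y ^+ 3 * (1 - (y 0 0 ^+ 2 + y 0 1 ^+ 2 + y 0 2 ^+ 2) * einv y ^+ 2)); first by ring.
by rewrite H subrr mulr0.
Qed.

Lemma ddkn_trace i y : y != 0 -> \sum_l ddkn i l l y = 0.
Proof.
move=> /einv_sqr H.
transitivity (15 * y 0 i * einv y ^+ 5 * ((y 0 0 ^+ 2 + y 0 1 ^+ 2 + y 0 2 ^+ 2) * einv y ^+ 2 - 1)); last by rewrite H subrr mulr0.
rewrite sum3 /ddkn !eqxx /=.
by case: (ord3P i) => -> /=; rewrite ?eqxx; ring.
Qed.

End KernelIdentities.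

(** * Curl equations off the support of the density *)

Section OffSupport.
Variable R : realType.
Local Notation pt := 'rV[R]_3.
Implicit Types (x y : pt) (i j l : 'I_3).

(* Up to sign, the scalar and vector parts of the convolution of the vector field
   [rho] with the quaternionic Cauchy kernel y/|y|^3. *)
Definition trp (rho : 'I_3 -> pt -> R) x : R := \sum_i pot (kn i) (rho i) x.
Definition rotp (rho : 'I_3 -> pt -> R) i j x : R :=
  pot (kn i) (rho j) x - pot (kn j) (rho i) x.

Variables (L : R) (rho : 'I_3 -> pt -> R) (V : set pt).
Hypotheses (irho : forall j, itg (rho j))
  (rhoL : forall j x, ~ box 0 L x -> rho j x = 0)
  (oV : open V) (rhoV : forall j x, V x -> rho j x = 0).

Lemma is_pd_pot_kn i j l x : V x ->
  is_pd l (pot (kn i) (rho j)) x (pot (dkn i l) (rho j) x).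
Proof.
apply: (is_pd_pot (L := L) (V := V)) => //; [exact: rhoL|exact: rhoV|exact: kclass_kn|exact: kclass_dkn|].
by move=> y; exact: is_pd_kn.
Qed.

Lemma is_pd_pot_dkn i j l m x : V x ->
  is_pd m (pot (dkn i l) (rho j)) x (pot (ddkn i l m) (rho j) x).
Proof.
apply: (is_pd_pot (L := L) (V := V)) => //; [exact: rhoL|exact: rhoV|exact: kclass_dkn|exact: kclass_ddkn|].
by move=> y; exact: is_pd_dkn.
Qed.

(** Where [rho j] is nonzero, xi differs from x, as [rho j] vanishes on [V]; the pole of the kernels
    is never met. *)
Lemma pot_sum0 (k : 'I_3 -> pt -> R) j x : (forall l, kclass (k l)) ->
  (forall y, y != 0 -> \sum_l k l y = 0) -> V x ->
  \sum_l pot (k l) (rho j) x = 0.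
Proof.
move=> kk k0 Vx; rewrite sum3 /pot.
have ik l := itg_pot_off (irho j) (@rhoL j) oV (@rhoV j) (kk l) Vx.
rewrite -intgD// -intgD//; last exact: itgD.
rewrite -(@intg0 R); apply: eq_intg => xi; rewrite -!mulrDl.
have [->|r0] := eqVneq (rho j xi) 0; first by rewrite mulr0.
rewrite -(sum3 (fun l => k l (x - xi))) k0 ?mul0r//.
by apply: contra_neq r0 => /eqP; rewrite subr_eq0 => /eqP <-; exact: rhoV.
Qed.

Lemma is_pd_rotp i j l x : V x ->
  is_pd l (rotp rho i j) x (pot (dkn i l) (rho j) x - pot (dkn j l) (rho i) x).
Proof. by move=> Vx; apply: is_pdB; exact: is_pd_pot_kn. Qed.

Lemma is_pd_trp l x : V x -> is_pd l (trp rho) x (\sum_i pot (dkn i l) (rho i) x).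
Proof. by move=> Vx; apply: is_pd_sum => i; exact: is_pd_pot_kn. Qed.

(** The six terms cancel in pairs, because [dkn] consists of second derivatives of -1/|y| and is
    symmetric. *)
Lemma rotp_div x : V x ->
  pd 0 (rotp rho 1 2) x + pd 1 (rotp rho 2 0) x + pd 2 (rotp rho 0 1) x = 0.
Proof.
move=> Vx; have E i j l : pd l (rotp rho i j) x = pot (dkn i l) (rho j) x - pot (dkn j l) (rho i) x.
  by have /is_pdP[] := is_pd_rotp i j l Vx.
rewrite !E (dkn_sym _ 1 0) (dkn_sym _ 2 0) (dkn_sym _ 2 1); ring.
Qed.

(** By symmetry of [dkn] the right side is the gradient minus the potential of [rho l] for the trace
    of [dkn], and this trace vanishes. *)
Lemma trp_grad l x : V x -> pd l (trp rho) x = \sum_i pd i (rotp rho l i) x.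
Proof.
move=> Vx; have /is_pdP[_ ->] := is_pd_trp l Vx.
have E i : pd i (rotp rho l i) x = pot (dkn i l) (rho i) x - pot (dkn i i) (rho l) x.
  by have /is_pdP[_ ->] := is_pd_rotp l i i Vx; rewrite dkn_sym.
under [RHS]eq_bigr do rewrite E.
rewrite big_split/= sumrN (pot_sum0 (k := fun i => dkn i i)) ?oppr0 ?addr0//.
  by move=> i; exact: kclass_dkn.
by move=> y; exact: dkn_trace.
Qed.

Lemma rotp_Cn i j n : Cn n V (rotp rho i j).
Proof.
have C a b : Cn n V (pot (kn a) (rho b)).
  exact: (pot_Cn (irho b) (@rhoL b) oV (@rhoV b) n (kclass_kn _ a)).
apply: (@Cn_eq _ _ _ (fun x => pot (kn i) (rho j) x + -1 * pot (kn j) (rho i) x)) => //.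
  by move=> x _; rewrite mulN1r.
by apply: CnD => //; apply: CnZ.
Qed.

Lemma trp_Cn n : Cn n V (trp rho).
Proof.
have C a b : Cn n V (pot (kn a) (rho b)).
  exact: (pot_Cn (irho b) (@rhoL b) oV (@rhoV b) n (kclass_kn _ a)).
apply: (@Cn_eq _ _ _ (fun x => pot (kn 0) (rho 0) x + pot (kn 1) (rho 1) x + pot (kn 2) (rho 2) x)) => //.
  by move=> x _; rewrite /trp sum3.
by apply: CnD => //; apply: CnD.
Qed.

Lemma rotp_harmonic i j x : V x -> \sum_l pd l (pd l (rotp rho i j)) x = 0.
Proof.
move=> Vx.
have [r r0 rV] := (open_normP V).1 oV x Vx.
have E l : pd l (pd l (rotp rho i j)) x = pot (ddkn i l l) (rho j) x - pot (ddkn j l l) (rho i) x.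
  have h := is_pdB (is_pd_pot_dkn i j l l Vx) (is_pd_pot_dkn j i l l Vx).
  have h' : is_pd l (pd l (rotp rho i j)) x (pot (ddkn i l l) (rho j) x - pot (ddkn j l l) (rho i) x).
    apply: (is_pd_local r0 _ h) => y /rV Vy.
    by have /is_pdP[_ ->] := is_pd_rotp i j l Vy.
  by have /is_pdP[] := h'.
under eq_bigr do rewrite E.
rewrite big_split/= sumrN.
have Z a b : \sum_l pot (ddkn a l l) (rho b) x = 0.
  apply: (@pot_sum0 (fun l => ddkn a l l)) => //; first by move=> l; exact: kclass_ddkn.
  by move=> y; exact: ddkn_trace.
by rewrite !Z subrr.
Qed.

End OffSupport.

(** * Reproduction of compactly supported functions *)

Section CompactSupport.
Variable R : realType.
Local Notation pt := 'rV[R]_3.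
Implicit Types (f g h u v rho : pt -> R) (x y z : pt) (i j l : 'I_3).

Lemma box_compact (c : pt) (r : R) : compact (box c r).
Proof.
apply: bounded_closed_compact; last exact: closed_norm_le.
exists (`|c| + r); split; first exact: num_real.
move=> M cM x; rewrite /box /= => xc; apply/ltW/(le_lt_trans _ cM).
by rewrite -(subrK c x) addrC (le_trans (ler_normD _ _))// lerD2l.
Qed.

Lemma cc_bounded g (L : R) : 0 <= L -> continuous g -> (forall x, ~ box 0 L x -> g x = 0) ->
  exists M : R, forall x, `|g x| <= M.
Proof.
move=> L0 cg gL.
have [|||c cb H] := @EVT_max_rV R 3 (fun x => `|g x|) (box 0 L).
- by exists 0; rewrite /box /= subrr normr0.
- exact: box_compact.
- by apply: continuous_subspaceT => x; apply: (@continuous_comp _ _ _ g (@Num.norm _ R)); [exact: cg|exact: norm_continuous].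
exists `|g c| => x; have [xb|xb] := pselect (box 0 L x); last by rewrite gL// normr0.
by apply: H; rewrite inE.
Qed.

Lemma itg_cc g (L : R) : 0 <= L -> continuous g -> (forall x, ~ box 0 L x -> g x = 0) -> itg g.
Proof.
move=> L0 cg gL; have [M gM] := cc_bounded L0 cg gL.
exact: (itg_bounded L0 (msr_cont cg) gM gL).
Qed.

Lemma cc_dens g (L : R) : 0 <= L -> continuous g -> (forall x, ~ box 0 L x -> g x = 0) -> dens 4 L g.
Proof.
move=> L0 cg gL; have [M gM] := cc_bounded L0 cg gL.
by apply: (bounded_dens L0 _ (msr_cont cg) gM gL).
Qed.

Definition C1c (L : R) u := Cn 1 setT u /\ forall x, ~ box 0 L x -> u x = 0.

Lemma C1c_cont L u : C1c L u -> continuous u.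
Proof. by move=> [[cu _] _] x; exact: cu. Qed.

Lemma C1c_pd_cont L u j : C1c L u -> continuous (pd j u).
Proof. by move=> [[_ /(_ j)[_ [cu _]]] _] x; exact: cu. Qed.

Lemma C1c_is_pd L u j x : C1c L u -> is_pd j u x (pd j u x).
Proof. by move=> [cu _]; exact: Cn_is_pd cu _. Qed.

Lemma C1cP L u (d : 'I_3 -> pt -> R) : (forall j x, is_pd j u x (d j x)) ->
  continuous u -> (forall j, continuous (d j)) -> (forall x, ~ box 0 L x -> u x = 0) -> C1c L u.
Proof.
move=> ud cu cd uL; split => //; split=> [x _|k]; first exact: cu.
have E : pd k u = d k by apply/funext => x; have /is_pdP[] := ud k x.
rewrite E; split=> [x _|]; first by have /is_pdP[] := ud k x.
by split=> // x _; exact: cd.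
Qed.

Lemma C1c_pd0 L u j x : C1c L u -> ~ box 0 L x -> pd j u x = 0.
Proof.
move=> [cu uL] xL.
have oV : open (~` box 0 L) by rewrite openC; exact: closed_norm_le.
have [r r0 rV] := (open_normP _).1 oV x xL.
have /is_pdP[_ ->] : is_pd j u x 0 => //.
by apply: (is_pd_local r0 _ (is_pd_cst j 0 x)) => y /rV /uL.
Qed.

(** The path from y to x consists of three coordinate segments, with the mean value theorem on each;
    the partial derivatives are bounded by compactness. *)
Lemma C1c_lip L u : 0 <= L -> C1c L u -> exists2 M : R, 0 <= M & forall x y, `|u x - u y| <= M * `|x - y|.
Proof.
move=> L0 cu.
have B j : exists M : R, forall x, `|pd j u x| <= M.
  by apply: (cc_bounded L0 (C1c_pd_cont cu)) => x; exact: C1c_pd0.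
have [M0 H0] := B 0; have [M1 H1] := B 1; have [M2 H2] := B 2.
have M00 := le_trans (normr_ge0 _) (H0 0); have M10 := le_trans (normr_ge0 _) (H1 0).
have M20 := le_trans (normr_ge0 _) (H2 0).
exists (M0 + M1 + M2) => [|x y]; first by rewrite !addr_ge0.
pose t k := x 0 k - y 0 k.
have tb k : `|t k| <= `|x - y| by have := coord_le_norm (x - y) k; rewrite !mxE.
pose z1 := y + t 0 *: ej R 0; pose z2 := z1 + t 1 *: ej R 1.
have xE : x = z2 + t 2 *: ej R 2.
  by apply/rowP => k; rewrite !mxE /t; case: (ord3P k) => -> /=; rewrite ?mulr1 ?mulr0 ?addr0 addrC subrK.
have step j M z : (forall x, `|pd j u x| <= M) -> 0 <= M ->
    `|u (z + t j *: ej R j) - u z| <= M * `|x - y|.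
  move=> HM Mge; apply: le_trans (ler_wpM2l Mge (tb j)).
  by apply: mvt_line => s _ //; have /is_pdP[] := C1c_is_pd j (z + s *: ej R j) cu.
have s0 := step 0 _ y H0 M00; have s1 := step 1 _ z1 H1 M10; have s2 := step 2 _ z2 H2 M20.
rewrite -/z1 in s0; rewrite -/z2 in s1; rewrite -xE in s2.
have -> : u x - u y = (u z1 - u y) + (u z2 - u z1) + (u x - u z2) by ring.
rewrite 2!mulrDl; apply: (le_trans (ler_normD _ _)); apply: lerD => //.
by apply: (le_trans (ler_normD _ _)); apply: lerD.
Qed.

Lemma is_pd_seq j g x d : is_pd j g x d ->
  n.+1%:R * (g (x + n.+1%:R^-1 *: ej R j) - g x) @[n --> \oo] --> d.
Proof.
move=> [dg dgE].
have cv : (fun h : R => h^-1 *: ((g \o shift x) (h *: ej R j) - g x)) @ 0^' --> d.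
  by rewrite -dgE; exact: dg.
move/cvgrPdist_lt : cv => cv; apply/cvgrPdist_lt => e /cv [r /= r0 H].
near=> n.
have nr : n.+1%:R^-1 < r by near: n; exact: near_infty_natSinv_lt (PosNum r0).
have := H n.+1%:R^-1; rewrite /ball_ /= sub0r normrN ger0_norm ?invr_ge0//.
move=> /(_ nr); rewrite invr_neq0 ?pnatr_eq0// => /(_ isT).
by rewrite invrK [_ *: (_ - _)]/(_ * _) [_ *: _ + _]addrC.
Unshelve. all: by end_near. Qed.

(** The difference quotients have integral 0 by translation invariance and converge to the
    derivative. The mean value theorem bounds them by M on the box enlarged by 1, off which they
    vanish. *)
Lemma intg_pd_eq0 L u j : 0 <= L -> C1c L u -> intg (pd j u) = 0.
Proof.
move=> L0 cu.
have iu : itg u by apply: (itg_cc L0 (C1c_cont cu)); exact: cu.2.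
have [M HM] : exists M : R, forall x, `|pd j u x| <= M.
  by apply: (cc_bounded L0 (C1c_pd_cont cu)) => x; exact: C1c_pd0.
have M0 := le_trans (normr_ge0 _) (HM 0).
pose f (n : nat) x := n.+1%:R * (u (x + n.+1%:R^-1 *: ej R j) - u x).
have L1 : 0 <= L + 1 by rewrite addr_ge0.
have invn (n : nat) : `|n.+1%:R^-1 : R| = n.+1%:R^-1 by rewrite ger0_norm// invr_ge0.
have fE n x : `|f n x| <= M * \1_(box 0 (L + 1)) x.
  rewrite indicE; have [|xb] := boolP (x \in box 0 (L + 1)) => [_|].
    rewrite mulr1 /f normrM ger0_norm// mulrC -ler_pdivlMr ?ltr0n//.
    have := @mvt_line _ u x j n.+1%:R^-1 M; rewrite invn; apply => // s _.
    by have /is_pdP[] := C1c_is_pd j (x + s *: ej R j) cu.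
  have {}xb : ~ box 0 (L + 1) x by move=> xb'; rewrite mem_set in xb.
  have xL : L + 1 < `|x| by move/negP: xb; rewrite /box /= subr0 -ltNge.
  have out y : `|y - x| <= 1 -> u y = 0.
    move=> yx; apply: cu.2; rewrite /box /= subr0; apply/negP; rewrite -ltNge.
    have : `|x| <= `|y - x| + `|y|.
      by rewrite distrC -[X in `|X| <= _](subrK y) (le_trans (ler_normD _ _)).
    lra.
  rewrite mulr0 /f !out ?subrr ?mulr0 ?normr0//.
  rewrite addrAC subrr add0r normrZ invn.
  by apply: mulr_ile1 => //; [rewrite invf_le1 ?ltr0n// ler1n|exact: norm_ej].
have mf n : msr (f n).
  apply: msrM; first exact: msr_cst.
  by apply: msrB; [apply: msr_shift; exact: itg_msr|exact: itg_msr].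
have [_] := intg_dct mf (fun x => is_pd_seq (C1c_is_pd j x cu)) (itgZ M (itg_box 0 L1)) fE.
have -> : (fun n => intg (f n)) = (fun=> 0).
  apply/funext => n; rewrite /f intgZ; last by apply: itgB => //; exact: itg_shift.
  by rewrite intgB ?intg_shift ?subrr ?mulr0//; exact: itg_shift.
by move=> /(cvg_unique _ (cvg_cst 0)) <-.
Qed.

End CompactSupport.

(** * A regularised Newton kernel *)

Section Regularised.
Variable R : realType.
Local Notation pt := 'rV[R]_3.
Implicit Types (f g h u v rho : pt -> R) (x y z : pt) (i j l : 'I_3) (e : R).

(** A version of 1/|y| smooth at the origin; [kreg] is the gradient of its negative and [dkreg] the
    Hessian. *)
Definition nreg e (y : pt) : R := (Num.sqrt (enorm y ^+ 2 + e ^+ 2))^-1.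
Definition kreg e i (y : pt) : R := y 0 i * nreg e y ^+ 3.
Definition dkreg e i j (y : pt) : R :=
  (i == j)%:R * nreg e y ^+ 3 + -3 * (y 0 i * (y 0 j * nreg e y ^+ 5)).

Lemma nreg_arg_gt0 e y : 0 < e -> 0 < enorm y ^+ 2 + e ^+ 2.
Proof. by move=> e0; rewrite ltr_wpDl ?sqr_ge0// exprn_gt0. Qed.

Lemma nreg_gt0 e y : 0 < e -> 0 < nreg e y.
Proof. by move=> e0; rewrite invr_gt0 sqrtr_gt0 nreg_arg_gt0. Qed.

Lemma nreg_sqr e y : 0 < e -> (enorm y ^+ 2 + e ^+ 2) * nreg e y ^+ 2 = 1.
Proof.
move=> e0; have q0 := nreg_arg_gt0 y e0.
by rewrite /nreg exprVn (sqr_sqrtr (ltW q0)) mulfV// gt_eqF.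
Qed.

Lemma enorm_nreg_le1 e y : 0 < e -> enorm y * nreg e y <= 1.
Proof.
move=> e0; rewrite -(ler_pXn2r (n := 2)) ?nnegrE ?mulr_ge0 ?enorm_ge0 ?(ltW (nreg_gt0 y e0))//.
by rewrite expr1n exprMn -(nreg_sqr y e0) ler_wpM2r ?sqr_ge0// lerDl sqr_ge0.
Qed.

Lemma eps_nreg_le1 e y : 0 < e -> e * nreg e y <= 1.
Proof.
move=> e0; rewrite -(ler_pXn2r (n := 2)) ?nnegrE ?mulr_ge0 ?(ltW e0) ?(ltW (nreg_gt0 y e0))//.
by rewrite expr1n exprMn -(nreg_sqr y e0) ler_wpM2r ?sqr_ge0// lerDr sqr_ge0.
Qed.

Lemma is_pd_nreg e j y : 0 < e -> is_pd j (nreg e) y (- (y 0 j * nreg e y ^+ 3)).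
Proof.
move=> e0; have q0 := nreg_arg_gt0 y e0.
have Q : is_pd j (fun y => enorm y ^+ 2 + e ^+ 2) y (2 * y 0 j).
  have c k : is_pd j (fun y : pt => y 0 k ^+ 2) y (2 * y 0 k * (k == j)%:R).
    by apply: is_pd_eq (is_pdM (is_pd_coord j k y) (is_pd_coord j k y)); ring.
  have -> : (fun y : pt => enorm y ^+ 2 + e ^+ 2) = (fun y => y 0 0 ^+ 2 + y 0 1 ^+ 2 + y 0 2 ^+ 2 + e ^+ 2).
    by apply/funext => z; rewrite enorm_sqr.
  apply: is_pd_eq (is_pdD (is_pdD (is_pdD (c 0) (c 1)) (c 2)) (is_pd_cst j (e ^+ 2) y)).
  by case: (ord3P j) => -> /=; ring.
have S := is_pd_comp Q (is_derive1_sqrt q0).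
have s0 : Num.sqrt (enorm y ^+ 2 + e ^+ 2) != 0 by rewrite gt_eqF// sqrtr_gt0.
apply: is_pd_eq (is_pdV s0 S).
by rewrite /nreg; field.
Qed.

Lemma is_pd_kreg e i j y : 0 < e -> is_pd j (kreg e i) y (dkreg e i j y).
Proof. by move=> e0; apply: is_pd_coord_inv; exact: is_pd_nreg. Qed.

Lemma nreg_continuous e : 0 < e -> continuous (nreg e).
Proof.
move=> e0 y; have q0 := nreg_arg_gt0 y e0.
apply: (@continuousV _ _ (fun y : pt => Num.sqrt (enorm y ^+ 2 + e ^+ 2))).
  by rewrite gt_eqF// sqrtr_gt0.
apply: (@continuous_comp _ _ _ (fun y : pt => enorm y ^+ 2 + e ^+ 2) (@Num.sqrt R)); last exact: sqrt_continuous.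
apply: (@continuousD _ _ _ (fun y : pt => enorm y ^+ 2) (fun=> e ^+ 2)); last exact: cst_continuous.
by apply: (@continuous_comp _ _ _ (@enorm R) (fun t : R => t ^+ 2)); [exact: enorm_continuous|exact: exprn_continuous].
Qed.

Lemma nregX_continuous e n : 0 < e -> continuous (fun y => nreg e y ^+ n).
Proof.
move=> e0 y; apply: (@continuous_comp _ _ _ (nreg e) (fun t : R => t ^+ n)); last exact: exprn_continuous.
exact: nreg_continuous.
Qed.

Lemma kreg_continuous e i : 0 < e -> continuous (kreg e i).
Proof.
move=> e0 y; apply: (@continuousM _ _ (fun y : pt => y 0 i)); [exact: coord_continuous|exact: nregX_continuous].
Qed.

Lemma dkreg_continuous e i j : 0 < e -> continuous (dkreg e i j).
Proof.
move=> e0 y; apply: (@continuousD _ _ _ (fun y => (i == j)%:R * nreg e y ^+ 3)).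
  by apply: (@continuousM _ _ (fun=> (i == j)%:R)); [exact: cst_continuous|exact: nregX_continuous].
apply: (@continuousM _ _ (fun=> -3)); first exact: cst_continuous.
apply: (@continuousM _ _ (fun y : pt => y 0 i)); first exact: coord_continuous.
apply: (@continuousM _ _ (fun y : pt => y 0 j)); first exact: coord_continuous.
exact: nregX_continuous.
Qed.

Lemma dkreg_sym e i j : dkreg e i j = dkreg e j i.
Proof. by apply/funext => y; rewrite /dkreg eq_sym; ring. Qed.

(** This divergence is, up to a constant factor, an approximate identity as e tends to 0. *)
Lemma dkreg_trace e y : 0 < e -> \sum_i dkreg e i i y = 3 * (e ^+ 2 * nreg e y ^+ 5).
Proof.
move=> e0; rewrite sum3 /dkreg !eqxx /=.
have := nreg_sqr y e0; rewrite enorm_sqr => H.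
transitivity (3 * (e ^+ 2 * nreg e y ^+ 5) + 3 * nreg e y ^+ 3 * (1 - (y 0 0 ^+ 2 + y 0 1 ^+ 2 + y 0 2 ^+ 2 + e ^+ 2) * nreg e y ^+ 2)); first by ring.
by rewrite H subrr mulr0 addr0.
Qed.

Lemma nreg_le_einv e y : 0 < e -> y != 0 -> nreg e y <= einv y.
Proof.
move=> e0 y0; have h := enorm_gt0 y0.
by rewrite /einv -[leRHS]mul1r ler_pdivlMr// mulrC enorm_nreg_le1.
Qed.

Lemma kreg_bound e i y : 0 < e -> `|kreg e i y| <= enorm y `^ (-2).
Proof.
move=> e0; have [->|y0] := eqVneq y 0.
  by rewrite /kreg mxE mul0r normr0 powR_ge0.
apply: le_trans (norm_kn i y); rewrite knE /kreg [leLHS]normrM [leRHS]normrM ler_wpM2l//.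
have n0 := nreg_gt0 y e0; have i0 : 0 <= einv y by rewrite invr_ge0 enorm_ge0.
rewrite !normrX (ger0_norm (ltW n0)) (ger0_norm i0).
by rewrite ler_pXn2r ?nnegrE ?(ltW n0)// nreg_le_einv.
Qed.

Lemma kreg_cvg i y : kreg n.+1%:R^-1 i y @[n --> \oo] --> kn i y.
Proof.
have [->|y0] := eqVneq y 0.
  have -> : (fun n => kreg n.+1%:R^-1 i (0 : pt)) = (fun=> kn i (0 : pt)).
    by apply/funext => n; rewrite /kreg /kn !mxE !mul0r.
  exact: cvg_cst.
rewrite knE; apply: (@cvgM _ _ _ _ (fun=> y 0 i)); first exact: cvg_cst.
have einvE : einv y = nreg 0 y.
  by rewrite /einv /nreg expr0n addr0 sqrtr_sqr ger0_norm ?enorm_ge0.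
have C : {for (0 : R), continuous (fun e => nreg e y ^+ 3)}.
  apply: (@continuous_comp _ _ _ (fun e => nreg e y) (fun t : R => t ^+ 3)); last exact: exprn_continuous.
  apply: (@continuousV _ _ (fun e : R => Num.sqrt (enorm y ^+ 2 + e ^+ 2))).
    by rewrite expr0n addr0 sqrtr_sqr gt_eqF// normr_gt0 gt_eqF// enorm_gt0.
  apply: (@continuous_comp _ _ _ (fun e : R => enorm y ^+ 2 + e ^+ 2) (@Num.sqrt R)); last exact: sqrt_continuous.
  apply: (@continuousD _ _ _ (fun=> enorm y ^+ 2) (fun e : R => e ^+ 2)); first exact: cst_continuous.
  exact: exprn_continuous.
have Z : (n.+1%:R^-1 : R) @[n --> \oo] --> (0 : R).
  apply/cvgrPdist_lt => e e0; near=> n.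
  rewrite sub0r normrN ger0_norm ?invr_ge0//.
  by near: n; exact: near_infty_natSinv_lt (PosNum e0).
rewrite einvE; exact: (cvg_comp _ _ Z C).
Unshelve. all: by end_near. Qed.

Lemma itg_newton p L rho x : 0 <= L -> 3 < p -> dens p L rho ->
  itg (fun xi => enorm (x - xi) `^ (-2) * `|rho xi|).
Proof.
move=> L0 p3 dr.
have ir : itg rho by apply: (dens_itg L0 _ dr); lra.
have [d d0 /(_ x)[ig _]] := pot_near L0 p3 dr ltr01.
apply: (itg_le _ _ (itgD ig (itgZ (d `^ (-2)) (itg_norm ir)))).
  apply: msrM; last by apply: msr_norm; exact: itg_msr.
  by apply: (msr_refl (g := fun y => enorm y `^ (-2))); apply: msr_powR; exact: msr_enorm.
move=> xi; rewrite ger0_norm ?mulr_ge0 ?powR_ge0// indicE.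
have [_|xb] := boolP (x - xi \in box 0 d).
  by rewrite mul1r lerDl mulr_ge0 ?powR_ge0.
rewrite !mul0r add0r ler_wpM2r//.
have {}xb : d < `|x - xi|.
  by rewrite ltNge; apply: contra xb => xd; rewrite inE /box /= subr0.
have de : d < enorm (x - xi) by apply: (lt_le_trans xb); exact: norm_le_enorm.
rewrite !powRN lef_pV2 ?posrE ?powR_gt0 ?(lt_trans d0 de)//.
by apply: ge0_ler_powR; rewrite ?nnegrE ?enorm_ge0 ?(ltW d0) ?(ltW de).
Qed.

End Regularised.

(** * Integration by parts and the reproducing property *)

Section Representation.
Variable R : realType.
Local Notation pt := 'rV[R]_3.
Implicit Types (f g h u v rho phi : pt -> R) (x y z xi : pt) (i j l : 'I_3) (e : R).

Lemma refl_continuous g x : continuous g -> continuous (fun xi : pt => g (x - xi)).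
Proof.
move=> cg xi; apply: (@continuous_comp _ _ _ (fun xi : pt => x - xi) g); last exact: cg.
by apply: (@continuousB _ _ _ (fun=> x) id) => //; exact: cst_continuous.
Qed.

Lemma mul_continuous g h : continuous g -> continuous h -> continuous (fun x : pt => g x * h x).
Proof. by move=> cg ch x; apply: continuousM; [exact: cg|exact: ch]. Qed.

Lemma by_parts e i j L u x : 0 <= L -> 0 < e -> C1c L u ->
  intg (fun xi => dkreg e i j (x - xi) * u xi) = intg (fun xi => kreg e i (x - xi) * pd j u xi).
Proof.
move=> L0 e0 cu.
pose v xi := kreg e i (x - xi) * u xi.
pose d l xi := - dkreg e i l (x - xi) * u xi + kreg e i (x - xi) * pd l u xi.
have vd l xi : is_pd l v xi (d l xi).
  by apply: is_pdM; [apply: is_pd_refl; exact: is_pd_kreg|exact: C1c_is_pd cu].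
have c1 l : continuous (fun xi : pt => dkreg e i l (x - xi) * u xi).
  by apply: mul_continuous; [apply: refl_continuous; exact: dkreg_continuous|exact: C1c_cont cu].
have c2 l : continuous (fun xi : pt => kreg e i (x - xi) * pd l u xi).
  by apply: mul_continuous; [apply: refl_continuous; exact: kreg_continuous|exact: C1c_pd_cont cu].
have cv : C1c L v.
  apply: (C1cP vd).
  - by apply: mul_continuous; [apply: refl_continuous; exact: kreg_continuous|exact: C1c_cont cu].
  - move=> l xi; apply: (@continuousD _ _ _ (fun xi => - dkreg e i l (x - xi) * u xi)); last exact: c2.
    apply: (@eq_continuous_for _ _ (fun xi => - (dkreg e i l (x - xi) * u xi))); first by move=> z; rewrite mulNr.
    by apply: continuousN; exact: c1.
  - by move=> z zL; rewrite /v cu.2// mulr0.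
have := intg_pd_eq0 j L0 cv.
have -> : pd j v = (fun xi => kreg e i (x - xi) * pd j u xi - dkreg e i j (x - xi) * u xi).
  by apply/funext => xi; have /is_pdP[_ ->] := vd j xi; rewrite /d mulNr addrC.
rewrite intgB; first by move/subr0_eq.
- by apply: (itg_cc L0 (c2 j)) => z zL; rewrite (C1c_pd0 j cu zL) mulr0.
- by apply: (itg_cc L0 (c1 j)) => z zL; rewrite cu.2// mulr0.
Qed.

Lemma pd_dens L u j : 0 <= L -> C1c L u -> dens 4 L (pd j u).
Proof.
move=> L0 cu; apply: (cc_dens L0 (C1c_pd_cont cu)) => x; exact: C1c_pd0.
Qed.

(** In the limit [dkreg] has size |y|^-3 and is not integrable. With the derivative moved to [u],
    the remaining kernel is dominated by |y|^-2 for every n. *)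
Lemma by_parts_cvg i j L u x : 0 <= L -> C1c L u ->
  intg (fun xi => dkreg n.+1%:R^-1 i j (x - xi) * u xi) @[n --> \oo] --> pot (kn i) (pd j u) x.
Proof.
move=> L0 cu.
have e0 (n : nat) : 0 < (n.+1%:R^-1 : R) by rewrite invr_gt0.
have -> : (fun n : nat => intg (fun xi => dkreg n.+1%:R^-1 i j (x - xi) * u xi)) =
   (fun n : nat => intg (fun xi => kreg n.+1%:R^-1 i (x - xi) * pd j u xi)).
  by apply/funext => n; exact: (by_parts i j x L0 (e0 n) cu).
have p43 : 3 < (4 : R) by rewrite ltr_nat.
have [|||] := @intg_dct R (fun n xi => kreg n.+1%:R^-1 i (x - xi) * pd j u xi) (fun xi => kn i (x - xi) * pd j u xi) _ _ _ (itg_newton x L0 p43 (pd_dens j L0 cu)).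
- move=> n; apply: msrM; last exact: msr_cont (C1c_pd_cont cu).
  by apply: msr_refl; apply: msr_cont; exact: kreg_continuous.
- move=> xi; apply: cvgM; [exact: kreg_cvg|exact: cvg_cst].
- by move=> n xi; rewrite normrM ler_wpM2r// kreg_bound.
by [].
Qed.

(** Both sides are limits of integrals against [dkreg], which is symmetric. Hence [rotp] vanishes on
    gradients of compactly supported functions. *)
Lemma pot_pd_sym i j L u x : 0 <= L -> C1c L u ->
  pot (kn i) (pd j u) x = pot (kn j) (pd i u) x.
Proof.
move=> L0 cu; have h1 := @by_parts_cvg i j L u x L0 cu.
have h2 := @by_parts_cvg j i L u x L0 cu.
have E : (fun n : nat => intg (fun xi => dkreg n.+1%:R^-1 i j (x - xi) * u xi)) =
   (fun n : nat => intg (fun xi => dkreg n.+1%:R^-1 j i (x - xi) * u xi)).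
  by apply/funext => n; rewrite dkreg_sym.
rewrite E in h1; exact: (cvg_unique _ h1 h2).
Qed.

Definition pot_trace u x : R := \sum_i pot (kn i) (pd i u) x.

Lemma pot_trace_cvg L u x : 0 <= L -> C1c L u ->
  intg (fun xi => 3 * (n.+1%:R^-1 ^+ 2 * nreg n.+1%:R^-1 (x - xi) ^+ 5) * u xi) @[n --> \oo] --> pot_trace u x.
Proof.
move=> L0 cu.
have H i := @by_parts_cvg i i L u x L0 cu.
have -> : (fun n : nat => intg (fun xi => 3 * (n.+1%:R^-1 ^+ 2 * nreg n.+1%:R^-1 (x - xi) ^+ 5) * u xi)) =
  (fun n : nat => intg (fun xi => dkreg n.+1%:R^-1 0 0 (x - xi) * u xi) +
   intg (fun xi => dkreg n.+1%:R^-1 1 1 (x - xi) * u xi) + intg (fun xi => dkreg n.+1%:R^-1 2 2 (x - xi) * u xi)).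
  apply/funext => n.
  have e0 : 0 < (n.+1%:R^-1 : R) by rewrite invr_gt0.
  have ii i : itg (fun xi => dkreg n.+1%:R^-1 i i (x - xi) * u xi).
    apply: (itg_cc L0); last by move=> z zL; rewrite cu.2// mulr0.
    by apply: mul_continuous; [apply: refl_continuous; exact: dkreg_continuous|exact: C1c_cont cu].
  rewrite -intgD// -intgD//; last exact: itgD.
  by apply: eq_intg => xi; rewrite -(dkreg_trace (x - xi) e0) sum3 !mulrDl.
by rewrite /pot_trace sum3; apply: cvgD; first apply: cvgD; exact: H.
Qed.

(* Lipschitz continuity at the zero [x] gains one power of the distance, so the
   approximate identity is dominated by the Newtonian kernel. *)
Lemma pot_trace_eq0 L u x : 0 <= L -> C1c L u -> u x = 0 -> pot_trace u x = 0.
Proof.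
move=> L0 cu ux0.
have [M M0 HM] := C1c_lip L0 cu.
have p43 : 3 < (4 : R) by rewrite ltr_nat.
have db : dens 4 L (\1_(box 0 L) : pt -> R).
  apply: (bounded_dens (M := 1) L0) => //.
  - by apply: msr_indic; exact: msrs_box.
  - by move=> z; rewrite indicE; case: (_ \in _); rewrite ?normr1 ?normr0.
  - by move=> z zL; rewrite indicE memNset.
have iN := itgZ (3 * M) (itg_newton x L0 p43 db).
have b n xi : `|3 * (n.+1%:R^-1 ^+ 2 * nreg n.+1%:R^-1 (x - xi) ^+ 5) * u xi| <=
   3 * M * (n.+1%:R^-1 ^+ 2 * nreg n.+1%:R^-1 (x - xi) ^+ 5 * enorm (x - xi)).
  have e0 : 0 < (n.+1%:R^-1 : R) by rewrite invr_gt0.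
  have n0 := nreg_gt0 (x - xi) e0.
  have k0 : 0 <= n.+1%:R^-1 ^+ 2 * nreg n.+1%:R^-1 (x - xi) ^+ 5.
    by rewrite mulr_ge0 ?exprn_ge0// ltW.
  rewrite normrM ger0_norm; last by rewrite mulr_ge0.
  have : `|u xi| <= M * enorm (x - xi).
    rewrite -[u xi]subr0 -ux0; apply: le_trans (HM xi x) _.
    by rewrite ler_wpM2l// distrC norm_le_enorm.
  move=> /(ler_wpM2l (mulr_ge0 (ler0n R 3) k0)) /le_trans; apply.
  by rewrite le_eqVlt; apply/orP; left; apply/eqP; ring.
(* Write N for [nreg] at y = x - xi: then e^2 N^5 |y| = (e N)^2 (|y| N) N^2, where e N and |y| N are
   at most 1 and N is at most 1/|y|. *)
have dom n xi : `|3 * (n.+1%:R^-1 ^+ 2 * nreg n.+1%:R^-1 (x - xi) ^+ 5) * u xi| <=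
   3 * M * (enorm (x - xi) `^ (-2) * `|\1_(box 0 L) xi|).
  rewrite [\1_ _ _]indicE; have [_|xL] := boolP (xi \in box 0 L); last first.
    rewrite cu.2; last by move=> xL'; rewrite mem_set in xL.
    by rewrite mulr0 normr0 !mulr_ge0 ?powR_ge0.
  rewrite normr1 mulr1; apply: le_trans (b n xi) _; rewrite ler_wpM2l ?mulr_ge0//.
  have e0 : 0 < (n.+1%:R^-1 : R) by rewrite invr_gt0.
  have n0 := nreg_gt0 (x - xi) e0.
  have [->|y0] := eqVneq (x - xi) 0; first by rewrite enorm0 mulr0 powR_ge0.
  have E0 := enorm_gt0 y0.
  have h1 := eps_nreg_le1 (x - xi) e0; have h2 := enorm_nreg_le1 (x - xi) e0.
  rewrite powR_invn ?enorm_ge0// -exprVn -/(einv (x - xi)).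
  have -> : n.+1%:R^-1 ^+ 2 * nreg n.+1%:R^-1 (x - xi) ^+ 5 * enorm (x - xi) =
     (n.+1%:R^-1 * nreg n.+1%:R^-1 (x - xi)) ^+ 2 * (enorm (x - xi) * nreg n.+1%:R^-1 (x - xi)) * nreg n.+1%:R^-1 (x - xi) ^+ 2 by ring.
  have h3 : nreg n.+1%:R^-1 (x - xi) ^+ 2 <= einv (x - xi) ^+ 2.
    by rewrite ler_pXn2r ?nnegrE ?(ltW n0) ?invr_ge0 ?(ltW E0)// nreg_le_einv.
  apply: le_trans h3; rewrite ler_piMl ?sqr_ge0//.
  apply: mulr_ile1 => //; first exact: sqr_ge0.
    by rewrite mulr_ge0 ?(ltW n0) ?(ltW E0).
  by rewrite exprn_ile1// mulr_ge0 ?(ltW n0) ?(ltW e0).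
have cvg0 xi : 3 * (n.+1%:R^-1 ^+ 2 * nreg n.+1%:R^-1 (x - xi) ^+ 5) * u xi @[n --> \oo] --> (0 : R).
  have [y0|y0] := eqVneq (x - xi) 0.
    have -> : u xi = 0 by rewrite -ux0; congr u; apply/esym/eqP; rewrite -subr_eq0 y0.
    by under eq_fun do rewrite mulr0; exact: cvg_cst.
  apply/cvgrPdist_lt => e e0.
  pose K := 3 * einv (x - xi) ^+ 5 * `|u xi| + 1.
  have K0 : 0 < K by rewrite ltr_wpDl// !mulr_ge0 ?exprn_ge0 ?invr_ge0 ?enorm_ge0.
  near=> n.
  have en : n.+1%:R^-1 < e / K by near: n; exact: near_infty_natSinv_lt (PosNum (divr_gt0 e0 K0)).
  have n10 : 0 < (n.+1%:R^-1 : R) by rewrite invr_gt0.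
  have n1 : (n.+1%:R^-1 : R) <= 1 by rewrite invf_le1 ?ltr0n// ler1n.
  have n0 := nreg_gt0 (x - xi) n10.
  rewrite sub0r normrN normrM ger0_norm; last by rewrite !mulr_ge0 ?exprn_ge0 ?(ltW n0).
  have h5 : nreg n.+1%:R^-1 (x - xi) ^+ 5 <= einv (x - xi) ^+ 5.
    by rewrite ler_pXn2r ?nnegrE ?(ltW n0) ?invr_ge0 ?enorm_ge0// nreg_le_einv.
  have h6 : (n.+1%:R^-1 : R) ^+ 2 <= n.+1%:R^-1 by rewrite expr2 ler_piMl// ltW.
  have h7 := ler_pM (sqr_ge0 _) (exprn_ge0 5 (ltW n0)) h6 h5.
  apply: (@le_lt_trans _ _ (n.+1%:R^-1 * K)); last by rewrite -ltr_pdivlMr.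
  apply: (@le_trans _ _ (3 * (n.+1%:R^-1 * einv (x - xi) ^+ 5) * `|u xi|)).
    by rewrite ler_wpM2r// ler_wpM2l.
  rewrite /K mulrDr mulr1; apply: (@le_trans _ _ (n.+1%:R^-1 * (3 * einv (x - xi) ^+ 5 * `|u xi|))); last by rewrite lerDl ltW.
  by rewrite le_eqVlt; apply/orP; left; apply/eqP; ring.
have [|] := @intg_dct R _ (fun=> 0) _ _ cvg0 iN dom.
  move=> n; have e0 : 0 < (n.+1%:R^-1 : R) by rewrite invr_gt0.
  apply: msrM; last exact: msr_cont (C1c_cont cu).
  apply: msrM; first exact: msr_cst.
  apply: msrM; first exact: msr_cst.
  by apply: (msr_refl (g := fun y => nreg _ y ^+ 5)); apply: msr_cont; exact: nregX_continuous.
move=> _; rewrite intg0 => h.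
exact: (cvg_unique _ (@pot_trace_cvg L u x L0 cu) h).
Unshelve. all: by end_near. Qed.

End Representation.

Section Constant.
Variable R : realType.
Local Notation pt := 'rV[R]_3.
Implicit Types (f g h u v rho : pt -> R) (x y z xi : pt) (i j l : 'I_3) (e : R).
Variable phi : pt -> R.
Hypotheses (cphi : C1c 1 phi) (phi0 : forall x, 0 <= phi x)
  (phi1 : forall x, `|x| <= 2^-1 -> phi x = 1).

Lemma C1c_affine L u (a : pt) (c : R) : 0 < c -> C1c L u ->
  C1c (`|a| + L / c) (fun x => u (c *: (x - a))).
Proof.
move=> c0 cu.
have aff (g : pt -> R) : continuous g -> continuous (fun x : pt => g (c *: (x - a))).
  move=> cg x; apply: (@continuous_comp _ _ _ (fun x : pt => c *: (x - a)) g); last exact: cg.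
  apply: (@continuous_comp _ _ _ (fun x : pt => x - a) ( *:%R c)); last exact: scaler_continuous.
  by apply: (@continuousB _ _ _ id (fun=> a)) => //; exact: cst_continuous.
apply: (C1cP (d := fun j x => c * pd j u (c *: (x - a)))).
- by move=> j x; apply: is_pd_affine; exact: C1c_is_pd cu.
- by apply: aff; exact: C1c_cont cu.
- move=> j; apply: mul_continuous; first exact: cst_continuous.
  by apply: aff; exact: C1c_pd_cont cu.
- move=> x xb; apply: cu.2; rewrite /box /= !subr0 in xb * => H; apply: xb.
  rewrite normrZ gtr0_norm// -ler_pdivlMl// mulrC in H.
  by rewrite -(subrK a x) addrC (le_trans (ler_normD _ _))// lerD2l.
Qed.

Lemma C1c_le L L' u : L <= L' -> C1c L u -> C1c L' u.
Proof.
move=> LL [cu uL]; split => // x xL'; apply: uL => xL; apply: xL'.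
by rewrite /box /= in xL *; exact: le_trans LL.
Qed.

Lemma C1cB L u v (c : R) : C1c L u -> C1c L v -> C1c L (fun x => u x - c * v x).
Proof.
move=> cu cv; apply: (C1cP (d := fun j x => pd j u x - c * pd j v x)).
- move=> j x; apply: is_pdB; first exact: C1c_is_pd cu.
  by apply: is_pdZ; exact: C1c_is_pd cv.
- move=> x; apply: (@continuousB _ _ _ u (fun x => c * v x)); first exact: (C1c_cont cu).
  by apply: (@mul_continuous _ (fun=> c) v); [exact: cst_continuous|exact: (C1c_cont cv)].
- move=> j x; apply: (@continuousB _ _ _ (pd j u) (fun x => c * pd j v x)); first exact: (C1c_pd_cont cu).
  by apply: (@mul_continuous _ (fun=> c) (pd j v)); [exact: cst_continuous|exact: (C1c_pd_cont cv)].
- by move=> x xL; rewrite cu.2// cv.2// mulr0 subrr.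
Qed.

(* This constant is 4 pi, but only its positivity matters. *)
Definition newton_const : R := pot_trace phi 0.

Lemma pot_pd_itg L u i j x : 0 <= L -> C1c L u -> itg (fun xi => kn i (x - xi) * pd j u xi).
Proof.
move=> L0 cu; apply: (pot_itg (p := 4) (L := L)) => //; first by rewrite ltr_nat.
exact: pd_dens.
Qed.

Lemma pot_translate k rho x : itg (fun xi => k (- xi) * rho xi) ->
  pot k (fun xi => rho (xi - x)) x = pot k rho 0.
Proof.
move=> ik; rewrite /pot -[RHS](intg_shift (- x)); last by apply: eq_itg ik => xi; rewrite sub0r.
by apply: eq_intg => xi; rewrite sub0r opprB.
Qed.

(** Subtract u(x) times the bump centred at x: the difference vanishes at x, where [pot_trace_eq0]
    applies, and a translation turns the bump term into [newton_const]. *)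
Lemma pot_trace_represent L u x : 0 <= L -> C1c L u -> pot_trace u x = newton_const * u x.
Proof.
move=> L0 cu.
pose psi := fun xi => phi (xi - x).
have cpsi : C1c (`|x| + 1) psi.
  have := C1c_affine x ltr01 cphi; rewrite divr1.
  by have -> : (fun z => phi (1 *: (z - x))) = psi by apply/funext => z; rewrite scale1r.
pose L' := Num.max L (`|x| + 1).
have L'0 : 0 <= L' by rewrite le_max L0.
have cu' : C1c L' u by apply: C1c_le cu; rewrite le_max lexx.
have cpsi' : C1c L' psi by apply: C1c_le cpsi; rewrite le_max lexx orbT.
have cw := C1cB (u x) cu' cpsi'.
have w0 : u x - u x * psi x = 0.
  by rewrite /psi subrr phi1 ?mulr1 ?subrr// normr0 invr_ge0.
have E i : pot (kn i) (pd i (fun z => u z - u x * psi z)) x = pot (kn i) (pd i u) x - u x * pot (kn i) (pd i phi) 0.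
  have -> : pd i (fun z => u z - u x * psi z) = (fun z => pd i u z - u x * pd i phi (z - x)).
    apply/funext => z.
    suff /is_pdP[] : is_pd i (fun z => u z - u x * psi z) z (pd i u z - u x * pd i phi (z - x)) by [].
    apply: is_pdB; first exact: C1c_is_pd cu.
    by apply: is_pdZ; apply: is_pd_translate; exact: C1c_is_pd cphi.
  have i1 := pot_pd_itg i i x L0 cu.
  have i2 := pot_pd_itg i i 0 ler01 cphi.
  have i3 : itg (fun xi => kn i (x - xi) * pd i phi (xi - x)).
    have := itg_shift (- x) i2; apply: eq_itg => xi; by rewrite sub0r opprB.
  rewrite -(@pot_translate (kn i) (pd i phi) x); last by apply: eq_itg i2 => xi; rewrite sub0r.
  rewrite /pot -(intgZ _ i3) -(intgB i1 (itgZ (u x) i3)).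
  by apply: eq_intg => xi; ring.
have ET : pot_trace (fun z => u z - u x * psi z) x = pot_trace u x - u x * newton_const.
  by rewrite /newton_const /pot_trace mulr_sumr -sumrB; apply: eq_bigr => i _; exact: E.
by rewrite -[LHS](subrK (u x * newton_const)) -ET (pot_trace_eq0 L'0 cw w0) add0r mulrC.
Qed.

(** Every approximant with e <= 1/2 is at least 24/243. On the sup-norm box of radius e, of volume 8
    e^3, phi is 1 and |xi|^2 + e^2 <= 5 e^2 <= (3 e)^2, so the integrand is at least 3 e^2 (3 e)^-5
    there. *)
Lemma newton_const_gt0 : 0 < newton_const.
Proof.
have cv := @pot_trace_cvg _ 1 phi 0 ler01 cphi.
apply: (@lt_le_trans _ _ (24 / 243)); first by rewrite divr_gt0 ?ltr0n.
rewrite /newton_const -(cvg_lim _ cv)//.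
apply: limr_ge; first by apply/cvg_ex; eexists; exact: cv.
exists 1%N => // n /= n1.
set e : R := n.+1%:R^-1.
have e0 : 0 < e by rewrite invr_gt0.
have e2 : e <= 2^-1 by rewrite /e lef_pV2 ?posrE// ler_nat.
have ig : itg (fun xi => 3 * (e ^+ 2 * nreg e (0 - xi) ^+ 5) * phi xi).
  apply: (itg_cc ler01); last by move=> z zL; rewrite cphi.2// mulr0.
  apply: mul_continuous; last exact: C1c_cont cphi.
  apply: (refl_continuous (g := fun y => 3 * (e ^+ 2 * nreg e y ^+ 5))).
  apply: (@mul_continuous _ (fun=> 3)); first exact: cst_continuous.
  apply: (@mul_continuous _ (fun=> e ^+ 2)); first exact: cst_continuous.
  exact: nregX_continuous.
have ib := itgZ (3 * (e ^+ 2 * (3 * e) ^- 5)) (itg_box 0 (ltW e0)).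
have -> : 24 / 243 = intg (fun xi => 3 * (e ^+ 2 * (3 * e) ^- 5) * \1_(box 0 e) xi).
  rewrite intgZ; last by apply: itg_box; exact: ltW.
  by rewrite intg_box ?(ltW e0)//; field; rewrite gt_eqF.
apply: (intg_le ib ig) => xi; rewrite indicE.
have N0 := nreg_gt0 (0 - xi) e0.
have [xb|_] := boolP (xi \in box 0 e); last first.
  by rewrite mulr0 !mulr_ge0 ?exprn_ge0 ?(ltW e0) ?(ltW N0).
have {}xb : `|xi| <= e by move: xb; rewrite inE /box /= subr0.
rewrite mulr1 phi1 ?mulr1; last exact: le_trans xb e2.
rewrite ler_wpM2l// ler_wpM2l ?exprn_ge0 ?(ltW e0)//.
rewrite -exprVn ler_pXn2r ?nnegrE ?invr_ge0 ?mulr_ge0 ?(ltW e0) ?(ltW N0)//.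
rewrite /nreg sub0r enormN lef_pV2 ?posrE ?sqrtr_gt0 ?nreg_arg_gt0 ?mulr_gt0//.
rewrite -(ler_pXn2r (n := 2)) ?nnegrE ?sqrtr_ge0 ?mulr_ge0 ?(ltW e0)//.
rewrite sqr_sqrtr ?(ltW (nreg_arg_gt0 _ e0))//.
have : enorm xi ^+ 2 <= (2 * e) ^+ 2.
  rewrite ler_pXn2r ?nnegrE ?enorm_ge0 ?mulr_ge0 ?(ltW e0)//.
  by apply: (le_trans (enorm_le_norm xi)); rewrite ler_wpM2l.
rewrite !exprMn; have := sqr_ge0 e; lra.
Qed.

End Constant.

(** * Potentials of a gradient supported in a domain *)

Section Core.
Variable R : realType.
Local Notation pt := 'rV[R]_3.
Implicit Types (f g h u v : pt -> R) (x y z xi : pt) (i j l : 'I_3) (e : R) (U V : set pt).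

Lemma pd_local j g h U x : open U -> (forall y, U y -> g y = h y) -> U x -> pd j g x = pd j h x.
Proof.
move=> /open_normP oU gh Ux; have [r r0 rU] := oU x Ux.
by apply: near_eq_derive; apply/nbhs_normP; exists r => // y /rU /gh.
Qed.

Lemma C1M U g h : open U -> Cn 1 U g -> Cn 1 U h -> Cn 1 U (fun x => g x * h x).
Proof.
move=> oU cg ch; split=> [x Ux|k]; first by apply: continuousM; [exact: cg.1|exact: ch.1].
have H x : U x -> is_pd k (fun x => g x * h x) x (pd k g x * h x + g x * pd k h x).
  by move=> Ux; apply: is_pdM; [exact: Cn_is_pd cg Ux|exact: Cn_is_pd ch Ux].
split=> [x /H /is_pdP[]//|].
apply: (@Cn_eq _ _ _ (fun x => pd k g x * h x + g x * pd k h x)) => //.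
  by move=> x /H /is_pdP[].
split=> // x Ux; apply: (@continuousD _ _ _ (fun x => pd k g x * h x)).
  by apply: continuousM; [exact: (cg.2 k).2.1|exact: ch.1].
by apply: continuousM; [exact: cg.1|exact: (ch.2 k).2.1].
Qed.

Lemma open_ball_norm (c : pt) (r : R) : open [set x | `|x - c| < r].
Proof.
apply/open_normP => x /= xr; exists (r - `|x - c|); first by rewrite subr_gt0.
move=> y yx; rewrite -(subrKA x) (le_lt_trans (ler_normD _ _))//; lra.
Qed.

Lemma lt_norm_add3 (a b d e : R) : `|a| < e / 3 -> `|b| < e / 3 -> `|d| < e / 3 -> `|a + b + d| < e.
Proof.
move=> ha hb hd; apply: le_lt_trans (ler_normD _ _) _.
have := ler_normD a b; lra.
Qed.

Lemma lt_norm_sub2 (a b e : R) : `|a| < e / 2 -> `|b| < e / 2 -> `|a - b| < e.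
Proof. by move=> ha hb; apply: le_lt_trans (ler_normB _ _) _; lra. Qed.

Lemma quarter_lt (r t : R) : 0 < r -> t < r / 4 -> t < r. Proof. lra. Qed.

Lemma double_quarter_le (r t : R) : t <= r / 4 -> 2 * t <= 2^-1 * r. Proof. lra. Qed.

Variables (phi : pt -> R) (Omega : set pt) (w : pt -> R) (L p : R).
Hypotheses (cphi : C1c 1 phi) (phi0 : forall x, 0 <= phi x)
  (phi1 : forall x, `|x| <= 2^-1 -> phi x = 1)
  (oO : open Omega) (OL : Omega `<=` box 0 L) (L0 : 0 <= L) (p3 : 3 < p)
  (cw : Cn 1 Omega w).

Definition grad_density j : pt -> R := pd j w \_ Omega.
Hypothesis (dr : forall j, dens p L (grad_density j)).
Local Notation rho := grad_density.
Local Notation c := (newton_const phi).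

Lemma rho_out j x : ~ Omega x -> rho j x = 0.
Proof. by move=> xO; rewrite /grad_density patchE memNset. Qed.

Lemma rho_in j x : Omega x -> rho j x = pd j w x.
Proof. by move=> xO; rewrite /grad_density patchE mem_set. Qed.

Lemma itg_rho j : itg (rho j).
Proof. by apply: (dens_itg L0 _ (dr j)); apply/ltW/(lt_trans _ p3); rewrite ltr1n. Qed.

Lemma rhoL j x : ~ box 0 L x -> rho j x = 0.
Proof. by move=> xL; apply: rho_out => /OL. Qed.

Lemma trp_continuous : continuous (trp rho).
Proof.
move=> x; apply: continuous_sum => i.
by apply: (pot_continuous L0 p3 (dr i)).
Qed.

Lemma rotp_continuous i j : continuous (rotp rho i j).
Proof.
move=> x; apply: (@continuousB _ _ _ (pot (kn i) (rho j)) (pot (kn j) (rho i))).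
  exact: (pot_continuous L0 p3 (dr j)).
exact: (pot_continuous L0 p3 (dr i)).
Qed.

Lemma pot_rho_infty i j e : 0 < e -> exists M : R, forall x, M < enorm x -> `|pot (kn i) (rho j) x| < e.
Proof. by apply: (pot_infty i L0 (itg_rho j)) => x; exact: rhoL. Qed.

Lemma trp_infty e : 0 < e -> exists M : R, forall x, M < enorm x -> `|trp rho x| < e.
Proof.
move=> e0; have e3 : 0 < e / 3 by rewrite divr_gt0.
have [M0 H0] := pot_rho_infty 0 0 e3; have [M1 H1] := pot_rho_infty 1 1 e3.
have [M2 H2] := pot_rho_infty 2 2 e3.
exists (Num.max M0 (Num.max M1 M2)) => x; rewrite !gt_max => /and3P[/H0 h0 /H1 h1 /H2 h2].
by rewrite /trp sum3; exact: lt_norm_add3.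
Qed.

Lemma rotp_infty i j e : 0 < e -> exists M : R, forall x, M < enorm x -> `|rotp rho i j x| < e.
Proof.
move=> e0; have e3 : 0 < e / 2 by rewrite divr_gt0.
have [M0 H0] := pot_rho_infty i j e3; have [M1 H1] := pot_rho_infty j i e3.
exists (Num.max M0 M1) => x; rewrite !gt_max => /andP[/H0 h0 /H1 h1].
exact: lt_norm_sub2.
Qed.

(* Near a point of [Omega], [w] agrees with a compactly supported function [u]; the
   potentials of [w] then differ from those of [u] by potentials of the density
   [sigma], which vanishes near that point. *)
Lemma local_representation x0 : Omega x0 ->
  exists (sigma : 'I_3 -> pt -> R) (L' : R) (V : set pt),
  [/\ [/\ open V, V x0 & V `<=` Omega],
     [/\ (forall j, itg (sigma j)), (forall j x, ~ box 0 L' x -> sigma j x = 0) &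
         (forall j x, V x -> sigma j x = 0)],
     (forall x, V x -> c * w x - trp rho x = trp sigma x) &
     forall i j x, V x -> rotp rho i j x = rotp sigma j i x].
Proof.
move=> Ox0; have [r r0 rO] := (open_normP _).1 oO x0 Ox0.
(* As [phi] is 1 for |y| <= 1/2 and 0 for |y| > 1, this scale makes [chi] equal to 1 within r/4 of
   x0 and to 0 beyond r/2. *)
pose k := 2 / r; have k0 : 0 < k by rewrite divr_gt0.
pose chi x := phi (k *: (x - x0)).
have cchi := C1c_affine x0 k0 cphi; rewrite -/chi in cchi.
have chi0 x : r / 2 < `|x - x0| -> chi x = 0.
  move=> xr; apply: cphi.2; rewrite /box /= subr0 normrZ gtr0_norm//; apply/negP; rewrite -ltNge.
  by rewrite /k mulrAC ltr_pdivlMr// mul1r mulrC -ltr_pdivrMr.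
have chi1 x : `|x - x0| <= r / 4 -> chi x = 1.
  move=> xr; apply: phi1; rewrite normrZ gtr0_norm// /k mulrAC ler_pdivrMr//; exact: double_quarter_le.
pose u x := w x * chi x.
set L1 := `|x0| + 1 / k in cchi.
have L10 : 0 <= L1 by rewrite addr_ge0// divr_ge0// ltW.
have cu : C1c L1 u.
  split; last by move=> x xL; rewrite /u cchi.2// mulr0.
  (* Nothing is known about [w] off Omega, but near a point there [chi], and with it [u], is
     identically 0. *)
  apply: Cn_local => x _; have [Ox|Ox] := pselect (Omega x).
    exists Omega; first exact: Ox.
    by apply: (C1M oO cw); apply: Cn_sub cchi.1; exact: subsetT.
  exists [set x | r / 2 < `|x - x0|].
    rewrite /= ltNge; apply/negP => xr; apply: Ox; apply: rO; apply: le_lt_trans xr _.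
    by rewrite ltr_pdivrMr// mulr_natr mulr2n ltrDl.
  apply: (@Cn_eq _ _ _ (fun=> 0)); last exact: Cn_cst.
    have := @closed_norm_le _ x0 (r / 2); rewrite -openC; congr open.
    by apply/seteqP; split=> z /=; rewrite ltNge => /negP.
  by move=> z /= /chi0 zr; rewrite /u zr mulr0.
pose V := [set x | `|x - x0| < r / 4].
have r40 : 0 < r / 4 by rewrite divr_gt0.
have VO : V `<=` Omega by move=> x /= xr; apply: rO; exact: quarter_lt.
have oV : open V by exact: open_ball_norm.
have uw x : V x -> u x = w x by move=> /ltW /chi1 xr; rewrite /u xr mulr1.
pose sigma j x := pd j u x - rho j x.
pose L' := Num.max L L1.
have iu j : itg (pd j u).
  by apply: (itg_cc L10 (C1c_pd_cont cu)) => x; exact: C1c_pd0.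
have isig j : itg (sigma j) by apply: itgB; [exact: iu|exact: itg_rho].
have ip i j x : itg (fun xi => kn i (x - xi) * rho j xi) by exact: (pot_itg i x L0 p3 (dr j)).
have ipu i j x := pot_pd_itg i j x L10 cu.
have potE i j x : pot (kn i) (sigma j) x = pot (kn i) (pd j u) x - pot (kn i) (rho j) x.
  by rewrite /pot -(intgB (ipu i j x) (ip i j x)); apply: eq_intg => xi; rewrite mulrBr.
exists sigma, L', V; split => //.
- by split=> //; rewrite /V /= subrr normr0.
- split=> // j x; last first.
    move=> Vx; rewrite /sigma (pd_local j oV uw Vx) rho_in ?subrr//; exact: VO.
  move=> xL; have [xl xl1] : ~ box 0 L x /\ ~ box 0 L1 x.
    by split=> h; apply: xL; move: h; rewrite /box /= /L' le_max => ->; rewrite ?orbT.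
  by rewrite /sigma (C1c_pd0 j cu xl1) rhoL ?subrr.
- move=> x Vx; rewrite -uw// -(pot_trace_represent cphi phi1 x L10 cu).
  rewrite /pot_trace /trp -sumrB.
  by apply: eq_bigr => i _; rewrite potE.
- move=> i j x _; rewrite /rotp !potE (pot_pd_sym j i x L10 cu).
  by rewrite opprB [RHS]addrC subrKA.
Qed.

(** Every order of smoothness is reached although [w] is only C^1: near each point the difference is
    a potential whose density vanishes there. *)
Lemma tau_Cn n : Cn n Omega (fun x => c * w x - trp rho x).
Proof.
apply: Cn_local => x /local_representation[s [L' [V [[oV Vx VO] [iS sL sV] tE _]]]].
exists V => //; apply: (Cn_eq oV (g := trp s)) => [y Vy|]; first by rewrite tE.
exact: trp_Cn iS sL oV sV n.
Qed.

Lemma rotp_Omega_Cn i j n : Cn n Omega (rotp rho i j).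
Proof.
apply: Cn_local => x /local_representation[s [L' [V [[oV Vx VO] [iS sL sV] _ rE]]]].
exists V => //; apply: (Cn_eq oV (g := rotp s j i)) => [y Vy|]; first by rewrite rE.
exact: rotp_Cn iS sL oV sV j i n.
Qed.

Lemma rotp_Omega_div x : Omega x ->
  pd 0 (rotp rho 1 2) x + pd 1 (rotp rho 2 0) x + pd 2 (rotp rho 0 1) x = 0.
Proof.
move=> /local_representation[s [L' [V [[oV Vx VO] [iS sL sV] _ rE]]]].
rewrite !(pd_local _ oV (rE _ _) Vx).
have N i j l : pd l (rotp s j i) x = - pd l (rotp s i j) x.
  have h := is_pdN (pdP (((rotp_Cn iS sL oV sV i j 1).2 l).1 x Vx)).
  have -> : rotp s j i = (fun x => - rotp s i j x) by apply/funext => y; rewrite /rotp opprB.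
  by have /is_pdP[] := h.
rewrite (N 1 2) (N 2 0) (N 0 1) -!opprD (rotp_div iS sL oV sV Vx) oppr0//.
Qed.

(** The indices of [rotp] are exchanged with respect to [trp_grad], because near the point the
    vector potential of [sigma] is the negative of that of the density. *)
Lemma tau_grad l x : Omega x ->
  pd l (fun x => c * w x - trp rho x) x = \sum_i pd i (rotp rho i l) x.
Proof.
move=> /local_representation[s [L' [V [[oV Vx VO] [iS sL sV] tE rE]]]].
rewrite (pd_local _ oV tE Vx) (trp_grad iS sL oV sV l Vx).
by apply: eq_bigr => i _; rewrite (pd_local _ oV (rE _ _) Vx).
Qed.

Lemma rotp_Omega_harmonic i j x : Omega x -> \sum_l pd l (pd l (rotp rho i j)) x = 0.
Proof.
move=> /local_representation[s [L' [V [[oV Vx VO] [iS sL sV] tE rE]]]].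
transitivity (\sum_l pd l (pd l (rotp s j i)) x); last exact: (rotp_harmonic iS sL oV sV j i Vx).
apply: eq_bigr => l _.
by apply: (pd_local _ oV _ Vx) => y Vy; rewrite (pd_local _ oV (rE i j) Vy).
Qed.

End Core.

(** * The maximum principle *)

Section MaximumPrinciple.
Variable R : realType.
Local Notation pt := 'rV[R]_3.
Implicit Types (f g h u v : pt -> R) (x y z xi : pt) (i j l : 'I_3) (U V K : set pt).

(** If D were positive, the first derivative, which is 0 at the maximum, would be positive just
    beyond it in direction l, and the mean value theorem would produce a larger value. *)
Lemma second_derivative_at_max l g d (D : R) U x : open U -> U x ->
  (forall y, U y -> is_pd l g y (d y)) -> is_pd l d x D ->
  (forall y, U y -> g y <= g x) -> D <= 0.
Proof.
move=> oU Ux gd dD gx.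
have [r r0 rU] := (open_normP _).1 oU x Ux.
pose F (t : R) := g (x + t *: ej R l); pose G (t : R) := d (x + t *: ej R l).
have inU t : `|t| < r -> U (x + t *: ej R l).
  move=> tr; apply: rU; rewrite addrAC subrr add0r normrZ.
  by apply: le_lt_trans tr; rewrite ler_piMr// norm_ej.
have FG (t : R) : `|t| < r -> is_derive t 1 F (G t).
  by move=> tr; apply/is_derive_line; exact: gd (inU t tr).
have Fmax t : `|t| < r -> F t <= F 0.
  by move=> tr; rewrite {2}/F scale0r addr0; exact: gx (inU t tr).
have G0 : G 0 = 0.
  have [_ F0] : is_derive (0 : R) 1 F 0.
    apply: (@derive1_at_max _ F (- r) r 0).
    - by rewrite ge0_cp// ltW.
    - by move=> t; rewrite in_itv /= -ltr_norml => /FG[].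
    - by rewrite in_itv /= oppr_lt0 r0.
    - by move=> t; rewrite in_itv /= -ltr_norml => /Fmax.
  have [|_ <-//] := FG 0.
  by rewrite normr0.
rewrite leNgt; apply/negP => D0.
have dG : is_derive (0 : R) 1 G D by apply/is_derive_line; rewrite scale0r addr0.
have [dG1 dG2] := dG.
have cv : (fun h : R => h^-1 *: ((G \o shift 0) (h *: 1) - G 0)) @ 0^' --> D.
  by rewrite -dG2; exact: dG1.
have D2 : 0 < D / 2 by rewrite divr_gt0.
move/cvgrPdist_lt : cv => /(_ _ D2)[s /= s0 H].
pose t := Num.min r s / 2.
have m0 : 0 < Num.min r s by rewrite lt_min r0.
have t0 : 0 < t by rewrite divr_gt0.
have tm : t < Num.min r s by rewrite /t ltr_pdivrMr// mulr_natr mulr2n ltrDl.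
have [tr ts] : t < r /\ t < s by move: tm; rewrite lt_min => /andP.
have Gpos b : 0 < b -> b < s -> 0 < G b.
  move=> b0 bs; have := H b; rewrite /ball_ /= sub0r normrN gtr0_norm// => /(_ bs).
  rewrite gt_eqF// => /(_ isT); rewrite G0 subr0 addr0 [b *: 1]mulr1 ltr_norml => /andP[_ h].
  have {}h : D - b^-1 * G b < D / 2 := h.
  have : 0 < b^-1 * G b by lra.
  by rewrite pmulr_rgt0// invr_gt0.
have [||b btr E] := @MVT _ F G 0 t t0.
- move=> b; rewrite in_itv /= => /andP[b0 bt]; apply: FG; rewrite gtr0_norm//; exact: lt_trans bt tr.
- apply: derivable_within_continuous => b; rewrite in_itv /= => /andP[b0 bt].
  have [|//] := FG b.
  by rewrite ger0_norm//; exact: le_lt_trans bt tr.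
have := Fmax t; rewrite gtr0_norm// => /(_ tr); rewrite leNgt => /negP; apply.
rewrite -subr_gt0 E subr0 mulr_gt0//.
by move: btr; rewrite in_itv /= => /andP[b0 bt]; apply: Gpos => //; exact: lt_trans bt ts.
Qed.

Lemma no_interior_max (a b c d : R) : 0 < d -> a + d * 2 <= 0 -> b + d * 2 <= 0 ->
  c + d * 2 <= 0 -> a + b + c = 0 -> False.
Proof. lra. Qed.

(* Otherwise h + d |x|^2 would have an interior maximum for small d > 0. *)
Lemma max_principle K U h e : compact K -> open U -> U `<=` K -> continuous h ->
  (forall x, K x -> ~ U x -> h x <= e) ->
  Cn 2 U h -> (forall x, U x -> \sum_l pd l (pd l h) x = 0) ->
  forall x, K x -> h x <= e.
Proof.
move=> cK oU UK ch hK c2 harm x0 Kx0; rewrite leNgt; apply/negP => hx0.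
have [M M0 HM] : exists2 M : R, 0 < M & forall x, K x -> enorm x ^+ 2 <= M.
  have [N [_ HN]] := compact_bounded cK.
  have N1 : N < `|N| + 1 by rewrite (le_lt_trans (ler_norm N))// ltrDl.
  exists ((2 * (`|N| + 1)) ^+ 2); first by rewrite exprn_gt0// mulr_gt0// ltr_wpDl.
  move=> x Kx; rewrite ler_pXn2r ?nnegrE ?enorm_ge0 ?mulr_ge0 ?addr_ge0//.
  by apply: (le_trans (enorm_le_norm x)); rewrite ler_wpM2l// (HN _ N1 x).
(* The perturbation is then at most (h x0 - e)/2 on [K], so the maximum of [g], which is at least h
   x0, cannot be attained outside [U], where h <= e. *)
pose d := (h x0 - e) / 2 / M.
have d0 : 0 < d by rewrite !divr_gt0// subr_gt0.
pose g x := h x + d * enorm x ^+ 2.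
have cg : continuous g.
  move=> x; apply: (@continuousD _ _ _ h (fun x => d * enorm x ^+ 2)); first exact: ch.
  apply: (@continuousM _ _ (fun=> d)); first exact: cst_continuous.
  by apply: (@continuous_comp _ _ _ (@enorm R) (fun t : R => t ^+ 2)); [exact: enorm_continuous|exact: exprn_continuous].
have [||c cb H] := @EVT_max_rV R 3 g K _ cK.
- by exists x0.
- by apply: continuous_subspaceT.
rewrite inE in cb.
have gx0 : h x0 <= g c.
  apply: (@le_trans _ _ (g x0)); first by rewrite lerDl mulr_ge0 ?(ltW d0) ?sqr_ge0.
  by apply: H; rewrite inE.
have dM : d * enorm c ^+ 2 <= (h x0 - e) / 2.
  apply: (@le_trans _ _ (d * M)); first by rewrite ler_wpM2l ?(ltW d0)// HM.
  by rewrite /d mulfVK// gt_eqF.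
have [Uc|nUc] := pselect (U c); last first.
  have := hK c cb nUc; rewrite /g in gx0; lra.
have Q l x : is_pd l (fun x : pt => enorm x ^+ 2) x (2 * x 0 l).
  have q k : is_pd l (fun y : pt => y 0 k ^+ 2) x (2 * x 0 k * (k == l)%:R).
    by apply: is_pd_eq (is_pdM (is_pd_coord l k x) (is_pd_coord l k x)); ring.
  have -> : (fun y : pt => enorm y ^+ 2) = (fun y => y 0 0 ^+ 2 + y 0 1 ^+ 2 + y 0 2 ^+ 2).
    by apply/funext => z; rewrite enorm_sqr.
  apply: is_pd_eq (is_pdD (is_pdD (q 0) (q 1)) (q 2)).
  by case: (ord3P l) => -> /=; ring.
have N l : pd l (pd l h) c + d * 2 <= 0.
  apply: (@second_derivative_at_max l g (fun x => pd l h x + d * (2 * x 0 l)) _ U c oU Uc).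
  - by move=> x Ux; apply: is_pdD; [exact: Cn_is_pd c2 Ux|exact: is_pdZ].
  - apply: is_pdD; first by apply: pdP; exact: ((c2.2 l).2.2 l).1.
    apply: is_pdZ; apply: is_pd_eq (is_pdZ 2 (is_pd_coord l l c)).
    by rewrite eqxx mulr1.
  - by move=> y Uy; apply: H; rewrite inE; exact: UK.
have := harm c Uc; rewrite sum3; exact: no_interior_max d0 (N 0) (N 1) (N 2).
Qed.

End MaximumPrinciple.

(** * Whitney cubes and the Whitney extension *)

Section WhitneyCubes.
Variable R : realType.
Local Notation pt := 'rV[R]_3.
Implicit Types (x y : pt) (z w : 'rV[int]_3) (k : 'I_3) (Q P : dcube) (n : nat).
Variable Omega : set pt.

Lemma sideS n (z w : 'rV[int]_3) : side R (n, z) = 2 * side R (n.+1, w).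
Proof. by rewrite /side /= exprS; field; rewrite expf_neq0. Qed.

Lemma child_sub n (z w : 'rV[int]_3) :
  (forall k, z 0 k = 2 * w 0 k \/ z 0 k = 2 * w 0 k + 1) ->
  @cube R (n.+1, z) `<=` cube (n, w).
Proof.
move=> zw x Qx k; have := Qx k; rewrite /= (sideS n w z).
have s0 := side_gt0 R (n.+1, z); move: (side _ _) s0 => s s0 /andP[h1 h2].
have [E|E] := zw k; rewrite E !(intrD, intrM) in h1 h2; rewrite intrD; apply/andP; split; nra.
Qed.

Lemma parent_exists (z : 'rV[int]_3) :
  exists w : 'rV[int]_3, forall k, z 0 k = 2 * w 0 k \/ z 0 k = 2 * w 0 k + 1.
Proof.
exists (\row_k divz (z 0 k) 2) => k; rewrite mxE.
have := divz_eq (z 0 k) 2; rewrite [_ * 2]mulrC.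
have := ltz_pmod (z 0 k) (isT : (0 : int) < 2); have := modz_ge0 (z 0 k) (isT : (2 : int) != 0).
case: (modz (z 0 k) 2) => [[|[|m]]|m]// _ _ E; [left|right]; by rewrite {1}E ?addr0.
Qed.

Lemma grid_meets n z : cube (n, z) `&` Omega !=set0 -> grid Omega n z.
Proof.
elim: n z => [|n IH] z //= [x [Qx Ox]].
have [w zw] := parent_exists z; exists w => //.
by apply: IH; exists x; split => //; exact: child_sub Qx.
Qed.

Lemma whitney_belowP n Q : whitney_below Omega n Q -> (Q.1 < n)%N /\
  whitney_candidate Omega Q.1 Q.2 /\
  forall P, whitney_below Omega Q.1 P -> ~ (@cube R Q `<=` cube P).
Proof.
elim: n => [//|n IH] /= [/IH[h1 h2]|[E h1 h2]]; first by split=> //; rewrite ltnW.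
by rewrite E.
Qed.

Lemma whitneyP Q : whitney Omega Q -> whitney_candidate Omega Q.1 Q.2 /\
  forall P, whitney_below Omega Q.1 P -> ~ (@cube R Q `<=` cube P).
Proof. by move=> [n _ /whitney_belowP[_]]. Qed.

Lemma candidate_in n z : whitney_candidate Omega n z ->
  exists2 P, whitney_below Omega n.+1 P & @cube R (n, z) `<=` cube P.
Proof.
move=> cz; have [[P [hP sP]]|h] := pselect (exists P, whitney_below Omega n P /\ @cube R (n, z) `<=` cube P).
  by exists P => //; left.
exists (n, z) => //; right; split => // P hP sP; apply: h; by exists P.
Qed.

Lemma whitney_sub Q : whitney Omega Q -> cube Q `<=` Omega.
Proof. by case: Q => n z /whitneyP[[]]. Qed.

Lemma cube_centre Q x : cube Q x <-> `|x - centre R Q| <= side R Q / 2.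
Proof.
have s0 := side_gt0 R Q.
split=> [Qx|/norm_rVleP H k].
  apply/norm_rVleP => [|k]; first by rewrite divr_ge0// ltW.
  have := Qx k; rewrite !mxE intrD => /andP[h1 h2]; rewrite ler_norml; apply/andP; split; nra.
have := H _ k; rewrite !mxE ler_norml => /(_ _)/andP[|h1 h2]; first by rewrite divr_ge0// ltW.
by rewrite intrD; apply/andP; split; nra.
Qed.

(** A dyadic cube at x of side less than r/2, together with all cubes touching it, stays in the ball
    of radius r. It is thus a candidate, hence contained in a selected cube. *)
Lemma whitney_cover x : open Omega -> Omega x -> exists2 Q, whitney Omega Q & cube Q x.
Proof.
move=> oO Ox; have [r r0 rO] := (open_normP _).1 oO x Ox.
have r2 : 0 < r / 2 by rewrite divr_gt0.
have [n nr] := exp2inv_lt r2; have {}nr := nr n (leqnn n).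
pose z := \row_k Num.floor (x 0 k * 2 ^+ n).
have Qx : cube (n, z) x by exact: floor_cube.
have cz : whitney_candidate Omega n z.
  split.
  - by apply: grid_meets; exists x.
  - move=> y Qy; apply: rO; have := cube_dist Qy Qx; rewrite /side /=; lra.
  - move=> w _ [y [wy zy]] u wu; apply: rO.
    have := cube_dist wu wy; have := cube_dist zy Qx; rewrite /side /=.
    by rewrite -(subrKA y u (- x)) => h1 h2; apply: le_lt_trans (ler_normD _ _) _; lra.
have [P hP sP] := candidate_in cz.
by exists P; [exists n.+1|exact: sP].
Qed.

(* Contains the support of the bump at Q: (1 + eps)/2 < 5/8 as eps < 1/4. *)
Definition wide Q : set pt := [set x | `|x - centre R Q| <= 5 / 8 * side R Q].

Lemma cube_wide Q : cube Q `<=` wide Q.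
Proof.
move=> x /cube_centre h; have s0 := side_gt0 R Q; rewrite /wide /=; lra.
Qed.

(** The cube of the same generation that contains y is Q or touches Q, as the integer corners differ
    by at most 1 in each coordinate. *)
Lemma near_whitney_sub Q y : whitney Omega Q -> `|y - centre R Q| < 3 / 2 * side R Q -> Omega y.
Proof.
case: Q => n z hQ yc; have [[_ zO H] _] := whitneyP hQ.
have s0 := side_gt0 R (n, z).
pose w := \row_k Num.floor (y 0 k * 2 ^+ n).
have wy : cube (n, w) y by exact: floor_cube.
have zw k : (w 0 k <= z 0 k + 1)%R /\ (z 0 k <= w 0 k + 1)%R.
  have r0 : 0 < 3 / 2 * side R (n, z) by rewrite mulr_gt0.
  have := (norm_rVltP _ r0) yc k; rewrite !mxE ltr_norml => /andP[h1 h2].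
  have sE : side R (n, z) * 2 ^+ n = 1 by rewrite /side /= mulVf// expf_neq0.
  have p0 : 0 < (2 : R) ^+ n by rewrite exprn_gt0.
  have f1 := floor_le (y 0 k * 2 ^+ n); have f2 := floorD1_gt (y 0 k * 2 ^+ n).
  have e1 : (z 0 k)%:~R - 1 < y 0 k * 2 ^+ n.
    have : (y 0 k - ((z 0 k)%:~R + 2^-1) * side R (n, z) + 3 / 2 * side R (n, z)) * 2 ^+ n > 0.
      by rewrite mulr_gt0//; lra.
    have -> : (y 0 k - ((z 0 k)%:~R + 2^-1) * side R (n, z) + 3 / 2 * side R (n, z)) * 2 ^+ n =
      y 0 k * 2 ^+ n - ((z 0 k)%:~R + 2^-1) * (side R (n, z) * 2 ^+ n) + 3 / 2 * (side R (n, z) * 2 ^+ n) by ring.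
    rewrite sE; lra.
  have e2 : y 0 k * 2 ^+ n < (z 0 k)%:~R + 2.
    have : (((z 0 k)%:~R + 2^-1) * side R (n, z) + 3 / 2 * side R (n, z) - y 0 k) * 2 ^+ n > 0.
      by rewrite mulr_gt0//; lra.
    have -> : (((z 0 k)%:~R + 2^-1) * side R (n, z) + 3 / 2 * side R (n, z) - y 0 k) * 2 ^+ n =
      ((z 0 k)%:~R + 2^-1) * (side R (n, z) * 2 ^+ n) + 3 / 2 * (side R (n, z) * 2 ^+ n) - y 0 k * 2 ^+ n by ring.
    rewrite sE; lra.
  rewrite -!ltzD1 -!(ltr_int R) !intrD; rewrite intrD in f2; split; lra.
clearbody w.
(* The coordinatewise larger of the two least corners lies in both cubes. *)
pose q : pt := \row_k ((Num.max (w 0 k) (z 0 k))%:~R * side R (n, z)).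
have qz : cube (n, z) q.
  move=> k; have [h1 h2] := zw k.
  rewrite /q mxE /=; apply/andP; split; rewrite (ler_wpM2r (ltW s0))// ler_int.
    by rewrite le_max lexx orbT.
  by rewrite ge_max h1 lerDl.
have qw : cube (n, w) q.
  move=> k; have [h1 h2] := zw k.
  change (is_true ((w 0 k)%:~R * side R (n, z) <= q 0 k <= (w 0 k + 1)%:~R * side R (n, z))).
  rewrite /q mxE /=; apply/andP; split; rewrite (ler_wpM2r (ltW s0))// ler_int.
    by rewrite le_max lexx.
  by rewrite ge_max h2 lerDl.
apply: (H w) wy; last by exists q.
by apply: grid_meets; exists q; split => //; exact: zO.
Qed.

(** The constant is 3/2 - 5/8, from [near_whitney_sub] and the size of [wide]. *)
Lemma whitney_far Q x y : whitney Omega Q -> wide Q x -> ~ Omega y -> 7 / 8 * side R Q <= `|x - y|.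
Proof.
move=> hQ xQ yO; rewrite leNgt; apply/negP => h; apply: yO; apply: (near_whitney_sub hQ).
rewrite -(subrKA x y); apply: le_lt_trans (ler_normD _ _) _; rewrite distrC.
by move: xQ; rewrite /wide /=; lra.
Qed.

Lemma wide_sub Q : whitney Omega Q -> wide Q `<=` Omega.
Proof.
move=> hQ x xQ; apply: (near_whitney_sub hQ); have s0 := side_gt0 R Q.
by move: xQ; rewrite /wide /=; lra.
Qed.

(** The parent of the cube is not a candidate, otherwise the cube would lie in one selected earlier.
    So the parent or a cube touching it leaves Omega, within two parent sides of the centre. Level 0
    has no parent. *)
Lemma whitney_not_far n z : whitney Omega (n.+1, z) ->
  exists2 y, ~ Omega y & `|y - centre R (n.+1, z)| <= 4 * side R (n.+1, z).
Proof.
move=> hQ; have [[gz zO H] nb] := whitneyP hQ.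
set c := centre R (n.+1, z).
have cQ : cube (n.+1, z) c.
  by apply/cube_centre; rewrite subrr normr0 divr_ge0 ?(ltW (side_gt0 _ _)).
move: gz => /= [w gw zw].
have sub := @child_sub n z w zw.
have ncw : ~ whitney_candidate Omega n w.
  move=> /candidate_in[P hP sP]; by apply: (nb P hP) => u /sub /sP.
have sE : side R (n, w) = 2 * side R (n.+1, z) by exact: sideS.
have s0 := side_gt0 R (n.+1, z).
have [wO|] := pselect (cube (n, w) `<=` Omega); last first.
  move=> /existsNP[y /not_implyP[wy yO]]; exists y => //.
  have := cube_dist wy (sub _ cQ); rewrite sE; lra.
have : ~ forall w', grid Omega n w' -> @cube R (n, w') `&` cube (n, w) !=set0 -> cube (n, w') `<=` Omega.
  by move=> h; apply: ncw; split.
move=> /existsNP[w' /not_implyP[gw' /not_implyP[[u [u1 u2]] /existsNP[y /not_implyP[wy yO]]]]].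
exists y => //.
have h1 := cube_dist wy u1; have h2 := cube_dist u2 (sub _ cQ).
have sE' : side R (n, w') = 2 * side R (n.+1, z) by exact: sideS.
rewrite -(subrKA u y); apply: le_trans (ler_normD _ _) _; rewrite sE' in h1; rewrite sE in h2; lra.
Qed.

End WhitneyCubes.

Section Boundary.
Variable R : realType.
Local Notation pt := 'rV[R]_3.
Implicit Types (x y : pt) (Q P : dcube).
Variables (Omega : set pt).
Hypothesis oO : open Omega.

Lemma frontier_open : frontier Omega = closure Omega `\` Omega.
Proof. by rewrite /frontier ((interior_id _).1 oO). Qed.

Lemma frontier_disjoint x : frontier Omega x -> ~ Omega x.
Proof. by rewrite frontier_open => -[]. Qed.

(** Take the infimum of the parameters at which the segment is outside Omega: that point is not in
    Omega, which is open, and points just before it are. *)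
Lemma frontier_segment x y : Omega x -> ~ Omega y ->
  exists2 t, frontier Omega t & `|x - t| <= `|x - y|.
Proof.
move=> Ox Oy; pose z s := x + s *: (y - x).
have zz s s' : `|z s - z s'| = `|s - s'| * `|y - x|.
  by rewrite /z opprD addrACA subrr add0r -scalerBl normrZ.
pose S := [set s : R | 0 <= s <= 1 /\ ~ Omega (z s)].
have S1 : S 1 by split; [rewrite ler01 lexx|rewrite /z scale1r addrC subrK].
have hS : has_inf S.
  by split; [exists 1|exists 0 => s [/andP[]]].
have i0 : 0 <= inf S by apply: lb_le_inf; [exists 1|move=> s [/andP[]]].
have i1 : inf S <= 1 by apply: ge_inf => //; exact: hS.2.
have d0 : 0 < `|y - x| + 1 by rewrite ltr_wpDl.
exists (z (inf S)); last first.
  have -> : x = z 0 by rewrite /z scale0r addr0.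
  rewrite zz sub0r normrN ger0_norm// /z scale0r addr0 distrC.
  by rewrite ler_piMl.
have nO : ~ Omega (z (inf S)).
  move=> /((open_normP _).1 oO)[r r0 rO].
  have rd : 0 < r / (`|y - x| + 1) by rewrite divr_gt0.
  have [s Ss si] := inf_adherent rd hS.
  apply: Ss.2; apply: rO; rewrite zz.
  have is_ : inf S <= s by apply: ge_inf => //; exact: hS.2.
  rewrite ger0_norm ?subr_ge0//.
  apply: (@le_lt_trans _ _ ((s - inf S) * (`|y - x| + 1))).
    by rewrite ler_wpM2l ?subr_ge0// lerDl.
  by rewrite -ltr_pdivlMr// ltrBlDl.
rewrite frontier_open; split=> // B /nbhs_normP[r r0 rB].
have rd : 0 < r / (`|y - x| + 1) by rewrite divr_gt0.
have ip : 0 < inf S.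
  rewrite lt_neqAle i0 andbT; apply/eqP => E; apply: nO.
  by rewrite -E /z scale0r addr0.
pose s := Num.max 0 (inf S - r / (`|y - x| + 1) / 2).
have s0 : 0 <= s by rewrite le_max lexx.
have si : s < inf S by rewrite gt_max ip ltrBlDr ltrDl divr_gt0.
have sr : inf S - s < r / (`|y - x| + 1).
  have : inf S - r / (`|y - x| + 1) / 2 <= s by rewrite le_max lexx orbT.
  by move: rd; move: (_ / _) => q; lra.
exists (z s); split.
  have [//|no] := pselect (Omega (z s)).
  have : inf S <= s.
    by apply: ge_inf; [exact: hS.2|split => //; rewrite s0 (le_trans (ltW si))].
  by rewrite leNgt si.
apply: rB; rewrite zz distrC gtr0_norm ?subr_gt0//.
apply: (@le_lt_trans _ _ ((inf S - s) * (`|y - x| + 1))).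
  by rewrite ler_wpM2l ?subr_ge0 ?(ltW si)// lerDl.
by rewrite -ltr_pdivlMr.
Qed.

End Boundary.

Section WhitneyNear.
Variable R : realType.
Local Notation pt := 'rV[R]_3.
Implicit Types (x y t : pt) (Q P : dcube).
Variables (Omega : set pt) (p : dcube -> pt) (L : R).
Hypotheses (oO : open Omega) (OL : Omega `<=` box 0 L) (GL : frontier Omega `<=` box 0 L)
  (L0 : 0 <= L) (np : nearest_points Omega (frontier Omega) p).
Local Notation Gamma := (frontier Omega).
Local Notation wh := (whitney Omega).

Lemma setdist_has_inf (E U : set pt) : E !=set0 -> U !=set0 ->
  has_inf [set enorm (x - y) | x in E & y in U].
Proof.
move=> [x Ex] [y Uy]; split; first by exists (enorm (x - y)); exists x => //; exists y.
by exists 0 => _ [u _ [v _ <-]]; exact: enorm_ge0.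
Qed.

Lemma cube_centre_in Q : cube Q (centre R Q).
Proof. by apply/cube_centre; rewrite subrr normr0 divr_ge0 ?(ltW (side_gt0 _ _)). Qed.

(** [setdist] is an infimum, so a point u of the cube is taken that realises it up to one side. The
    factor 2 comes from passing between the Euclidean and the sup norm. *)
Lemma nearest_le Q x t : wh Q -> wide Q x -> Gamma t ->
  `|x - p Q| <= 3 * side R Q + 2 * `|centre R Q - t|.
Proof.
move=> hQ xQ Gt; have [Gp E] := np hQ; have s0 := side_gt0 R Q.
have hi : has_inf [set enorm (x - y) | x in cube Q & y in [set p Q]].
  by apply: setdist_has_inf; [exists (centre R Q); exact: cube_centre_in|exists (p Q)].
have [_ [u Qu [_ -> <-]] ud] := inf_adherent s0 hi.
have h1 : setdist (cube Q) Gamma <= enorm (centre R Q - t).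
  apply: ge_inf; last by exists (centre R Q); [exact: cube_centre_in|exists t].
  by apply: (setdist_has_inf _ _).2; [exists u|exists t].
have h2 : enorm (u - p Q) < setdist (cube Q) Gamma + side R Q by rewrite E.
have h3 := norm_le_enorm (u - p Q).
have h4 := enorm_le_norm (centre R Q - t).
move/cube_centre : Qu => Qu.
have h5 : `|x - p Q| <= `|x - centre R Q| + `|u - centre R Q| + `|u - p Q|.
  rewrite -(subrKA (centre R Q) x) -(subrKA u (centre R Q)) addrA.
  apply: le_trans (ler_normD _ _) _; rewrite lerD2r.
  by apply: le_trans (ler_normD _ _) _; rewrite (distrC u).
move: xQ; rewrite /wide /=; lra.
Qed.

Lemma whitney_near : exists2 C : R, 1 <= C & forall Q x, wh Q -> wide Q x ->
  `|x - p Q| <= C * side R Q.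
Proof.
(* This is 3 + 2 (4 + 2L), from [nearest_le]. A cube with a parent has a boundary point within 4
   sides of its centre; for a unit cube only the distance 2L between points of the box is
   available. *)
exists (11 + 4 * L) => [|[n z] x hQ xQ]; first by move: L0 => ?; lra.
have s0 := side_gt0 R (n, z).
have [t Gt tc] : exists2 t, Gamma t & `|centre R (n, z) - t| <= (4 + 2 * L) * side R (n, z).
  case: n hQ {xQ} s0 => [|n] hQ s0.
    exists (p (0%N, z)); first exact: (np hQ).1.
    have -> : side R (0%N, z) = 1 by rewrite /side /= expr0 invr1.
    have := OL (whitney_sub hQ (cube_centre_in _)); have := GL (np hQ).1.
    rewrite /box /= !subr0 => h1 h2; have := ler_normB (centre R (0%N, z)) (p (0%N, z)); lra.
  have [y yO yc] := whitney_not_far hQ.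
  have [t Gt tx] := frontier_segment oO (whitney_sub hQ (cube_centre_in _)) yO.
  exists t => //; rewrite distrC in yc; apply: le_trans tx (le_trans yc _); rewrite ler_wpM2r ?(ltW s0)//; move: L0 => ?; lra.
have := nearest_le hQ xQ Gt; nra.
Qed.

(* Enumerates the cubes of levels n0 - m to n0 + m that lie at most B cells away
   from x. *)
Definition offset_cube (n0 m B : nat) x (u : 'I_m.*2.+1 * {ffun 'I_3 -> 'I_B.*2.+1}) : dcube :=
  let n := (n0 + u.1 - m)%N in
  (n, \row_k (Num.floor (x 0 k * 2 ^+ n) + (u.2 k)%:Z - B%:Z)).

Lemma offset_cubeP n0 (m B : nat) x Q : (n0 <= Q.1 + m)%N -> (Q.1 <= n0 + m)%N ->
  `|x - centre R Q| <= (B%:R - 2) * side R Q -> exists u, Q = offset_cube n0 (m:=m) (B:=B) x u.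
Proof.
case: Q => n z /= h1 h2 xc.
have hu : (n + m - n0 < m.*2.+1)%N by rewrite ltnS leq_subLR -addnn addnA leq_add2r.
have B0 : 0 <= (B%:R - 2) * side R (n, z) by apply: le_trans xc.
have zB k : (0 <= z 0 k - Num.floor (x 0 k * 2 ^+ n) + B%:Z < B.*2.+1%:Z)%R.
  have := (norm_rVleP _ B0) xc k; rewrite !mxE ler_norml => /andP[e1 e2].
  have sE : side R (n, z) * 2 ^+ n = 1 by rewrite /side /= mulVf// expf_neq0.
  have p0 : 0 < (2 : R) ^+ n by rewrite exprn_gt0.
  have f1 := floor_le (x 0 k * 2 ^+ n); have f2 := floorD1_gt (x 0 k * 2 ^+ n).
  have g1 : 0 <= (x 0 k - ((z 0 k)%:~R + 2^-1) * side R (n, z) + (B%:R - 2) * side R (n, z)) * 2 ^+ n.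
    by rewrite mulr_ge0// ?(ltW p0)//; move: e1; lra.
  have g2 : 0 <= ((B%:R - 2) * side R (n, z) - (x 0 k - ((z 0 k)%:~R + 2^-1) * side R (n, z))) * 2 ^+ n.
    by rewrite mulr_ge0// ?(ltW p0)//; move: e2; lra.
  have E1 : (x 0 k - ((z 0 k)%:~R + 2^-1) * side R (n, z) + (B%:R - 2) * side R (n, z)) * 2 ^+ n =
    x 0 k * 2 ^+ n + (B%:R - 2 - ((z 0 k)%:~R + 2^-1)) * (side R (n, z) * 2 ^+ n) by ring.
  have E2 : ((B%:R - 2) * side R (n, z) - (x 0 k - ((z 0 k)%:~R + 2^-1) * side R (n, z))) * 2 ^+ n =
    (B%:R - 2 + ((z 0 k)%:~R + 2^-1)) * (side R (n, z) * 2 ^+ n) - x 0 k * 2 ^+ n by ring.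
  rewrite E1 sE mulr1 in g1; rewrite E2 sE mulr1 in g2.
  rewrite intrD in f2.
  apply/andP; split.
    rewrite -(ler_int R) !intrD mulrNz /= -pmulrn; move: f1 f2 g1 g2; lra.
  have -> : B.*2.+1%:Z = B%:Z + B%:Z + 1 by rewrite -addnn -addn1 !PoszD.
  rewrite -(ltr_int R) !intrD mulrNz /= -!pmulrn; move: f1 f2 g1 g2; lra.
pose b (k : 'I_3) := absz (z 0 k - Num.floor (x 0 k * 2 ^+ n) + B%:Z).
have bE k : (b k)%:Z = z 0 k - Num.floor (x 0 k * 2 ^+ n) + B%:Z.
  by rewrite /b gez0_abs//; have /andP[] := zB k.
have hb k : (b k < B.*2.+1)%N by rewrite -ltz_nat bE; have /andP[] := zB k.
exists (Ordinal hu, [ffun k => Ordinal (hb k)]).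
have E : (n0 + (n + m - n0) - m)%N = n by rewrite subnKC// addnK.
rewrite /offset_cube /= E; congr (_, _); apply/rowP => k.
by rewrite mxE ffunE /= bE; ring.
Qed.

Lemma whitney_finite : exists (N : nat) (K : R), 1 <= K /\ forall x Q0, wh Q0 -> cube Q0 x ->
  exists s : seq dcube, [/\ uniq s, (size s <= N)%N,
    (forall Q, Q \in s -> [/\ wh Q, side R Q0 <= K * side R Q & `|x - p Q| <= K * side R Q0]) &
    forall Q y, wh Q -> wide Q y -> `|y - x| <= side R Q0 / 8 -> Q \in s].
Proof.
have [C C1 HC] := whitney_near.
pose K := 2 * (C + 1).
have [m Km] : exists m : nat, K <= 2 ^+ m.
  exists (Num.truncn K).+1; apply: ltW; apply: (lt_le_trans (truncnS_gt K)).
  by rewrite -natrX ler_nat ltnW// ltn_expl.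
pose B := (Num.truncn (K + 4)).+1.
have BK : K + 4 <= B%:R by apply: ltW; exact: truncnS_gt.
pose K' := K + K * C + 1.
have K1 : 1 <= K by rewrite /K; lra.
have KC : 1 <= K * C by rewrite mulr_ege1.
exists #|{: 'I_m.*2.+1 * {ffun 'I_3 -> 'I_B.*2.+1}}|, K'; split; first by rewrite /K'; lra.
move=> x Q0 hQ0 Qx; have l0 := side_gt0 R Q0.
have xw := cube_wide Qx.
(* The lower bound of [whitney_far] for one cube, at the nearest point of the other, is set against
   the upper bound of [whitney_near] for that other cube. *)
have key Q y : wh Q -> wide Q y -> `|y - x| <= side R Q0 / 8 ->
  side R Q0 <= K * side R Q /\ side R Q <= K * side R Q0.
  move=> hQ yQ yx; have l1 := side_gt0 R Q.
  have nG t : Gamma t -> ~ Omega t := @frontier_disjoint _ _ oO t.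
  have a1 := whitney_far hQ yQ (nG _ (np hQ0).1).
  have a2 := whitney_far hQ0 xw (nG _ (np hQ).1).
  have b1 := HC _ _ hQ yQ; have b2 := HC _ _ hQ0 xw.
  have c1 := ler_normD (y - x) (x - p Q0); rewrite subrKA in c1.
  have c2 := ler_normD (x - y) (y - p Q); rewrite subrKA (distrC x y) in c2.
  rewrite /K; split; nra.
pose s0 := undup [seq offset_cube Q0.1 x u | u : 'I_m.*2.+1 * {ffun 'I_3 -> 'I_B.*2.+1}].
pose s := [seq Q <- s0 | `[< wh Q /\ exists2 y, wide Q y & `|y - x| <= side R Q0 / 8 >]].
exists s; split.
- by rewrite filter_uniq// undup_uniq.
- rewrite size_filter; apply: leq_trans (count_size _ _) _.
  by apply: leq_trans (size_undup _) _; rewrite size_image.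
- move=> Q; rewrite mem_filter => /andP[/asboolP[hQ [y yQ yx]] _].
  have [k1 k2] := key Q y hQ yQ yx; have l1 := side_gt0 R Q; have b := HC _ _ hQ yQ.
  have c := ler_normD (x - y) (y - p Q); rewrite subrKA (distrC x y) in c.
  by split => //; rewrite /K'; nra.
- move=> Q y hQ yQ yx; have [k1 k2] := key Q y hQ yQ yx; have l1 := side_gt0 R Q.
  rewrite mem_filter; apply/andP; split; first by apply/asboolP; split => //; exists y.
  have lev (n n' : nat) : (2 : R) ^- n <= K * 2 ^- n' -> (n' <= n + m)%N.
    move=> h; rewrite -(ler_eXn2l (x := 2 : R)) ?ltr1n//.
    have p1 : 0 < (2 : R) ^+ n by rewrite exprn_gt0.
    have p2 : 0 < (2 : R) ^+ n' by rewrite exprn_gt0.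
    rewrite ler_pdivlMr// in h; rewrite mulrC ler_pdivrMr// in h.
    by rewrite exprD; apply: le_trans h _; rewrite mulrC ler_pM2l.
  rewrite mem_undup.
  have [u uE] : exists u, Q = offset_cube Q0.1 (m:=m) (B:=B) x u.
    apply: offset_cubeP; [exact: lev|exact: lev|].
    have c := ler_normD (x - y) (y - centre R Q); rewrite subrKA (distrC x y) in c.
    move: yQ; rewrite /wide /=; nra.
  by rewrite uE; apply: map_f; rewrite mem_enum.
Qed.

End WhitneyNear.

Section C1Closure.
Variable R : realType.
Local Notation pt := 'rV[R]_3.
Implicit Types (f g h : pt -> R) (U : set pt).

Lemma C1V U g : open U -> (forall x, U x -> g x != 0) -> Cn 1 U g -> Cn 1 U (fun x => (g x)^-1).
Proof.
move=> oU g0 cg; split=> [x Ux|k]; first by apply: continuousV; [exact: g0|exact: cg.1].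
have H x : U x -> is_pd k (fun x => (g x)^-1) x (- pd k g x / g x ^+ 2).
  by move=> Ux; apply: is_pdV; [exact: g0|exact: Cn_is_pd cg Ux].
split=> [x /H /is_pdP[]//|].
apply: (@Cn_eq _ _ _ (fun x => - pd k g x * ((g x)^-1 * (g x)^-1))) => //.
  by move=> x /H /is_pdP[_ ->]; rewrite -invfM.
split=> // x Ux; apply: (@continuousM _ _ (fun x => - pd k g x)).
  by apply: continuousN; exact: (cg.2 k).2.1.
by apply: (@continuousM _ _ (fun x => (g x)^-1)); apply: continuousV; (exact: g0 || exact: cg.1).
Qed.

Lemma Cn_sum n U (I : Type) (s : seq I) (g : I -> pt -> R) : open U ->
  (forall i, Cn n U (g i)) -> Cn n U (fun x => \sum_(i <- s) g i x).
Proof.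
move=> oU cg; elim: s => [|i s IH].
  by apply: (Cn_eq oU (g := fun=> 0)) (Cn_cst _ _ _) => x _; rewrite big_nil.
by apply: (Cn_eq oU (g := fun x => g i x + \sum_(i <- s) g i x)) (CnD oU (cg i) IH) => x _; rewrite big_cons.
Qed.

Lemma ler_norm_sum_bound (I : eqType) (s : seq I) (F : I -> R) (M : R) (n : nat) :
  0 <= M -> (size s <= n)%N -> (forall i, i \in s -> `|F i| <= M) -> `|\sum_(i <- s) F i| <= n%:R * M.
Proof.
move=> M0 sn FM; apply: le_trans (ler_norm_sum _ _ _) _.
apply: (@le_trans _ _ (\sum_(i <- s) M)).
  by rewrite big_seq [leRHS]big_seq; apply: ler_sum => i /FM.
have -> : \sum_(i <- s) M = (size s)%:R * M by rewrite big_const_seq count_predT iter_addr_0 mulr_natl.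
by rewrite ler_wpM2r ?ler_nat.
Qed.

(** Each of the two terms of the quotient rule is at most N B D. In the application d is the sum of
    the bumps, which gives |n| <= D d without a factor N. *)
Lemma quotient_pd_le (n n' d d' B D N : R) : 1 <= d -> 0 <= D -> 0 <= B -> 0 <= N ->
  `|n| <= D * d -> `|n'| <= N * (B * D) -> `|d'| <= N * B -> `|n' * d^-1 + n * (- d' / d ^+ 2)| <= 2 * N * B * D.
Proof.
move=> d1 D0 B0 N0 hn hn' hd'.
have d0 : 0 < d by apply: lt_le_trans d1.
have h1 : `|n' * d^-1| <= N * (B * D).
  rewrite normrM normfV (gtr0_norm d0) ler_pdivrMr//; apply: le_trans hn' _.
  by rewrite ler_peMr// !mulr_ge0.
have h2 : `|n * (- d' / d ^+ 2)| <= D * (N * B).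
  have -> : n * (- d' / d ^+ 2) = - ((n / d) * (d' / d)) by field; exact: lt0r_neq0.
  rewrite normrN normrM; apply: ler_pM => //.
    by rewrite normrM normfV (gtr0_norm d0) ler_pdivrMr.
  rewrite normrM normfV (gtr0_norm d0) ler_pdivrMr//; apply: le_trans hd' _.
  by rewrite ler_peMr// mulr_ge0.
by apply: le_trans (ler_normD _ _) _; apply: le_trans (lerD h1 h2) _; rewrite le_eqVlt; apply/orP; left; apply/eqP; ring.
Qed.

End C1Closure.

(** * Derivative and boundary estimates for the Whitney extension *)

Section Extension.
Variable R : realType.
Local Notation pt := 'rV[R]_3.
Implicit Types (x y t : pt) (Q P : dcube) (j : 'I_3) (a : pt -> R).
Variables (Omega : set pt) (p : dcube -> pt) (L : R) (phi : pt -> R).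
Hypotheses (oO : open Omega) (OL : Omega `<=` box 0 L) (GL : frontier Omega `<=` box 0 L)
  (L0 : 0 <= L) (np : nearest_points Omega (frontier Omega) p)
  (cphi : C1c 1 phi) (phi0 : forall x, 0 <= phi x)
  (phi1 : forall x, `|x| <= 2^-1 -> phi x = 1)
  (phi_supp : forall x, phi x != 0 -> `|x| <= 5 / 8).
Local Notation Gamma := (frontier Omega).
Local Notation wh := (whitney Omega).
Local Notation bump := (bump_at phi).

(** The Whitney sum inside Omega for one real component; [part_trunc] relates it to the complex
    vector field. *)
Definition ext a x := \sum_(Q \in wh) (partition_fun Omega phi Q x * a (p Q)).

Lemma bump_ge0 Q x : 0 <= bump Q x. Proof. exact: phi0. Qed.

Lemma norm_side (Q : dcube) x : `|(side R Q)^-1 *: x| = `|x| / side R Q.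
Proof. by rewrite normrZ gtr0_norm ?invr_gt0 ?side_gt0// mulrC. Qed.

Lemma bump_cube Q x : cube Q x -> bump Q x = 1.
Proof.
move=> /cube_centre h; apply: phi1.
by rewrite norm_side ler_pdivrMr ?side_gt0// mulrC.
Qed.

Lemma bump_wide Q x : bump Q x != 0 -> wide Q x.
Proof.
move=> /phi_supp; rewrite norm_side ler_pdivrMr ?side_gt0//.
Qed.

Lemma bump_C1 Q : Cn 1 setT (bump Q).
Proof. by have := C1c_affine (centre R Q) (c := (side R Q)^-1) _ cphi; rewrite invr_gt0 side_gt0 => /(_ isT)[]. Qed.

Lemma bump_pd_bound : exists2 B : R, 0 <= B & forall Q j x, `|pd j (bump Q) x| <= B / side R Q.
Proof.
have H j : exists M : R, forall x, `|pd j phi x| <= M.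
  apply: (cc_bounded ler01 (@C1c_pd_cont _ _ _ j cphi)) => x.
  exact: C1c_pd0 cphi.
have [B0 h0] := H 0; have [B1 h1] := H 1; have [B2 h2] := H 2.
have b0 : 0 <= B0 by apply: le_trans (h0 0).
have b1 : 0 <= B1 by apply: le_trans (h1 0).
have b2 : 0 <= B2 by apply: le_trans (h2 0).
exists (B0 + B1 + B2) => [|Q j x]; first by rewrite !addr_ge0.
have s0 := side_gt0 R Q.
have /is_pdP[_ ->] : is_pd j (bump Q) x ((side R Q)^-1 * pd j phi ((side R Q)^-1 *: (x - centre R Q))).
  by apply: is_pd_affine; exact: C1c_is_pd cphi.
rewrite normrM gtr0_norm ?invr_gt0// mulrC ler_wpM2r ?invr_ge0 ?(ltW s0)//.
by case: (ord3P j) => ->; [apply: le_trans (h0 _) _|apply: le_trans (h1 _) _|apply: le_trans (h2 _) _]; lra.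
Qed.

(** Near x0 the extension is a quotient of sums over one fixed list, with denominator at least 1
    because each point lies in some cube, where the bump is 1. The clause on [F] covers any sum
    whose terms vanish with the bumps, complex vector sums included. *)
Lemma ext_chart : exists (N : nat) (K : R), 1 <= K /\ forall x0 Q0, wh Q0 -> cube Q0 x0 ->
  exists s : seq dcube, [/\ (size s <= N)%N, Q0 \in s,
    (forall Q, Q \in s -> [/\ wh Q, side R Q0 <= K * side R Q & `|x0 - p Q| <= K * side R Q0]) &
    forall y, `|y - x0| <= side R Q0 / 8 -> [/\ Omega y, 1 <= \sum_(Q <- s) bump Q y,
      forall (V : nmodType) (F : dcube -> V), (forall Q, bump Q y = 0 -> F Q = 0) ->
        \sum_(Q \in wh) F Q = \sum_(Q <- s) F Q &
      forall a, ext a y = (\sum_(Q <- s) bump Q y * a (p Q)) / \sum_(Q <- s) bump Q y]].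
Proof.
have [N [K [K1 H]]] := whitney_finite oO OL GL L0 np.
exists N, K; split=> // x0 Q0 hQ0 Qx; have [s [us sN sP sm]] := H x0 Q0 hQ0 Qx.
have s0 := side_gt0 R Q0.
exists s; split => //.
  by apply: (sm _ x0 hQ0 (cube_wide Qx)); rewrite subrr normr0 divr_ge0 ?(ltW s0).
move=> y yx.
have Oy : Omega y.
  apply: (wide_sub hQ0); rewrite /wide /=; move/cube_centre : Qx => Qx.
  have := ler_normD (y - x0) (x0 - centre R Q0); rewrite subrKA; lra.
have fs (V : nmodType) (F : dcube -> V) : (forall Q, bump Q y = 0 -> F Q = 0) ->
    \sum_(Q \in wh) F Q = \sum_(Q <- s) F Q.
  move=> F0; rewrite (fsbigE s)//=.
  - rewrite big_seq_cond [RHS]big_seq; apply: eq_bigl => Q.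
    by case: (boolP (Q \in s)) => //= /sP[hQ _ _]; rewrite (mem_set hQ).
  - by move=> Q /= /sP[].
  - move=> Q hQ nQ; apply: F0; apply/eqP/negPn/negP => /bump_wide Qw.
    by move/negP: nQ; apply; exact: (sm Q y hQ Qw yx).
split; [exact: Oy| |exact: fs|].
  have [Q1 hQ1 Q1y] := whitney_cover oO Oy.
  have Q1s : Q1 \in s := sm Q1 y hQ1 (cube_wide Q1y) yx.
  rewrite (perm_big _ (perm_to_rem Q1s)) big_cons bump_cube// lerDl.
  by apply: sumr_ge0 => Q _; exact: bump_ge0.
move=> a; rewrite /ext fs; last by move=> Q b0; rewrite /partition_fun b0 !mul0r.
rewrite mulr_suml; apply: eq_bigr => Q _; rewrite /partition_fun fs//.
by rewrite mulrAC.
Qed.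

Lemma ext_C1 a : Cn 1 Omega (ext a).
Proof.
have [N [K [K1 H]]] := ext_chart.
apply: Cn_local => x Ox; have [Q0 hQ0 Qx] := whitney_cover oO Ox.
have [s [_ _ _ sE]] := H x Q0 hQ0 Qx; have s0 := side_gt0 R Q0.
pose V := [set y : pt | `|y - x| < side R Q0 / 8].
have oV : open V by exact: open_ball_norm.
exists V; first by rewrite /V /= subrr normr0 divr_gt0.
apply: (Cn_eq oV (g := fun y => (\sum_(Q <- s) bump Q y * a (p Q)) * (\sum_(Q <- s) bump Q y)^-1)).
  by move=> y /ltW /sE[_ _ _ ->].
have cb Q : Cn 1 V (bump Q) by apply: Cn_sub (bump_C1 Q).
apply: C1M => //.
  apply: Cn_sum => // Q; apply: (Cn_eq oV (g := fun y => a (p Q) * bump Q y)); last exact: CnZ.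
  by move=> y _; rewrite mulrC.
apply: C1V => //; last exact: Cn_sum.
by move=> y /ltW /sE[_ h _ _]; rewrite lt0r_neq0// (lt_le_trans _ h).
Qed.

Variables (a : pt -> R) (A mu : R).
Hypotheses (mu0 : 0 < mu) (A0 : 0 <= A)
  (ha : forall t t', Gamma t -> Gamma t' -> `|a t - a t'| <= A * `|t - t'| `^ mu).

(** The weights sum to 1, so the constant a(p Q0) can be subtracted before differentiating. What
    remains are differences of boundary values, of order side^mu, and each derivative of a bump
    costs 1/side. *)
Lemma ext_pd_bound : exists2 C : R, 0 <= C & forall Q x j, wh Q -> cube Q x ->
  `|pd j (ext a) x| <= C * (side R Q `^ mu / side R Q).
Proof.
have [N [K [K1 H]]] := ext_chart.
have [B B0 HB] := bump_pd_bound.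
have K0 : 0 <= K by apply: le_trans K1.
exists (2 * N%:R * (B * K) * (A * (2 * K) `^ mu)).
  by rewrite !mulr_ge0// powR_ge0.
move=> Q0 x j hQ0 Qx; have [s [sN Q0s sP sE]] := H x Q0 hQ0 Qx.
have l0 := side_gt0 R Q0.
pose D := A * (2 * K * side R Q0) `^ mu.
have D0 : 0 <= D by rewrite mulr_ge0// powR_ge0.
(* The value 0 off the list makes the bound by [D] hold for every cube, without a membership
   condition. *)
pose d Q := if Q \in s then a (p Q) - a (p Q0) else 0.
have dD Q : `|d Q| <= D.
  rewrite /d; case: ifP => [Qs|_]; last by rewrite normr0.
  have [hQ _ h] := sP Q Qs; have [_ _ h'] := sP Q0 Q0s.
  apply: le_trans (ha (np hQ).1 (np hQ0).1) _; rewrite ler_wpM2l//.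
  apply: ge0_ler_powR; rewrite ?nnegrE ?(ltW mu0)// ?mulr_ge0// ?(ltW l0)//.
  have := ler_normD (p Q - x) (x - p Q0); rewrite subrKA (distrC _ x); lra.
pose Phi y := \sum_(Q <- s) bump Q y.
pose Nd y := \sum_(Q <- s) bump Q y * d Q.
have E y : `|y - x| <= side R Q0 / 8 -> Nd y * (Phi y)^-1 + a (p Q0) = ext a y.
  move=> /sE[_ h _ ->]; have n0 : Phi y != 0 by rewrite lt0r_neq0// (lt_le_trans _ h).
  rewrite -/(Phi y) -[X in _ + X](mulfK n0) -mulrDl; congr (_ / _).
  rewrite /Phi mulr_sumr -big_split /= big_seq [RHS]big_seq; apply: eq_bigr => Q Qs.
  by rewrite /d Qs; ring.
have xx : `|x - x| <= side R Q0 / 8 by rewrite subrr normr0 divr_ge0 ?(ltW l0).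
have [Ox Phi1 _ _] := sE x xx.
have n0 : Phi x != 0 by rewrite lt0r_neq0// (lt_le_trans _ Phi1).
have bpd Q : is_pd j (bump Q) x (pd j (bump Q) x) by apply: Cn_is_pd (bump_C1 Q) _.
have pPhi : is_pd j Phi x (\sum_(Q <- s) pd j (bump Q) x) by apply: is_pd_sum.
have pN : is_pd j Nd x (\sum_(Q <- s) pd j (bump Q) x * d Q).
  apply: is_pd_sum => Q; apply: is_pd_eq (is_pdM (bpd Q) (is_pd_cst j (d Q) x)).
  by rewrite mulr0 addr0.
have pE := is_pdD (is_pdM pN (is_pdV n0 pPhi)) (is_pd_cst j (a (p Q0)) x).
have l8 : 0 < side R Q0 / 8 by rewrite divr_gt0.
have /is_pdP[_ ->] := is_pd_local l8 (fun y yx => E y (ltW yx)) pE.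
rewrite addr0.
have -> : 2 * N%:R * (B * K) * (A * (2 * K) `^ mu) * (side R Q0 `^ mu / side R Q0) =
  2 * N%:R * (B * K / side R Q0) * D.
  rewrite /D (@powRM _ (2 * K)) ?mulr_ge0 ?(ltW l0)//; ring.
have BK Q : Q \in s -> `|pd j (bump Q) x| <= B * K / side R Q0.
  move=> Qs; have [_ h _] := sP Q Qs; have l1 := side_gt0 R Q.
  apply: le_trans (HB _ _ _) _; rewrite -mulrA ler_wpM2l//.
  by rewrite ler_pdivlMr// mulrC ler_pdivrMr.
have BK0 : 0 <= B * K / side R Q0 by rewrite divr_ge0 ?mulr_ge0 ?(ltW l0).
apply: quotient_pd_le => //.
- rewrite /Nd; apply: le_trans (ler_norm_sum _ _ _) _; rewrite /Phi mulr_sumr.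
  by apply: ler_sum => Q _; rewrite normrM (ger0_norm (bump_ge0 _ _)) mulrC ler_wpM2r// bump_ge0.
- apply: ler_norm_sum_bound => // [|Q Qs]; first by rewrite mulr_ge0.
  by rewrite normrM; apply: ler_pM => //; exact: BK.
- exact: ler_norm_sum_bound.
Qed.

(** The value at x averages a(p Q) over cubes whose wide boxes contain x. By [whitney_far] their
    sides are at most 2 |x - t|, so |p Q - t| <= (1 + 2C) |x - t|. *)
Lemma ext_boundary : exists2 C : R, 0 <= C & forall x t, Omega x -> Gamma t ->
  `|ext a x - a t| <= C * `|x - t| `^ mu.
Proof.
have [N [K [K1 H]]] := ext_chart.
have [C C1 HC] := whitney_near oO OL GL L0 np.
exists (A * (1 + 2 * C) `^ mu); first by rewrite mulr_ge0// powR_ge0.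
move=> x t Ox Gt; have [Q0 hQ0 Qx] := whitney_cover oO Ox.
have [s [sN Q0s sP sE]] := H x Q0 hQ0 Qx.
have l0 := side_gt0 R Q0.
have xx : `|x - x| <= side R Q0 / 8 by rewrite subrr normr0 divr_ge0 ?(ltW l0).
have [_ Phi1 _ ->] := sE x xx.
set D := A * _ * _; set Phi := \sum_(Q <- s) bump Q x.
have Phi0 : 0 < Phi by apply: lt_le_trans Phi1.
have -> : (\sum_(Q <- s) bump Q x * a (p Q)) / Phi - a t = (\sum_(Q <- s) bump Q x * (a (p Q) - a t)) / Phi.
  rewrite -[X in _ - X](mulfK (lt0r_neq0 Phi0)) -mulrBl; congr (_ / _).
  by rewrite /Phi mulr_sumr -sumrB; apply: eq_bigr => Q _; ring.
rewrite normrM normfV (gtr0_norm Phi0) ler_pdivrMr//.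
apply: le_trans (ler_norm_sum _ _ _) _; rewrite /Phi mulr_sumr big_seq [leRHS]big_seq.
apply: ler_sum => Q Qs; rewrite normrM (ger0_norm (bump_ge0 _ _)) mulrC.
have [b0|/eqP/bump_wide xQ] := pselect (bump Q x = 0); first by rewrite b0 !mulr0.
rewrite ler_wpM2r ?bump_ge0//; have [hQ _ _] := sP Q Qs.
apply: le_trans (ha (np hQ).1 Gt) _; rewrite /D -mulrA ler_wpM2l//.
rewrite -powRM//; last by move: C1; lra.
apply: ge0_ler_powR; rewrite ?nnegrE ?(ltW mu0)// ?mulr_ge0//; first by move: C1; lra.
have h1 := whitney_far hQ xQ (frontier_disjoint oO Gt).
have h2 := HC _ _ hQ xQ; have := ler_normD (p Q - x) (x - t); rewrite subrKA (distrC _ x).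
have l1 := side_gt0 R Q; nra.
Qed.

End Extension.

(** * Minkowski dimension and integrability of the gradient *)

Section Covering.
Variable R : realType.
Local Notation pt := 'rV[R]_3.
Local Notation P := (@point_of R).
Implicit Types (x y t : pt) (Gamma : set pt) (s r e : R).

Lemma powR_half k e : (2 ^- k : R) `^ e = (2^-1 `^ e) ^+ k.
Proof.
have h : 0 <= (2 : R)^-1 by rewrite invr_ge0.
by rewrite -exprVn -powR_mulrn// -powRrM mulrC powRrM powR_mulrn ?powR_ge0.
Qed.

Lemma powR_half_lt1 e : 0 < e -> (2^-1 : R) `^ e < 1.
Proof.
move=> e0; suff: (2^-1 : R) `^ e < 1 `^ e by rewrite powR1.
apply: gt0_ltr_powR => //; rewrite ?nnegrE ?invr_ge0 ?ler01//.
by rewrite invf_lt1// ltr1n.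
Qed.

(** A nonempty set of natural numbers contains its infimum. It is nonempty by compactness, sup-norm
    balls of radius r/2 lying in Euclidean balls of radius r. *)
Lemma covering_number_attained Gamma r : compact Gamma -> 0 < r ->
  exists2 n : nat, covering_number Gamma r = n%:R &
    exists c : 'I_n -> pt, Gamma `<=` [set x | exists k, enorm (x - c k) <= r].
Proof.
move=> cG r0.
pose S := [set n : nat | exists c : 'I_n -> pt, Gamma `<=` [set x | exists k, enorm (x - c k) <= r]].
have S0 : exists n, `[< S n >].
  have r4 : 0 < r / 2 by rewrite divr_gt0.
  move: cG; rewrite compact_cover => /(_ pt setT (fun c => [set x | `|x - c| < r / 2])) [].
  - by move=> c _; exact: open_ball_norm.
  - by move=> x Gx; exists x => //=; rewrite subrr normr0.
  move=> D _ GD; exists (size (finmap.enum_fset D)); apply/asboolP.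
  exists (fun i => nth 0 (finmap.enum_fset D) i) => x /GD[c /= cD xc].
  have iD : (index c (finmap.enum_fset D) < size (finmap.enum_fset D))%N by rewrite index_mem.
  exists (Ordinal iD); rewrite /= nth_index//.
  by have := enorm_le_norm (x - c); lra.
pose n := ex_minn S0.
have [Sn nmin] : S n /\ forall m, S m -> (n <= m)%N.
  rewrite /n; case: ex_minnP => m /asboolP Sm H; split => // k Sk.
  by apply: H; apply/asboolP.
exists n => //; apply/eqP; rewrite eq_le; apply/andP; split.
  by apply: ge_inf; [exists 0 => _ [k _ <-]|exists n].
apply: lb_le_inf; first by exists n%:R; exists n.
by move=> _ [k Sk <-]; rewrite ler_nat; exact: nmin.
Qed.

Lemma minkowski_cover Gamma s : compact Gamma -> (minkowski_dim Gamma < s%:E)%E ->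
  exists2 d : R, 0 < d & forall r, 0 < r < d ->
    exists (n : nat) (c : 'I_n -> pt), n%:R <= r `^ (- s) /\
      Gamma `<=` [set x | exists k, enorm (x - c k) <= r].
Proof.
move=> cG /ereal_inf_lt[_ [V VF <-] Vs].
move: VF => /nbhs_ballP[d /= d0 dV].
exists (Num.min d 1) => [|r /andP[r0]]; first by rewrite lt_min d0 ltr01.
rewrite lt_min => /andP[rd r1].
have [n nE [c Gc]] := covering_number_attained cG r0.
exists n, c; split => //.
have Vr : V r by apply: (dV r) => //; rewrite /ball /= sub0r normrN gtr0_norm.
have : ((ln (covering_number Gamma r) / - ln r)%:E < s%:E)%E.
  by apply: le_lt_trans Vs; apply: ereal_sup_ubound; exists r.
have lr : 0 < - ln r by rewrite oppr_gt0 ln_lt0// r0.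
rewrite lte_fin ltr_pdivrMr// nE => h.
(* An empty cover is treated apart, since the exponential inverts [ln] on positive numbers only. *)
case: n nE c Gc h => [|n] _ _ _ h; first by rewrite powR_ge0.
rewrite /powR gt_eqF// -[leLHS](@lnK _ n.+1%:R) ?posrE ?ltr0n//.
by rewrite ler_expR ltW// mulNr -mulrN.
Qed.

Lemma lam_balls (s : seq pt) r : 0 <= r ->
  let E := [set x | exists2 c, c \in s & box c r x] in
  msrs E /\ (lam (P @^-1` E) <= ((size s)%:R * (2 * r) ^+ 3)%:E)%E.
Proof.
move=> r0; elim: s => [|c s [mE lE]].
  have -> : [set x | exists2 c, c \in [::] & box c r x] = set0.
    by apply/seteqP; split=> // x [c]; rewrite in_nil.
  by rewrite /msrs preimage_set0 measure0 mul0r; split; [exact: measurable0|].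
set E := [set x | _] in mE lE.
have -> : [set x | exists2 b, b \in c :: s & box b r x] = box c r `|` E.
  apply/seteqP; split=> x.
    by move=> [b]; rewrite inE => /predU1P[->|bs]; [left|right; exists b].
  by move=> [h|[b bs h]]; [exists c => //; rewrite mem_head|exists b => //; rewrite inE bs orbT].
have mb := msrs_box c r.
split; first exact: measurableU.
rewrite preimage_setU; apply: (@le_trans _ _ (lam (P @^-1` box c r) + lam (P @^-1` E))%E); first exact: (measureU2 (@lam R) mb mE).
rewrite lam_box// addeC [size (c :: s)]/= -[(size s).+1%:R]natr1 [X in (_ <= X%:E)%E]mulrDl [X in (_ <= (_ + X)%:E)%E]mul1r EFinD.
exact: leeD2r.
Qed.

(** A point within C 2^-k of Gamma is within (C + 1) 2^-k of a centre of a cover by at most 2^(ks)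
    balls of radius 2^-k, of total measure of order 2^(-k(3-s)). For the finitely many small k the
    whole box serves, at the price of the factor [q ^- k0]. *)
Lemma collar_measure Gamma s C L : compact Gamma -> (minkowski_dim Gamma < s%:E)%E -> s < 3 ->
  0 <= C -> 0 <= L ->
  exists2 M : R, 0 <= M & forall k : nat, exists E : set pt,
    [/\ msrs E, (lam (P @^-1` E) <= (M * (2^-1 `^ (3 - s)) ^+ k)%:E)%E &
      forall x t, box 0 L x -> Gamma t -> `|x - t| <= C * 2 ^- k -> E x].
Proof.
move=> cG ms s3 C0 L0; have [d d0 H] := minkowski_cover cG ms.
have [k0 hk0] := exp2inv_lt d0.
set q := _ `^ _.
have h0 : 0 < (2 : R)^-1 by rewrite invr_gt0.
have q0 : 0 < q by rewrite powR_gt0.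
have q1 : q < 1 by apply: powR_half_lt1; rewrite subr_gt0.
have M1 : 0 <= (2 * (C + 1)) ^+ 3 by rewrite exprn_ge0// mulr_ge0// addr_ge0.
have M2 : 0 <= (2 * L) ^+ 3 * q ^- k0.
  by rewrite mulr_ge0// ?exprn_ge0 ?mulr_ge0// invr_ge0 exprn_ge0// ltW.
exists ((2 * (C + 1)) ^+ 3 + (2 * L) ^+ 3 * q ^- k0); first exact: addr_ge0.
move=> k; have qk : 0 <= q ^+ k by rewrite exprn_ge0// ltW.
have [kk|kk] := ltnP k k0.
  exists (box 0 L); split=> //; first exact: msrs_box.
  rewrite lam_box// lee_fin [leRHS]mulrDl; apply: ler_wpDl; first exact: mulr_ge0.
  rewrite -mulrA; apply: ler_peMr; first by rewrite exprn_ge0// mulr_ge0.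
  by rewrite mulrC ler_pdivlMr ?exprn_gt0// mul1r ler_wiXn2l// ?(ltW q0) ?(ltW q1)// ltnW.
have r0 : 0 < (2 : R) ^- k by rewrite invr_gt0 exprn_gt0.
have [n [c [nr Gc]]] := H (2 ^- k) (introT andP (conj r0 (hk0 k kk))).
have rr : 0 <= (C + 1) * 2 ^- k by rewrite mulr_ge0 ?(ltW r0)// addr_ge0.
have [mE lE] := lam_balls [seq c i | i <- enum 'I_n] rr.
exists [set x | exists2 b, b \in [seq c i | i <- enum 'I_n] & box b ((C + 1) * 2 ^- k) x]; split => //.
  apply: le_trans lE _; rewrite size_map size_enum_ord lee_fin [leRHS]mulrDl; apply: ler_wpDr; first exact: mulr_ge0.
  apply: (@le_trans _ _ ((2 ^- k) `^ (- s) * (2 * ((C + 1) * 2 ^- k)) ^+ 3)).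
    by rewrite ler_wpM2r// exprn_ge0// mulr_ge0.
  have -> : q = 2^-1 `^ (- s) * 2^-1 ^+ 3.
    by rewrite /q addrC powRD ?powR_mulrn ?(ltW h0)//; apply/implyP => _; rewrite gt_eqF.
  have -> : (2^-1 `^ (- s) * 2^-1 ^+ 3) ^+ k = (2^-1 `^ (- s)) ^+ k * (2^-1 ^+ k) ^+ 3 :> R.
    by rewrite [LHS]exprMn -!exprM mulnC.
  rewrite powR_half -exprVn; move: (_ ^+ k) (_ ^+ k) => u v.
  by rewrite le_eqVlt; apply/orP; left; apply/eqP; ring.
move=> x t xL Gt xt; have [i ti] := Gc t Gt.
exists (c i); first by apply: map_f; rewrite mem_enum.
rewrite /box /=; have := norm_le_enorm (t - c i).
have := ler_normD (x - t) (t - c i); rewrite subrKA mulrDl mul1r; lra.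
Qed.

End Covering.

Section ExtensionDensity.
Variable R : realType.
Local Notation pt := 'rV[R]_3.
Implicit Types (x y t : pt) (Q : dcube) (j : 'I_3).
Variables (Omega : set pt) (p : dcube -> pt) (L : R) (phi : pt -> R) (a : pt -> R) (A mu s : R).
Hypotheses (oO : open Omega) (OL : Omega `<=` box 0 L) (cG : compact (frontier Omega))
  (GL : frontier Omega `<=` box 0 L)
  (L0 : 0 <= L) (np : nearest_points Omega (frontier Omega) p)
  (cphi : C1c 1 phi) (phi0 : forall x, 0 <= phi x)
  (phi1 : forall x, `|x| <= 2^-1 -> phi x = 1)
  (phi_supp : forall x, phi x != 0 -> `|x| <= 5 / 8)
  (mu01 : 0 < mu <= 1) (A0 : 0 <= A)
  (ha : forall t t', frontier Omega t -> frontier Omega t' -> `|a t - a t'| <= A * `|t - t'| `^ mu)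
  (ms : (minkowski_dim (frontier Omega) < s%:E)%E) (s3 : s < 3 * mu).
Local Notation ew := (ext Omega p phi a).

(* With p = 3 + 3 mu - s, the series bounding the integral has ratio
   2^-((mu - 1) p + 3 - s) = 2^-(mu (3 mu - s)) < 1. *)
Lemma ext_dens j : dens (3 + (3 * mu - s)) L (grad_density Omega ew j).
Proof.
set P := 3 + _.
have /andP[mu0 mu1] := mu01.
have s3' : s < 3 by move: s3 mu1; lra.
have [C C0 HC] := ext_pd_bound oO OL GL L0 np cphi phi0 phi1 phi_supp mu0 A0 ha.
have [D D1 HD] := whitney_near oO OL GL L0 np.
have D0 : 0 <= D by apply: le_trans D1.
have [M M0 HM] := collar_measure cG ms s3' D0 L0.
have cw := ext_C1 oO OL GL L0 np cphi phi0 phi1 phi_supp a.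
have P0 : 0 < P by rewrite addr_gt0// subr_gt0.
have mr : msr (grad_density Omega ew j).
  by apply: msr_open_patch => // x Ox; exact: (cw.2 j).2.1.
split=> // [x xL|].
  by apply: rho_out => /OL.
have h0 : 0 < (2 : R)^-1 by rewrite invr_gt0.
pose b : R := 2^-1 `^ ((mu - 1) * P).
have /choice[E HE] := HM.
have b0 : 0 <= b by rewrite powR_ge0.
have bq : b * 2^-1 `^ (3 - s) < 1.
  rewrite /b -powRD; last by apply/implyP => _; rewrite gt_eqF.
  apply: powR_half_lt1; rewrite /P.
  have -> : (mu - 1) * (3 + (3 * mu - s)) + (3 - s) = mu * (3 * mu - s) by ring.
  by rewrite mulr_gt0// subr_gt0.
have bq0 : 0 <= b * 2^-1 `^ (3 - s) by rewrite mulr_ge0// powR_ge0.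
apply: (proj1 (itg_series (E := E) (a := fun k => C `^ P * b ^+ k)
  (m := fun k => M * (2^-1 `^ (3 - s)) ^+ k) (S := C `^ P * M * (1 - b * 2^-1 `^ (3 - s))^-1) _ _ _ _ _ _)).
- by move=> k; have [] := HE k.
- by move=> k; rewrite mulr_ge0 ?powR_ge0 ?exprn_ge0.
- by move=> k; have [] := HE k.
- move=> n.
  have -> : \sum_(0 <= k < n) C `^ P * b ^+ k * (M * (2^-1 `^ (3 - s)) ^+ k) =
    C `^ P * M * \sum_(0 <= k < n) (b * 2^-1 `^ (3 - s)) ^+ k.
    by rewrite mulr_sumr; apply: eq_bigr => k _; rewrite exprMn; ring.
  by rewrite ler_wpM2l ?mulr_ge0 ?powR_ge0//; apply: geometric_le; rewrite bq0 bq.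
- by apply: msr_powR; exact: msr_norm.
move=> x; have [Ox|Ox] := pselect (Omega x); last first.
  have -> : grad_density Omega ew j x = 0 by apply: rho_out.
  by rewrite normr0 powR0 ?eqxx// gt_eqF.
move=> _; have [Q hQ Qx] := whitney_cover oO Ox.
(* A cube of level k lies in the k-th collar, since its points are within D 2^-k of [p Q]. *)
exists Q.1.
  have [_ _ HEx] := HE Q.1; apply: (HEx x (p Q) (OL Ox) (np hQ).1).
  exact: HD hQ (cube_wide Qx).
have -> : grad_density Omega ew j x = pd j ew x by apply: rho_in.
rewrite ger0_norm ?powR_ge0//.
apply: le_trans (ge0_ler_powR (ltW P0) _ _ (HC Q x j hQ Qx)) _; rewrite ?nnegrE//.
  by rewrite mulr_ge0// divr_ge0 ?powR_ge0// (ltW (side_gt0 _ _)).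
rewrite powRM//; last by rewrite divr_ge0 ?powR_ge0// (ltW (side_gt0 _ _)).
rewrite ler_wpM2l ?powR_ge0// /side.
have r0 : 0 < (2 : R) ^- Q.1 by rewrite invr_gt0 exprn_gt0.
have -> : (2 ^- Q.1) `^ mu / (2 ^- Q.1) = (2 ^- Q.1 : R) `^ (mu - 1).
  apply: (mulIf (lt0r_neq0 r0)); rewrite mulfVK ?lt0r_neq0//.
  rewrite -{3}[2 ^- Q.1](@powRr1 R (2 ^- Q.1) (ltW r0))// -powRD ?subrK//.
  by apply/implyP => _; rewrite lt0r_neq0.
by rewrite -powRrM powR_half /b.
Qed.

End ExtensionDensity.

(** * Curl systems and their quaternionic combinations *)

Section CurlSystems.
Variable R : realType.
Local Notation pt := 'rV[R]_3.
Implicit Types (g h : pt -> R) (x y : pt) (i j l m : 'I_3) (U : set pt) (n : nat).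

Definition harmonic U h := Cn 2 U h /\ forall x, U x -> \sum_l pd l (pd l h) x = 0.

Lemma harmonicD U g h : open U -> harmonic U g -> harmonic U h -> harmonic U (fun x => g x + h x).
Proof.
move=> oU [cg hg] [ch hh]; split=> [|x Ux]; first exact: CnD.
transitivity (\sum_l pd l (pd l g) x + \sum_l pd l (pd l h) x); last exact: (etrans (congr2 +%R (hg x Ux) (hh x Ux)) (addr0 0)).
rewrite -big_split; apply: eq_bigr => l _ /=.
rewrite (@pd_local _ _ _ (fun y => pd l g y + pd l h y) U) //.
  have := is_pdD (Cn_is_pd l ((cg.2 l).2 : Cn 1 U (pd l g)) Ux) (Cn_is_pd l ((ch.2 l).2 : Cn 1 U (pd l h)) Ux).
  by move=> /is_pdP[].
by move=> y Uy; have /is_pdP[_] := is_pdD (Cn_is_pd l cg Uy) (Cn_is_pd l ch Uy).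
Qed.

Lemma harmonicZ U (a : R) g : open U -> harmonic U g -> harmonic U (fun x => a * g x).
Proof.
move=> oU [cg hg]; split=> [|x Ux]; first exact: CnZ.
transitivity (a * \sum_l pd l (pd l g) x); last exact: (etrans (congr1 ( *%R a) (hg x Ux)) (mulr0 a)).
rewrite mulr_sumr; apply: eq_bigr => l _ /=.
rewrite (@pd_local _ _ _ (fun y => a * pd l g y) U) //.
  by have /is_pdP[] := is_pdZ a (Cn_is_pd l ((cg.2 l).2 : Cn 1 U (pd l g)) Ux).
by move=> y Uy; have /is_pdP[_] := is_pdZ a (Cn_is_pd l cg Uy).
Qed.

(* Equivalently, the quaternion-valued function t + B is monogenic. *)
Definition curl_system U (t : pt -> R) (B : 'I_3 -> pt -> R) :=
  [/\ forall n, Cn n U t, forall i n, Cn n U (B i),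
     forall x, U x -> [/\ pd 0 t x = pd 1 (B 2) x - pd 2 (B 1) x,
       pd 1 t x = pd 2 (B 0) x - pd 0 (B 2) x & pd 2 t x = pd 0 (B 1) x - pd 1 (B 0) x],
     forall x, U x -> pd 0 (B 0) x + pd 1 (B 1) x + pd 2 (B 2) x = 0 &
     forall i, harmonic U (B i)].

(** The convolution of [kn] with [rho] by the cross product: [rotp] at the cyclic pairs of
    indices. *)
Definition rotv (rho : 'I_3 -> pt -> R) i : pt -> R :=
  if i == 0 then rotp rho 1 2 else if i == 1 then rotp rho 2 0 else rotp rho 0 1.

Lemma rotv_ind (P : (pt -> R) -> Prop) rho : (forall i j, P (rotp rho i j)) -> forall i, P (rotv rho i).
Proof. by move=> H i; rewrite /rotv; case: ifP => _; [|case: ifP => _]; exact: H. Qed.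

Lemma pd_rotp_diag rho i l x : pd l (rotp rho i i) x = 0.
Proof.
have -> : rotp rho i i = fun=> 0 by apply/funext => y; rewrite /rotp subrr.
by have /is_pdP[] := is_pd_cst l (0 : R) x.
Qed.

Lemma pd_rotp_skew rho i j l x : derivable (rotp rho j i) x (ej R l) ->
  pd l (rotp rho i j) x = - pd l (rotp rho j i) x.
Proof.
move=> /pdP/is_pdN/is_pdP[_ <-]; congr (pd l _ x).
by apply/funext => y; rewrite /rotp opprB.
Qed.

Lemma diag_first (u a b d d' : R) : u = a + b + d -> a = 0 -> d = - d' -> u = b - d'.
Proof. by move=> -> -> ->; rewrite add0r. Qed.

Lemma diag_mid (u a a' b d : R) : u = a + b + d -> b = 0 -> a = - a' -> u = d - a'.
Proof. by move=> -> -> ->; rewrite addr0 addrC. Qed.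

Lemma diag_last (u a b b' d : R) : u = a + b + d -> d = 0 -> b = - b' -> u = a - b'.
Proof. by move=> -> -> ->; rewrite addr0. Qed.

Lemma rotp_curl rho g x : (forall i j l, derivable (rotp rho i j) x (ej R l)) ->
  (forall l, pd l g x = \sum_i pd i (rotp rho l i) x) ->
  [/\ pd 0 g x = pd 1 (rotv rho 2) x - pd 2 (rotv rho 1) x,
      pd 1 g x = pd 2 (rotv rho 0) x - pd 0 (rotv rho 2) x &
      pd 2 g x = pd 0 (rotv rho 1) x - pd 1 (rotv rho 0) x].
Proof.
move=> dR E; have E3 l := etrans (E l) (sum3 _).
split.
- exact: (diag_first (E3 0) (pd_rotp_diag _ _ _ _) (pd_rotp_skew (dR 2 0 2))).
- exact: (diag_mid (E3 1) (pd_rotp_diag _ _ _ _) (pd_rotp_skew (dR 0 1 0))).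
- exact: (diag_last (E3 2) (pd_rotp_diag _ _ _ _) (pd_rotp_skew (dR 1 2 1))).
Qed.

Lemma curl_system_outer L rho U : (forall j, itg (rho j)) ->
  (forall j x, ~ box 0 L x -> rho j x = 0) -> open U -> (forall j x, U x -> rho j x = 0) ->
  curl_system U (trp rho) (rotv rho).
Proof.
move=> ir rL oU rU.
have cR i j n : Cn n U (rotp rho i j) by exact: rotp_Cn ir rL oU rU i j n.
have dR i j l x : U x -> derivable (rotp rho i j) x (ej R l).
  by move=> Ux; have /is_pdP[] := Cn_is_pd l (cR i j 1) Ux.
split.
- by move=> n; exact: trp_Cn ir rL oU rU n.
- by move=> i n; apply: (rotv_ind (P := Cn n U)) => *; exact: cR.
- by move=> x Ux; apply: rotp_curl => [i j l|l]; [exact: dR|exact: (trp_grad ir rL oU rU)].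
- by move=> x Ux; exact: (rotp_div ir rL oU rU Ux).
- by apply: (rotv_ind (P := harmonic U)) => i j; split=> [|x Ux]; [exact: cR|exact: (rotp_harmonic ir rL oU rU i j Ux)].
Qed.

(** The function of [tau_grad] is taken with the opposite sign, so that the same [rotv] serves
    inside and outside. *)
Lemma curl_system_inner phi Omega w (L p : R) : C1c 1 phi ->
  (forall x, `|x| <= 2^-1 -> phi x = 1) -> open Omega -> Omega `<=` box 0 L -> 0 <= L -> 3 < p ->
  Cn 1 Omega w -> (forall j, dens p L (grad_density Omega w j)) ->
  let rho := grad_density Omega w in
  curl_system Omega (fun x => trp rho x - newton_const phi * w x) (rotv rho).
Proof.
move=> cphi phi1 oO OL L0 p3 cw dr rho; set c0 := newton_const phi.
have cR i j n : Cn n Omega (rotp rho i j) := rotp_Omega_Cn cphi phi1 oO OL L0 p3 cw dr i j n.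
have dR i j l x : Omega x -> derivable (rotp rho i j) x (ej R l).
  by move=> Ux; have /is_pdP[] := Cn_is_pd l (cR i j 1) Ux.
have ct n : Cn n Omega (fun x => c0 * w x - trp rho x) := tau_Cn cphi phi1 oO OL L0 p3 cw dr n.
have tE : (fun x => trp rho x - c0 * w x) = (fun x => -1 * (c0 * w x - trp rho x)).
  by apply/funext => x; rewrite mulN1r opprB.
rewrite tE; split.
- by move=> n; exact: CnZ.
- by move=> i n; apply: (rotv_ind (P := Cn n Omega)) => *; exact: cR.
- move=> x Ux.
  apply: rotp_curl => [i j l|l]; first exact: dR.
  have /is_pdP[_ ->] := is_pdZ (-1) (Cn_is_pd l (ct 1) Ux).
  apply: etrans (congr1 ( *%R (-1)) (tau_grad cphi phi1 oO OL L0 p3 cw dr l Ux)) _.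
  rewrite mulN1r -sumrN; apply: eq_bigr => i _; apply: esym.
  by apply: pd_rotp_skew; exact: dR.
- by move=> x Ux; exact: (rotp_Omega_div cphi phi1 oO OL L0 p3 cw dr Ux).
- by apply: (rotv_ind (P := harmonic Omega)) => i j; split=> [|x Ux]; [exact: cR|exact: (rotp_Omega_harmonic cphi phi1 oO OL L0 p3 cw dr i j Ux)].
Qed.

Definition laplace_eqs (c s : R) (F : 'I_3 -> pt -> R) x :=
  [/\ - pd 0 (F 0) x + (pd 1 (F 1) x - pd 2 (F 2) x) * s - (pd 1 (F 2) x + pd 2 (F 1) x) * c = 0,
      (pd 2 (F 2) x - pd 1 (F 1) x) * c - (pd 1 (F 2) x + pd 2 (F 1) x) * s = 0,
      - pd 0 (F 2) x + pd 2 (F 0) x * s + pd 1 (F 0) x * c = 0 &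
      pd 0 (F 1) x - pd 2 (F 0) x * c + pd 1 (F 0) x * s = 0].

Variables (c s : R).
Hypothesis cs1 : c ^+ 2 + s ^+ 2 = 1.

(* The vector and scalar parts of sum_m (t_m + psi . B_m) e_m, where
   psi = (i, c k - s j, c j + s k) is the structural set. *)
Definition psi_vec (t : 'I_3 -> pt -> R) (B : 'I_3 -> 'I_3 -> pt -> R) m : pt -> R := fun x =>
  [:: t 0 x - (c * B 1 1 x + s * B 1 2 x) + (c * B 2 2 x - s * B 2 1 x);
      t 1 x + (c * B 0 1 x + s * B 0 2 x) - B 2 0 x;
      t 2 x - (c * B 0 2 x - s * B 0 1 x) + B 1 0 x]`_m.

Definition psi_scal (B : 'I_3 -> 'I_3 -> pt -> R) x :=
  - B 0 0 x - (c * B 1 2 x - s * B 1 1 x) - (c * B 2 1 x + s * B 2 2 x).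

Lemma psi_vecE t B m x : psi_vec t B m x = if m == 0 then t 0 x - (c * B 1 1 x + s * B 1 2 x) + (c * B 2 2 x - s * B 2 1 x)
  else if m == 1 then t 1 x + (c * B 0 1 x + s * B 0 2 x) - B 2 0 x else t 2 x - (c * B 0 2 x - s * B 0 1 x) + B 1 0 x.
Proof. by case: (ord3P m) => ->. Qed.

Section OneSystem.
Variables (U : set pt) (t : 'I_3 -> pt -> R) (B : 'I_3 -> 'I_3 -> pt -> R).
Hypotheses (oU : open U) (sys : forall m, curl_system U (t m) (B m)).

Lemma psi_scal_harmonic : harmonic U (psi_scal B).
Proof.
have hB m i : harmonic U (B m i) by have [] := sys m.
have -> : psi_scal B = fun x => -1 * B 0 0 x + ((- c) * B 1 2 x + s * B 1 1 x) + ((- c) * B 2 1 x + (- s) * B 2 2 x).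
  by apply/funext => x; rewrite /psi_scal; ring.
exact: (harmonicD oU (harmonicD oU (harmonicZ _ oU (hB 0 0))
    (harmonicD oU (harmonicZ _ oU (hB 1 2)) (harmonicZ _ oU (hB 1 1))))
  (harmonicD oU (harmonicZ _ oU (hB 2 1)) (harmonicZ _ oU (hB 2 2)))).
Qed.

Lemma psi_vec_Cn m n : Cn n U (psi_vec t B m).
Proof.
have ct i : Cn n U (t i) by have [] := sys i.
have cB i j : Cn n U (B i j) by have [] := sys i.
case: (ord3P m) => ->.
- apply: (Cn_eq oU (g := fun x => t 0 x + ((- c) * B 1 1 x + (- s) * B 1 2 x) + (c * B 2 2 x + (- s) * B 2 1 x))).
    by move=> x _; rewrite psi_vecE /=; ring.
  by do !(apply: CnD => //); exact: CnZ.
- apply: (Cn_eq oU (g := fun x => t 1 x + (c * B 0 1 x + s * B 0 2 x) + (-1) * B 2 0 x)).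
    by move=> x _; rewrite psi_vecE /=; ring.
  by do !(apply: CnD => //); exact: CnZ.
- apply: (Cn_eq oU (g := fun x => t 2 x + ((- c) * B 0 2 x + s * B 0 1 x) + B 1 0 x)).
    by move=> x _; rewrite psi_vecE /=; ring.
  by do !(apply: CnD => //); exact: CnZ.
Qed.

Lemma psi_vec_pd m l x : U x -> pd l (psi_vec t B m) x =
  psi_vec (fun m => pd l (t m)) (fun m i => pd l (B m i)) m x.
Proof.
move=> Ux.
have dt i : is_pd l (t i) x (pd l (t i) x) by have [/(_ 1%N) h _ _ _ _] := sys i; exact: Cn_is_pd h Ux.
have dB i j : is_pd l (B i j) x (pd l (B i j) x).
  by have [_ /(_ j 1%N) h _ _ _] := sys i; exact: Cn_is_pd h Ux.
case: (ord3P m) => ->; rewrite [RHS]psi_vecE /=.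
- have /is_pdP[_ <-] := is_pdD (is_pdB (dt 0) (is_pdD (is_pdZ c (dB 1 1)) (is_pdZ s (dB 1 2))))
    (is_pdB (is_pdZ c (dB 2 2)) (is_pdZ s (dB 2 1))).
  by congr (pd l _ x).
- have /is_pdP[_ <-] := is_pdB (is_pdD (dt 1) (is_pdD (is_pdZ c (dB 0 1)) (is_pdZ s (dB 0 2)))) (dB 2 0).
  by congr (pd l _ x).
- have /is_pdP[_ <-] := is_pdD (is_pdB (dt 2) (is_pdB (is_pdZ c (dB 0 2)) (is_pdZ s (dB 0 1)))) (dB 1 0).
  by congr (pd l _ x).
Qed.

Lemma psi_scal_pd l x : U x -> pd l (psi_scal B) x = psi_scal (fun m i => pd l (B m i)) x.
Proof.
move=> Ux.
have dB i j : is_pd l (B i j) x (pd l (B i j) x).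
  by have [_ /(_ j 1%N) h _ _ _] := sys i; exact: Cn_is_pd h Ux.
have /is_pdP[_] := is_pdB (is_pdB (is_pdN (dB 0 0)) (is_pdB (is_pdZ c (dB 1 2)) (is_pdZ s (dB 1 1))))
   (is_pdD (is_pdZ c (dB 2 1)) (is_pdZ s (dB 2 2))).
exact.
Qed.

End OneSystem.

End CurlSystems.

Section Laplace.
Variable R : realType.
Local Notation pt := 'rV[R]_3.
Implicit Types (g h : pt -> R) (x y : pt) (i j l m : 'I_3) (U : set pt) (n : nat).
Variables (c s : R).
Hypothesis cs1 : c ^+ 2 + s ^+ 2 = 1.

(** Pointwise form of psi^D T = 0: psi_i psi_j = - psi_k for cyclic indices, so psi^D (t + psi . B)
    = psi . (grad t - curl B) - div B, and right multiplication by e_m commutes with psi^D. Since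
    the derivatives of T_0 vanish, the equations hold for the vector part alone. *)
Lemma psi_vec_alg (u : 'I_3 -> 'I_3 -> R) (b : 'I_3 -> 'I_3 -> 'I_3 -> R) :
  (forall m, [/\ u m 0 = b m 2 1 - b m 1 2, u m 1 = b m 0 2 - b m 2 0 & u m 2 = b m 1 0 - b m 0 1]) ->
  (forall m, b m 0 0 + b m 1 1 + b m 2 2 = 0) ->
  (forall l, - b 0 0 l - (c * b 1 2 l - s * b 1 1 l) - (c * b 2 1 l + s * b 2 2 l) = 0) ->
  let F0 l := u 0 l - (c * b 1 1 l + s * b 1 2 l) + (c * b 2 2 l - s * b 2 1 l) in
  let F1 l := u 1 l + (c * b 0 1 l + s * b 0 2 l) - b 2 0 l in
  let F2 l := u 2 l - (c * b 0 2 l - s * b 0 1 l) + b 1 0 l in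
  [/\ - F0 0 + (F1 1 - F2 2) * s - (F2 1 + F1 2) * c = 0,
      (F2 2 - F1 1) * c - (F2 1 + F1 2) * s = 0,
      - F2 0 + F0 2 * s + F0 1 * c = 0 &
      F1 0 - F0 2 * c + F0 1 * s = 0].
Proof.
move=> Hu Hd Hs F0 F1 F2.
have K z : c * c * z + s * s * z = z by rewrite -mulrDl -!expr2 cs1 mul1r.
have [u00 u01 u02] := Hu 0; have [u10 u11 u12] := Hu 1; have [u20 u21 u22] := Hu 2.
have Z m : b m 0 0 = - b m 1 1 - b m 2 2 by have := Hd m; lra.
have S0 := Hs 0; have S1 := Hs 1; have S2 := Hs 2.
rewrite /F0 /F1 /F2 u00 u01 u02 u10 u11 u12 u20 u21 u22 {F0 F1 F2 Hu Hd u00 u01 u02 u10 u11 u12 u20 u21 u22}.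
(* The multiples by [c] and [s], like the instances of [K] below, are supplied beforehand: linear
   arithmetic treats products as atoms. *)
have cS1 : c * (- b 0 0 1 - (c * b 1 2 1 - s * b 1 1 1) - (c * b 2 1 1 + s * b 2 2 1)) = 0 by rewrite S1 mulr0.
have sS1 : s * (- b 0 0 1 - (c * b 1 2 1 - s * b 1 1 1) - (c * b 2 1 1 + s * b 2 2 1)) = 0 by rewrite S1 mulr0.
have cS2 : c * (- b 0 0 2 - (c * b 1 2 2 - s * b 1 1 2) - (c * b 2 1 2 + s * b 2 2 2)) = 0 by rewrite S2 mulr0.
have sS2 : s * (- b 0 0 2 - (c * b 1 2 2 - s * b 1 1 2) - (c * b 2 1 2 + s * b 2 2 2)) = 0 by rewrite S2 mulr0.
move: S0; rewrite !Z => S0.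
split.
- have := K (b 0 2 1); have := K (b 0 1 2); clear -c s; lra.
- have := K (b 0 2 2); have := K (b 0 1 1); move: S0; clear -c s; lra.
- have := K (b 1 1 1); have := K (b 1 2 2); have := K (b 2 2 1); have := K (b 2 1 2).
  move: sS1 cS2; clear -c s; lra.
- have := K (b 1 2 1); have := K (b 1 1 2); have := K (b 2 1 1); have := K (b 2 2 2).
  move: cS1 sS2; clear -c s; lra.
Qed.

Lemma laplace_eqs_scale (a : R) (F : 'I_3 -> pt -> R) x (F0 F1 F2 : 'I_3 -> R) :
  (forall l, pd l (F 0) x = a * F0 l) -> (forall l, pd l (F 1) x = a * F1 l) ->
  (forall l, pd l (F 2) x = a * F2 l) ->
  [/\ - F0 0 + (F1 1 - F2 2) * s - (F2 1 + F1 2) * c = 0,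
      (F2 2 - F1 1) * c - (F2 1 + F1 2) * s = 0,
      - F2 0 + F0 2 * s + F0 1 * c = 0 &
      F1 0 - F0 2 * c + F0 1 * s = 0] -> laplace_eqs c s F x.
Proof.
move=> E0 E1 E2 [e0 e1 e2 e3]; have z := mulr0 a.
split.
- by rewrite (E0 0) (E1 1) (E1 2) (E2 1) (E2 2) -z -[in RHS]e0; ring.
- by rewrite (E1 1) (E1 2) (E2 1) (E2 2) -z -[in RHS]e1; ring.
- by rewrite (E2 0) (E0 1) (E0 2) -z -[in RHS]e2; ring.
- by rewrite (E1 0) (E0 1) (E0 2) -z -[in RHS]e3; ring.
Qed.

Lemma psi_vec_laplace U t B (a : R) x : open U -> (forall m, curl_system U (t m) (B m)) ->
  (forall y, U y -> psi_scal c s B y = 0) -> U x ->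
  laplace_eqs c s (fun m y => a * psi_vec c s t B m y) x.
Proof.
move=> oU sys S0 Ux.
have E m l : pd l (fun y => a * psi_vec c s t B m y) x =
    a * psi_vec c s (fun m => pd l (t m)) (fun m i => pd l (B m i)) m x.
  have /is_pdP[_ ->] := is_pdZ a (Cn_is_pd l (psi_vec_Cn c s oU sys m 1) Ux).
  by rewrite (psi_vec_pd c s sys m l Ux).
have dS l : psi_scal c s (fun m i => pd l (B m i)) x = 0.
  rewrite -(psi_scal_pd c s sys l Ux) (pd_local l oU S0 Ux).
  by have /is_pdP[] := is_pd_cst l (0 : R) x.
have curl m : [/\ pd 0 (t m) x = pd 1 (B m 2) x - pd 2 (B m 1) x,
       pd 1 (t m) x = pd 2 (B m 0) x - pd 0 (B m 2) x & pd 2 (t m) x = pd 0 (B m 1) x - pd 1 (B m 0) x].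
  by have [_ _ h _ _] := sys m; exact: h.
have div m : pd 0 (B m 0) x + pd 1 (B m 1) x + pd 2 (B m 2) x = 0.
  by have [_ _ _ h _] := sys m; exact: h.
have := psi_vec_alg (u := fun m l => pd l (t m) x) (b := fun m i l => pd l (B m i) x) curl div dS.
exact: (laplace_eqs_scale (E 0) (E 1) (E 2)).
Qed.

End Laplace.

(** * Functions harmonic on both sides of the boundary *)

Section Liouville.
Variable R : realType.
Local Notation pt := 'rV[R]_3.
Implicit Types (g h : pt -> R) (x y : pt) (U : set pt) (n : nat).
Variables (Omega : set pt) (L : R).
Hypotheses (oO : open Omega) (OL : Omega `<=` box 0 L) (GL : frontier Omega `<=` box 0 L).
Local Notation Gamma := (frontier Omega).
Definition exterior := ~` (Omega `|` Gamma).

Lemma closure_frontier : Omega `|` Gamma = closure Omega.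
Proof.
rewrite frontier_open//; apply/seteqP; split=> x.
  by move=> [Ox|[]//]; exact: subset_closure.
by move=> cx; have [Ox|Ox] := pselect (Omega x); [left|right].
Qed.

Lemma exterior_open : open exterior.
Proof. by rewrite /exterior closure_frontier openC; exact: closed_closure. Qed.

Lemma compact_box_diff U (r : R) : open U -> compact (box 0 r `&` ~` U).
Proof.
move=> oU; apply: (subclosed_compact _ (@box_compact R 0 r)).
  by apply: closedI; [exact: closed_norm_le|rewrite closedC].
by move=> x [].
Qed.

(** The maximum principle on each side: on the closure of Omega the boundary values are 0; outside,
    the domain is cut off by a box so large that |h| < e on its faces. *)
Lemma liouville_le h (e : R) : continuous h -> harmonic Omega h -> harmonic exterior h ->
  (forall x, Gamma x -> h x = 0) -> 0 < e ->
  (exists M : R, forall x, M < enorm x -> `|h x| < e) -> forall x, h x <= e.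
Proof.
move=> ch [c1 h1] [c2 h2] h0 e0 [M hM] x.
have [xE|xE] := pselect (exterior x); last first.
  apply: (@max_principle _ (box 0 L `&` ~` exterior) Omega h e) => //.
  - by apply: compact_box_diff; exact: exterior_open.
  - by move=> y Oy; split; [exact: OL|move=> h3; apply: h3; left].
  - move=> y [_ yE] yO; have [//|yG] := contrapT yE; by rewrite h0// ltW.
  - split=> //; have [//|xG] := contrapT xE; [exact: OL|exact: GL].
pose r := Num.max (Num.max M `|x|) 0 + 1.
have rM : M < r by rewrite /r ltr_pwDr// !le_max lexx.
have rx : `|x| < r by rewrite /r ltr_pwDr// !le_max lexx orbT.
have oV : open (exterior `&` [set y | `|y - 0| < r]).
  by apply: openI; [exact: exterior_open|exact: open_ball_norm].
apply: (@max_principle _ (box 0 r `&` ~` Omega) (exterior `&` [set y | `|y - 0| < r]) h e) => //.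
- exact: compact_box_diff.
- by move=> y [yE /ltW yr]; split=> // yO; apply: yE; left.
- move=> y [yr yO] yV.
  have [yE|yE] := pselect (exterior y); last first.
    by have [//|yG] := contrapT yE; rewrite h0// ltW.
  apply: le_trans (ler_norm _) (ltW (hM y _)); apply: lt_le_trans rM _.
  apply: le_trans (norm_le_enorm y); rewrite leNgt; apply/negP => yr'; apply: yV.
  by split=> //; rewrite /= subr0.
- by apply: Cn_sub c2 => y [].
- by move=> y [/h2].
- by split; [rewrite /box /= subr0 ltW|move=> xO; apply: xE; left].
Qed.

Lemma liouville h : continuous h -> harmonic Omega h -> harmonic exterior h ->
  (forall x, Gamma x -> h x = 0) ->
  (forall e : R, 0 < e -> exists M : R, forall x, M < enorm x -> `|h x| < e) -> forall x, h x = 0.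
Proof.
move=> ch hO hE h0 hi x.
apply/eqP; rewrite eq_le; apply/andP; split.
  apply/ler_addgt0Pr => e e0; rewrite add0r; exact: (liouville_le ch hO hE h0 e0 (hi e e0)).
rewrite -oppr_le0; apply/ler_addgt0Pr => e e0; rewrite add0r.
have ch' : continuous (fun y => -1 * h y) by move=> y; apply: (@continuousM _ _ (fun=> -1)); [exact: cst_continuous|exact: ch].
rewrite -mulN1r; apply: (liouville_le ch' _ _ _ e0).
- exact: harmonicZ.
- by apply: harmonicZ => //; exact: exterior_open.
- by move=> y Gy; rewrite h0// mulr0.
- by have [M hM] := hi e e0; exists M => y /hM; rewrite mulN1r normrN.
Qed.

End Liouville.

Lemma psi_scalE (R : realType) (c s : R) (B : 'I_3 -> 'I_3 -> 'rV[R]_3 -> R) : psi_scal c s B =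
  fun x => -1 * B 0 0 x + ((- c) * B 1 2 x + s * B 1 1 x) + ((- c) * B 2 1 x + (- s) * B 2 2 x).
Proof. by apply/funext => y; rewrite /psi_scal; ring. Qed.

Section Combinations.
Variable R : realType.
Local Notation pt := 'rV[R]_3.
Variables (c s : R) (t w : 'I_3 -> pt -> R) (B : 'I_3 -> 'I_3 -> pt -> R).

Lemma psi_vec_closed (P : (pt -> R) -> Prop) :
  (forall g h, P g -> P h -> P (fun x => g x + h x)) -> (forall a g, P g -> P (fun x => a * g x)) ->
  (forall m, P (t m)) -> (forall m i, P (B m i)) -> forall m, P (psi_vec c s t B m).
Proof.
move=> PD PZ Pt PB m.
have Q g h : P h -> h =1 g -> P g by move=> Ph /funext <-.
case: (ord3P m) => ->.
- apply: Q (PD _ _ (PD _ _ (Pt 0) (PD _ _ (PZ (- c) _ (PB 1 1)) (PZ (- s) _ (PB 1 2)))) (PD _ _ (PZ c _ (PB 2 2)) (PZ (- s) _ (PB 2 1)))) _.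
  by move=> x; rewrite psi_vecE /=; ring.
- apply: Q (PD _ _ (PD _ _ (Pt 1) (PD _ _ (PZ c _ (PB 0 1)) (PZ s _ (PB 0 2)))) (PZ (-1) _ (PB 2 0))) _.
  by move=> x; rewrite psi_vecE /=; ring.
- apply: Q (PD _ _ (PD _ _ (Pt 2) (PD _ _ (PZ (- c) _ (PB 0 2)) (PZ s _ (PB 0 1)))) (PB 1 0)) _.
  by move=> x; rewrite psi_vecE /=; ring.
Qed.

Lemma psi_vec_shift (k : R) m x :
  psi_vec c s (fun m x => t m x - k * w m x) B m x = psi_vec c s t B m x - k * w m x.
Proof. by case: (ord3P m) => ->; rewrite !psi_vecE /=; ring. Qed.

End Combinations.

(** * The decomposition for a real triple *)

Section RealFields.
Variable R : realType.
Local Notation pt := 'rV[R]_3.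
Local Notation P := (@point_of R).
Implicit Types (g h : pt -> R) (x y xi : pt) (i j l m : 'I_3) (U : set pt) (n : nat).
Variables (phi : pt -> R) (Omega : set pt) (L p c s : R) (w : 'I_3 -> pt -> R).
Hypotheses (cphi : C1c 1 phi) (phi0 : forall x, 0 <= phi x)
  (phi1 : forall x, `|x| <= 2^-1 -> phi x = 1) (oO : open Omega)
  (OL : Omega `<=` box 0 L) (GL : frontier Omega `<=` box 0 L) (L0 : 0 <= L) (p3 : 3 < p)
  (cs1 : c ^+ 2 + s ^+ 2 = 1) (cw : forall m, Cn 1 Omega (w m))
  (dr : forall m j, dens p L (grad_density Omega (w m) j)).
Local Notation rho := (fun m => grad_density Omega (w m)).
Local Notation t := (fun m => trp (rho m)).
Local Notation B := (fun m => rotv (rho m)).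
Local Notation c0 := (newton_const phi).

(** The integrand of T_0: [psi_scal] with each [rotp] replaced by its integrand. *)
Definition scalar_integrand x xi : R :=
  let k i := kn i (x - xi) in
  let d m j := grad_density Omega (w m) j xi in
  - (k 1 * d 0 2 - k 2 * d 0 1) - (c * (k 0 * d 1 1 - k 1 * d 1 0) - s * (k 2 * d 1 0 - k 0 * d 1 2))
  - (c * (k 2 * d 2 0 - k 0 * d 2 2) + s * (k 0 * d 2 1 - k 1 * d 2 0)).

Lemma scalar_integrand_itg x :
  itg (scalar_integrand x) /\ psi_scal c s B x = intg (scalar_integrand x).
Proof.
have K i m j : itg (fun xi => kn i (x - xi) * grad_density Omega (w m) j xi).
  exact: (pot_itg i x L0 p3 (dr m j)).
have V i j m : itg (fun xi => kn i (x - xi) * grad_density Omega (w m) j xi - kn j (x - xi) * grad_density Omega (w m) i xi).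
  exact: itgB (K _ _ _) (K _ _ _).
have E i j m : rotp (rho m) i j x = intg (fun xi => kn i (x - xi) * grad_density Omega (w m) j xi - kn j (x - xi) * grad_density Omega (w m) i xi).
  by rewrite (intgB (K _ _ _) (K _ _ _)).
have I1 := itgB (itgZ c (V 0 1 1)) (itgZ s (V 2 0 1)).
have I2 := itgD (itgZ c (V 2 0 2)) (itgZ s (V 0 1 2)).
have I0 := itgN (V 1 2 0).
have eN g v : itg g -> v = intg g -> intg (fun xi => - g xi) = - v by move=> ig ->; exact: intgN.
have eZ (a : R) g v : itg g -> v = intg g -> intg (fun xi => a * g xi) = a * v by move=> ig ->; exact: intgZ.
have eB g h u v : itg g -> itg h -> intg g = u -> intg h = v -> intg (fun xi => g xi - h xi) = u - v.
  by move=> ig ih <- <-; exact: intgB.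
have eD g h u v : itg g -> itg h -> intg g = u -> intg h = v -> intg (fun xi => g xi + h xi) = u + v.
  by move=> ig ih <- <-; exact: intgD.
split; first exact: (itgB (itgB I0 I1) I2).
apply: esym; apply: (eB _ _ _ _ (itgB I0 I1) I2).
  apply: (eB _ _ _ _ I0 I1); first exact: (eN _ _ (V 1 2 0) (E 1 2 0)).
  exact: (eB _ _ _ _ (itgZ c (V 0 1 1)) (itgZ s (V 2 0 1)) (eZ c _ _ (V 0 1 1) (E 0 1 1)) (eZ s _ _ (V 2 0 1) (E 2 0 1))).
exact: (eD _ _ _ _ (itgZ c (V 2 0 2)) (itgZ s (V 0 1 2)) (eZ c _ _ (V 2 0 2) (E 2 0 2)) (eZ s _ _ (V 0 1 2) (E 0 1 2))).
Qed.

Lemma psi_scal_zero (k : R) (H : pt -> R) x : k != 0 ->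
  (forall xi, Omega xi -> H xi = k * scalar_integrand x xi) -> zero_integral3 Omega H ->
  psi_scal c s B x = 0.
Proof.
move=> k0 HE [_ Z]; have [iI ->] := scalar_integrand_itg x.
have mO : measurable (P @^-1` Omega) by exact: msrs_open.
(* [lam] unfolds to the product measure of [zero_integral3], so the hypothesis is reused by
   conversion. *)
have Z' : (\int[@lam R]_(q in P @^-1` Omega) (H (P q))%:E = 0)%E := Z.
have E : (\int[@lam R]_q (k * scalar_integrand x (P q))%:E = 0)%E.
  rewrite -[RHS]Z' [RHS]integral_mkcond; apply: eq_integral => q _.
  rewrite patchE; case: ifPn => [|/negP qO].
    by rewrite inE => /HE ->.
  have nO : ~ Omega (P q) by move=> h; apply: qO; rewrite inE.
  by congr EFin; rewrite /scalar_integrand !(rho_out _ _ nO); ring.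
have [/eqP] := etrans (EFin_intg (itgZ k iI)) E.
by rewrite (intgZ k iI) mulf_eq0 (negPf k0) => /eqP.
Qed.

Hypothesis trace0 : forall x, frontier Omega x -> psi_scal c s B x = 0.

Lemma rotv_continuous m i : continuous (B m i).
Proof. by apply: (rotv_ind (P := fun g => continuous g)) => i' j'; exact: (@rotp_continuous _ _ _ _ _ L0 p3 (dr m)). Qed.

Lemma lt_norm_scale (a e b : R) : `|b| < e / (`|a| + 1) -> `|a * b| < e.
Proof.
have a1 : 0 < `|a| + 1 by rewrite ltr_wpDl.
rewrite normrM ltr_pdivlMr// => h.
by apply: le_lt_trans h; rewrite mulrC ler_wpM2l// lerDl.
Qed.

Definition vanishing g := forall e : R, 0 < e -> exists M : R, forall x, M < enorm x -> `|g x| < e.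

Lemma vanishingZ (a : R) g : vanishing g -> vanishing (fun x => a * g x).
Proof.
move=> vg e e0; have [|M hM] := vg (e / (`|a| + 1)); first by rewrite divr_gt0// ltr_wpDl.
by exists M => x /hM; exact: lt_norm_scale.
Qed.

Lemma vanishingD g h : vanishing g -> vanishing h -> vanishing (fun x => g x + h x).
Proof.
move=> vg vh e e0; have e2 : 0 < e / 2 by rewrite divr_gt0.
have [M hM] := vg _ e2; have [N hN] := vh _ e2.
exists (Num.max M N) => x; rewrite gt_max => /andP[/hM h1 /hN h2].
by apply: le_lt_trans (ler_normD _ _) _; move: h1 h2; lra.
Qed.

Lemma rotv_vanishing m i : vanishing (B m i).
Proof. by apply: (rotv_ind (P := vanishing)) => i' j' e e0; exact: (rotp_infty OL L0 p3 (dr m) i' j' e0). Qed.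

Lemma exterior_system m : curl_system (exterior Omega) (t m) (B m).
Proof.
have p1 : 1 <= p by apply: ltW; apply: lt_trans p3; rewrite ltr1n.
apply: (@curl_system_outer _ L) => //.
- by move=> j; exact: dens_itg L0 p1 (dr m j).
- by move=> j y yL; have [_ h _] := dr m j; exact: h.
- exact: exterior_open.
- by move=> j y yE; apply: rho_out => Oy; apply: yE; left.
Qed.

Lemma psi_scal0 x : psi_scal c s B x = 0.
Proof.
have hO := psi_scal_harmonic c s oO (fun m => curl_system_inner cphi phi1 oO OL L0 p3 (cw m) (dr m)).
have E := psi_scalE c s B.
have cB m i : continuous (B m i) by exact: rotv_continuous.
have cZ (a : R) m i : continuous (fun y => a * B m i y).
  by move=> y; apply: (@continuousM _ _ (fun=> a)); [exact: cst_continuous|exact: cB].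
have cD (g h : pt -> R) : continuous g -> continuous h -> continuous (fun y => g y + h y).
  by move=> cg ch y; apply: continuousD; [exact: cg|exact: ch].
have cS : continuous (psi_scal c s B).
  rewrite E; exact: (cD _ _ (cD _ _ (cZ _ 0 0) (cD _ _ (cZ _ 1 2) (cZ _ 1 1))) (cD _ _ (cZ _ 2 1) (cZ _ 2 2))).
have vZ (a : R) m i : vanishing (fun y => a * B m i y) by apply: vanishingZ; exact: rotv_vanishing.
have vS : vanishing (psi_scal c s B).
  rewrite E; exact: (vanishingD (vanishingD (vZ _ 0 0) (vanishingD (vZ _ 1 2) (vZ _ 1 1))) (vanishingD (vZ _ 2 1) (vZ _ 2 2))).
exact: (liouville oO OL GL cS hO (psi_scal_harmonic c s (exterior_open oO) exterior_system) trace0 vS).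
Qed.

Definition field_out m x : R := c0^-1 * psi_vec c s t B m x.
Definition field_in m x : R := w m x - field_out m x.

Lemma field_out_Cn m n : Cn n (exterior Omega) (field_out m).
Proof.
by apply: CnZ; [exact: exterior_open|exact: (psi_vec_Cn c s (exterior_open oO) exterior_system)].
Qed.

Lemma field_out_laplace x : exterior Omega x -> laplace_eqs c s field_out x.
Proof.
move=> Ux.
exact: (psi_vec_laplace cs1 c0^-1 (exterior_open oO) exterior_system (fun y _ => psi_scal0 y) Ux).
Qed.

Lemma field_out_continuous m : continuous (field_out m).
Proof.
have cZ (a : R) g : continuous g -> continuous (fun y => a * g y).
  by move=> cg y; apply: (@continuousM _ _ (fun=> a)); [exact: cst_continuous|exact: cg].
apply: (cZ _ _); apply: (@psi_vec_closed _ c s t B (fun g => continuous g)).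
- by move=> g h cg ch y; apply: continuousD; [exact: cg|exact: ch].
- exact: cZ.
- by move=> m'; exact: (@trp_continuous _ _ _ _ _ L0 p3 (dr m')).
- exact: rotv_continuous.
Qed.

Lemma field_out_vanishing m : vanishing (field_out m).
Proof.
apply: vanishingZ; apply: (@psi_vec_closed _ c s t B vanishing).
- exact: vanishingD.
- exact: vanishingZ.
- by move=> m' e e0; exact: (trp_infty OL L0 p3 (dr m') e0).
- exact: rotv_vanishing.
Qed.

Lemma field_split m x : w m x = field_in m x + field_out m x.
Proof. exact/esym/subrK. Qed.

(** Brings [field_in], defined as a difference to make the splitting immediate, into the form to
    which the inner curl systems apply. This is where [newton_const] must be nonzero. *)
Lemma field_inE : field_in = fun m x => (- c0^-1) * psi_vec c s (fun m x => t m x - c0 * w m x) B m x.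
Proof.
have c00 : c0 != 0 by rewrite lt0r_neq0// (newton_const_gt0 cphi phi0 phi1).
apply/funext => m; apply/funext => x; rewrite psi_vec_shift /field_in /field_out.
by rewrite mulNr mulrBr opprB mulKf.
Qed.

Lemma field_in_Cn m n : Cn n Omega (field_in m).
Proof.
rewrite field_inE; apply: CnZ => //.
exact: (psi_vec_Cn c s oO (fun m => curl_system_inner cphi phi1 oO OL L0 p3 (cw m) (dr m))).
Qed.

Lemma field_in_laplace x : Omega x -> laplace_eqs c s field_in x.
Proof.
move=> Ux; rewrite field_inE.
exact: (psi_vec_laplace cs1 (- c0^-1) oO (fun m => curl_system_inner cphi phi1 oO OL L0 p3 (cw m) (dr m))
  (fun y _ => psi_scal0 y) Ux).
Qed.

End RealFields.

(** * Reduction to real fields *)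

Section Quaternions.
Local Open Scope complex_scope.
Local Open Scope ring_scope.
Variable R : realType.
Local Notation pt := 'rV[R]_3.
Local Notation C3 := 'rV[R[i]]_3.
Implicit Types (x y xi : pt) (F : pt -> C3) (theta : R).

Lemma psi1E theta : qi * qexp theta * qj = Quat 0 0 (- sin theta)%:C (cos theta)%:C.
Proof.
rewrite /qexp; congr Quat; apply/eqP; rewrite eq_complex /=; apply/andP; split; apply/eqP; ring.
Qed.

Lemma psi2E theta : qexp theta * qj = Quat 0 0 (cos theta)%:C (sin theta)%:C.
Proof.
rewrite /qexp; congr Quat; apply/eqP; rewrite eq_complex /=; apply/andP; split; apply/eqP; ring.
Qed.

Lemma vec_to_quatE (v : C3) : vec_to_quat v = Quat 0 (v 0 0) (v 0 1) (v 0 2).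
Proof. by rewrite /vec_to_quat; congr Quat => /=; ring. Qed.

Lemma pdH_vec l F x : pdH l (fun y => vec_to_quat (F y)) x =
  Quat 0 (pdC l (fun y => F y 0 0) x) (pdC l (fun y => F y 0 1) x) (pdC l (fun y => F y 0 2) x).
Proof.
have -> : (fun y => vec_to_quat (F y)) = fun y => Quat 0 (F y 0 0) (F y 0 1) (F y 0 2).
  by apply/funext => y; exact: vec_to_quatE.
rewrite /pdH /=; congr Quat; rewrite /pdC /=.
by have /is_pdP[_ ->] := is_pd_cst l (0 : R) x.
Qed.

Lemma psi_mul_alg theta (a b : 'I_3 -> 'I_3 -> R) :
  let c := cos theta in let s := sin theta in
  let E (d : 'I_3 -> 'I_3 -> R) := [/\ - d 0 0 + (d 1 1 - d 2 2) * s - (d 2 1 + d 1 2) * c = 0,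
      (d 2 2 - d 1 1) * c - (d 2 1 + d 1 2) * s = 0,
      - d 2 0 + d 0 2 * s + d 0 1 * c = 0 &
      d 1 0 - d 0 2 * c + d 0 1 * s = 0] in
  let D l := Quat 0 (a 0 l +i* b 0 l) (a 1 l +i* b 1 l) (a 2 l +i* b 2 l) in
  E a -> E b -> qi * D 0 + qi * qexp theta * qj * D 1 + qexp theta * qj * D 2 = 0.
Proof.
move=> c s E D [a0 a1 a2 a3] [b0 b1 b2 b3]; rewrite psi1E psi2E -/c -/s.
congr Quat; apply/eqP; rewrite eq_complex /=; apply/andP; split; apply/eqP.
- by rewrite -[RHS]a0; ring.
- by rewrite -[RHS]b0; ring.
- by rewrite -[RHS]a1; ring.
- by rewrite -[RHS]b1; ring.
- by rewrite -[RHS]a2; ring.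
- by rewrite -[RHS]b2; ring.
- by rewrite -[RHS]a3; ring.
- by rewrite -[RHS]b3; ring.
Qed.

Lemma psiD_eq0 theta F x : laplace_eqs (cos theta) (sin theta) (Re_comp F) x ->
  laplace_eqs (cos theta) (sin theta) (Im_comp F) x ->
  psiD theta (fun y => vec_to_quat (F y)) x = 0.
Proof.
move=> eR eI; rewrite /psiD !pdH_vec.
exact: (psi_mul_alg (a := fun m l => pd l (Re_comp F m) x) (b := fun m l => pd l (Im_comp F m) x) eR eI).
Qed.

Lemma psi_kernelE theta y : let K := - (4 * pi)^-1 / enorm y ^+ 3 in
  psi_kernel theta y = Quat 0 (K * y 0 0)%:C (K * (cos theta * y 0 2 - sin theta * y 0 1))%:C
    (K * (cos theta * y 0 1 + sin theta * y 0 2))%:C.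
Proof.
move=> K; rewrite /psi_kernel -/K /psi_var psi1E psi2E.
congr Quat; apply/eqP; rewrite eq_complex /=; apply/andP; split; apply/eqP; ring.
Qed.

Lemma bilin_kernel_alg (K c s : R) (y : 'I_3 -> R) (v : C3) (h : R[i]) :
  h = bilin (vec_part (Quat 0 (K * y 0)%:C (K * (c * y 2 - s * y 1))%:C (K * (c * y 1 + s * y 2))%:C)) v ->
  complex.Re h = K * (y 0 * complex.Re (v 0 0) + (c * y 2 - s * y 1) * complex.Re (v 0 1) + (c * y 1 + s * y 2) * complex.Re (v 0 2)) /\
  complex.Im h = K * (y 0 * complex.Im (v 0 0) + (c * y 2 - s * y 1) * complex.Im (v 0 1) + (c * y 1 + s * y 2) * complex.Im (v 0 2)).
Proof.
move=> ->; rewrite /bilin sum3 !mxE /=.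
case: (v 0 0) (v 0 1) (v 0 2) => [a0 b0] [a1 b1] [a2 b2] /=.
by split; ring.
Qed.

Lemma V_field_alg (c s : R) (a b : 'I_3 -> 'I_3 -> R) (v : C3) :
  let d k l := a k l +i* b k l in
  v = \row_k [:: (d 2 2 - d 1 1) * c%:C - (d 2 1 + d 1 2) * s%:C;
             - d 2 0 + d 0 2 * s%:C + d 0 1 * c%:C;
             d 1 0 - d 0 2 * c%:C + d 0 1 * s%:C]`_k ->
  forall P : R[i] -> R, forall e : 'I_3 -> 'I_3 -> R,
  (P = @complex.Re R /\ e = a) \/ (P = @complex.Im R /\ e = b) ->
  [/\ P (v 0 0) = (e 2 2 - e 1 1) * c - (e 2 1 + e 1 2) * s,
      P (v 0 1) = - e 2 0 + e 0 2 * s + e 0 1 * c &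
      P (v 0 2) = e 1 0 - e 0 2 * c + e 0 1 * s].
Proof.
move=> d -> P e [[-> ->]|[-> ->]]; split; rewrite mxE /=; ring.
Qed.

(** The relation c^2 + s^2 = 1 enters only in the terms with [e 0 1] and [e 0 2], where the last two
    components of the kernel combine to y 2 and - y 1. *)
Lemma integrand_alg (K c s : R) (k y : 'I_3 -> R) (E : R) (e : 'I_3 -> 'I_3 -> R) :
  c ^+ 2 + s ^+ 2 = 1 -> (forall i, k i = y i / E) ->
  K / E * (y 0 * ((e 2 2 - e 1 1) * c - (e 2 1 + e 1 2) * s) +
    (c * y 2 - s * y 1) * (- e 2 0 + e 0 2 * s + e 0 1 * c) +
    (c * y 1 + s * y 2) * (e 1 0 - e 0 2 * c + e 0 1 * s)) =
  K * (- (k 1 * e 0 2 - k 2 * e 0 1) - (c * (k 0 * e 1 1 - k 1 * e 1 0) - s * (k 2 * e 1 0 - k 0 * e 1 2))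
  - (c * (k 2 * e 2 0 - k 0 * e 2 2) + s * (k 0 * e 2 1 - k 1 * e 2 0))).
Proof.
move=> cs1 kE; rewrite !kE; move: (E^-1) => u.
have H z : z = (c ^+ 2 + s ^+ 2) * z by rewrite cs1 mul1r.
rewrite [y 1 * u * e 0 2]H [y 2 * u * e 0 1]H; ring.
Qed.

(** Turns the hypothesis on V into boundary values of T_0. The comparison is made on Omega, where
    [grad_density] is the actual gradient. *)
Lemma kernel_integrand (Omega : set pt) theta (fw : pt -> C3) x xi : Omega xi ->
  let h := bilin (vec_part (psi_kernel theta (x - xi))) (V_field theta fw xi) in
  let c := cos theta in let s := sin theta in
  complex.Re h = - (4 * pi)^-1 * scalar_integrand Omega c s (Re_comp fw) x xi /\
  complex.Im h = - (4 * pi)^-1 * scalar_integrand Omega c s (Im_comp fw) x xi.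
Proof.
move=> Oxi h c s; set y := x - xi.
have [hR hI] := bilin_kernel_alg (congr1 (fun q => bilin (vec_part q) (V_field theta fw xi)) (psi_kernelE theta y)).
have VE := V_field_alg (a := fun m l => pd l (Re_comp fw m) xi) (b := fun m l => pd l (Im_comp fw m) xi)
  (erefl (V_field theta fw xi)).
have cs1 : c ^+ 2 + s ^+ 2 = 1 by exact: cos2Dsin2.
have kE i : kn i y = y 0 i / enorm y ^+ 3 by [].
split.
- have [v0 v1 v2] := VE _ _ (or_introl (conj erefl erefl)).
  apply: etrans hR _; rewrite v0 v1 v2.
  apply: etrans (integrand_alg (- (4 * pi)^-1) (fun m l => pd l (Re_comp fw m) xi) cs1 kE) _.
  have D m l : pd l (Re_comp fw m) xi = grad_density Omega (Re_comp fw m) l xi by rewrite rho_in.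
  by rewrite !D.
- have [v0 v1 v2] := VE _ _ (or_intror (conj erefl erefl)).
  apply: etrans hI _; rewrite v0 v1 v2.
  apply: etrans (integrand_alg (- (4 * pi)^-1) (fun m l => pd l (Im_comp fw m) xi) cs1 kE) _.
  have D m l : pd l (Im_comp fw m) xi = grad_density Omega (Im_comp fw m) l xi by rewrite rho_in.
  by rewrite !D.
Qed.

End Quaternions.

Section Components.
Local Open Scope complex_scope.
Local Open Scope ring_scope.
Variable R : realType.
Local Notation pt := 'rV[R]_3.
Local Notation C3 := 'rV[R[i]]_3.
Implicit Types (x y t : pt) (v : C3) (e : R).

Lemma within_continuous_norm (E : set pt) (g : pt -> R) :
  (forall x, E x -> forall e, 0 < e -> exists2 r : R, 0 < r & forall y, E y -> `|y - x| < r -> `|g y - g x| < e) ->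
  {within E, continuous g}.
Proof.
move=> H; apply/subspace_continuousP => x Ex; apply/cvgrPdist_lt => e e0.
have [r r0 Hr] := H x Ex e e0; apply/nbhs_normP; exists r => // y yx Ey.
by rewrite distrC; exact: Hr.
Qed.

Lemma powR_small (C mu e : R) : 0 <= C -> 0 < mu -> 0 < e ->
  exists2 r : R, 0 < r & forall d, 0 <= d -> d < r -> C * d `^ mu < e.
Proof.
move=> C0 mu0 e0; have C1 : 0 < C + 1 by rewrite ltr_wpDl.
have q0 : 0 < e / (C + 1) by rewrite divr_gt0.
exists ((e / (C + 1)) `^ mu^-1) => [|d d0 dr]; first exact: powR_gt0.
have h : d `^ mu < e / (C + 1).
  have E : e / (C + 1) = ((e / (C + 1)) `^ mu^-1) `^ mu by rewrite -powRrM mulVf ?lt0r_neq0// powRr1// ltW.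
  rewrite [ltRHS]E.
  by apply: gt0_ltr_powR => //; rewrite nnegrE ?powR_ge0.
rewrite ltr_pdivlMr// in h; apply: le_lt_trans h.
by rewrite mulrC ler_wpM2l ?powR_ge0// lerDl.
Qed.

Lemma Re_le_cnorm v k : `|complex.Re (v 0 k)| <= cnorm v.
Proof.
rewrite -sqrtr_sqr /cnorm ler_sqrt; last by apply: sumr_ge0 => i _; rewrite addr_ge0 ?sqr_ge0.
rewrite (bigD1 k)//= -addrA lerDl addr_ge0 ?sqr_ge0//.
by apply: sumr_ge0 => i _; rewrite addr_ge0 ?sqr_ge0.
Qed.

Lemma Im_le_cnorm v k : `|complex.Im (v 0 k)| <= cnorm v.
Proof.
rewrite -sqrtr_sqr /cnorm ler_sqrt; last by apply: sumr_ge0 => i _; rewrite addr_ge0 ?sqr_ge0.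
rewrite (bigD1 k)//= (addrC (_ ^+ 2)) -addrA lerDl addr_ge0 ?sqr_ge0//.
by apply: sumr_ge0 => i _; rewrite addr_ge0 ?sqr_ge0.
Qed.

Lemma cnorm_lt v e : 0 < e -> (forall k, `|complex.Re (v 0 k)| < e / 6 /\ `|complex.Im (v 0 k)| < e / 6) -> cnorm v < e.
Proof.
move=> e0 H; rewrite -[ltRHS]gtr0_norm// -sqrtr_sqr /cnorm ltr_sqrt ?exprn_gt0//.
have S k : complex.Re (v 0 k) ^+ 2 + complex.Im (v 0 k) ^+ 2 <= 2 * (e / 6) ^+ 2.
  have [h1 h2] := H k; rewrite mulr_natl mulr2n.
  apply: lerD; rewrite -[leLHS]real_normK ?num_real//; apply: lerXn2r; rewrite ?nnegrE ?divr_ge0 ?(ltW e0)//; exact: ltW.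
rewrite sum3; have := S 0; have := S 1; have := S 2.
have -> : (e / 6) ^+ 2 = e ^+ 2 / 36 by rewrite expr_div_n; congr (_ / _); ring.
have := exprn_gt0 2 e0; move: (e ^+ 2) (_ + _) (_ + _) (_ + _) => E a b d; lra.
Qed.

(** Lets every statement about a component be proved once for real and imaginary parts. *)
Definition part (Pi : R[i] -> R) := Pi = @complex.Re R \/ Pi = @complex.Im R.

Lemma part_add Pi : part Pi -> {morph Pi : x y / x + y}.
Proof. by move=> [->|->] [? ?] [? ?]. Qed.

Lemma part_sub Pi : part Pi -> {morph Pi : x y / x - y}.
Proof. by move=> [->|->] [? ?] [? ?]. Qed.

Lemma part_scale Pi (a : R) z : part Pi -> Pi (a%:C * z) = a * Pi z.
Proof. by move=> [->|->]; case: z => u v /=; ring. Qed.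

Lemma part0 Pi : part Pi -> Pi 0 = 0.
Proof. by move=> [->|->]. Qed.

Lemma part_le_cnorm Pi v k : part Pi -> `|Pi (v 0 k)| <= cnorm v.
Proof. by move=> [->|->]; [exact: Re_le_cnorm|exact: Im_le_cnorm]. Qed.

(** A finite dimension gives the midpoint of M and 3 mu; the value minus infinity is covered by s =
    0. *)
Lemma minkowski_exponent (M : \bar R) (mu : R) : 0 < mu -> ((3^-1)%:E * M < mu%:E)%E ->
  exists s : R, (M < s%:E)%E /\ s < 3 * mu.
Proof.
move=> mu0; case: M => [r| |].
- rewrite -EFinM lte_fin => h; exists ((r + 3 * mu) / 2); rewrite lte_fin; split; lra.
- by rewrite gt0_muley ?lte_fin ?invr_gt0// => /ltW; rewrite leye_eq.
- by move=> _; exists 0; rewrite ltNyr mulr_gt0.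
Qed.

End Components.

(** * Components of the truncated Whitney extension *)

Section Extended.
Local Open Scope complex_scope.
Local Open Scope ring_scope.
Variable R : realType.
Local Notation pt := 'rV[R]_3.
Local Notation C3 := 'rV[R[i]]_3.
Implicit Types (x y t : pt) (e : R).
Variables (Omega : set pt) (p : dcube -> pt) (L : R) (phi : pt -> R) (f : pt -> C3) (eps mu s : R).
Hypotheses (oO : open Omega) (OL : Omega `<=` box 0 L) (cG : compact (frontier Omega))
  (GL : frontier Omega `<=` box 0 L) (L0 : 0 <= L) (np : nearest_points Omega (frontier Omega) p)
  (heps : 0 < eps < 4^-1) (hphi : whitney_bump eps phi) (mu01 : 0 < mu <= 1)
  (hf : LipV mu (frontier Omega) f)
  (ms : (minkowski_dim (frontier Omega) < s%:E)%E) (s3 : s < 3 * mu).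
Local Notation Gamma := (frontier Omega).
Local Notation fw := (truncated_ext Omega Gamma phi p f).

Lemma whitney_bump_ge0 x : 0 <= phi x.
Proof. by have [_ /(_ x)/andP[]] := hphi. Qed.

Lemma whitney_bump_eq1 x : `|x| <= 2^-1 -> phi x = 1.
Proof.
have [_ _ h _] := hphi; move=> hx; apply: h => k.
exact: le_trans (coord_le_norm x k) hx.
Qed.

Lemma whitney_bump_support x : phi x != 0 -> `|x| <= 5 / 8.
Proof.
have [_ _ _ h] := hphi => h0; apply/norm_rVleP => [|k]; first by rewrite divr_ge0.
have [H|/h/eqP] := pselect (forall k, `|x 0 k| <= (1 + eps) / 2); last by rewrite (negPf h0).
by apply: le_trans (H k) _; move: heps; lra.
Qed.

Lemma whitney_bump_C1c : C1c 1 phi.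
Proof.
have [h _ _ _] := hphi; split=> [|x xL]; first exact: h.
apply/eqP/negPn/negP => /whitney_bump_support hx; apply: xL; rewrite /box /= subr0; lra.
Qed.

Variable Pi : R[i] -> R.
Hypothesis hPi : part Pi.
Local Notation w := (fun k x => Pi (fw x 0 k)).
Local Notation a := (fun k t => Pi (f t 0 k)).

Lemma trunc_frontier x : Gamma x -> fw x = f x.
Proof.
by move=> Gx; rewrite /truncated_ext /whitney_op !asboolT//; right.
Qed.

(** The projection is exchanged with a finite sum, after both sums over all Whitney cubes have been
    rewritten over the list of [ext_chart]. *)
Lemma part_trunc k x : Omega x -> w k x = ext Omega p phi (a k) x.
Proof.
move=> Ox; have nG : ~ Gamma x by move=> Gx; exact: (frontier_disjoint oO Gx Ox).
rewrite /truncated_ext asboolT; last by left.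
rewrite /whitney_op asboolF//.
have [Q0 hQ0 Qx] := whitney_cover oO Ox.
have [N [K [_ H]]] := ext_chart oO OL GL L0 np whitney_bump_ge0 whitney_bump_eq1 whitney_bump_support.
have [S [_ _ _ SE]] := H x Q0 hQ0 Qx.
have xx : `|x - x| <= side R Q0 / 8 by rewrite subrr normr0 divr_ge0 ?(ltW (side_gt0 _ _)).
have [_ _ fs _] := SE x xx.
rewrite fs; last by move=> Q b0; rewrite /partition_fun b0 mul0r scale0r.
rewrite /ext fs; last by move=> Q b0; rewrite /partition_fun b0 !mul0r.
rewrite summxE (big_morph Pi (part_add hPi) (part0 hPi)).
by apply: eq_bigr => Q _; rewrite mxE part_scale.
Qed.

Lemma part_holder : exists2 A : R, 0 <= A & forall k t t', Gamma t -> Gamma t' ->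
  `|a k t - a k t'| <= A * `|t - t'| `^ mu.
Proof.
have [c hc] := hf; have /andP[mu0 _] := mu01.
exists (`|c| * 2 `^ mu) => [|k t t' Gt Gt']; first by rewrite mulr_ge0// powR_ge0.
rewrite -part_sub//.
have -> : f t 0 k - f t' 0 k = (f t - f t') 0 k by rewrite !mxE.
apply: le_trans (part_le_cnorm _ _ hPi) _; apply: le_trans (hc t t' Gt Gt') _.
apply: (@le_trans _ _ (`|c| * enorm (t - t') `^ mu)).
  by rewrite ler_wpM2r ?powR_ge0// ler_norm.
rewrite -mulrA -powRM// ler_wpM2l//; apply: ge0_ler_powR; rewrite ?nnegrE ?enorm_ge0 ?mulr_ge0 ?(ltW mu0)//.
exact: enorm_le_norm.
Qed.

Lemma part_C1 k : Cn 1 Omega (w k).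
Proof.
apply: (Cn_eq oO (g := ext Omega p phi (a k))) => [x Ox|]; first by rewrite part_trunc.
exact: (ext_C1 oO OL GL L0 np whitney_bump_C1c whitney_bump_ge0 whitney_bump_eq1 whitney_bump_support).
Qed.

Lemma part_dens k j : dens (3 + (3 * mu - s)) L (grad_density Omega (w k) j).
Proof.
have [A A0 hA] := part_holder.
have -> : grad_density Omega (w k) j = grad_density Omega (ext Omega p phi (a k)) j.
  apply/funext => x; have [Ox|Ox] := pselect (Omega x); last by rewrite !rho_out.
  by rewrite !rho_in//; apply: (pd_local j oO _ Ox) => y; exact: part_trunc.
exact: (ext_dens oO OL cG GL L0 np whitney_bump_C1c whitney_bump_ge0 whitney_bump_eq1 whitney_bump_support mu01 A0 (hA k) ms s3).
Qed.

Lemma part_within k : {within Omega `|` Gamma, continuous (w k)}.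
Proof.
have [A A0 hA] := part_holder; have /andP[mu0 _] := mu01.
have [C C0 hC] := ext_boundary oO OL GL L0 np whitney_bump_ge0 whitney_bump_eq1 whitney_bump_support mu0 A0 (hA k).
apply: within_continuous_norm => x [Ox|Gx] e e0.
  have /cont_normP/(_ e e0)[r r0 H] := (part_C1 k).1 x Ox.
  by exists r => // y _; exact: H.
(* [C] controls the approach to x from inside Omega, [A] the approach along Gamma. *)
have [r r0 H] := powR_small (addr_ge0 A0 C0) mu0 e0.
exists r => // y Ey yx; apply: le_lt_trans (H _ (normr_ge0 _) yx).
rewrite (trunc_frontier Gx) mulrDl; case: Ey => [Oy|Gy].
  by rewrite part_trunc//; apply: le_trans (hC y x Oy Gx) _; rewrite lerDr mulr_ge0// powR_ge0.
by rewrite (trunc_frontier Gy); apply: le_trans (hA k y x Gy Gx) _; rewrite lerDl mulr_ge0// powR_ge0.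
Qed.

End Extended.

Lemma jordan_box (R : realType) (Omega : set 'rV[R]_3) : jordan_domain Omega ->
  exists L : R, [/\ 0 <= L, Omega `<=` box 0 L & frontier Omega `<=` box 0 L].
Proof.
move=> [bO _ _ cG _].
have [M [_ HM]] := bO; have [N [_ HN]] := compact_bounded cG.
have M1 : M < `|M| + `|N| + 1 by have := ler_norm M; have := normr_ge0 N; lra.
have N1 : N < `|M| + `|N| + 1 by have := ler_norm N; have := normr_ge0 M; lra.
exists (`|M| + `|N| + 1); split; first by rewrite !addr_ge0.
  by move=> x Ox; rewrite /box /= subr0; exact: HM M1 x Ox.
by move=> x Gx; rewrite /box /= subr0; exact: HN N1 x Gx.
Qed.

Lemma within_continuousB (R : realType) (E : set 'rV[R]_3) (g h : 'rV[R]_3 -> R) :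
  {within E, continuous g} -> continuous h -> {within E, continuous (fun x => g x - h x)}.
Proof.
move=> cg ch x; have ch' := @continuous_subspaceT _ _ E h ch.
exact: (@continuousB R R (subspace E) g h x (cg x) (ch' x)).
Qed.

Section ComplexFields.
Variable R : realType.
Local Notation pt := 'rV[R]_3.
Local Notation C3 := 'rV[R[i]%C]_3.
Variables (u v : 'I_3 -> pt -> R).

Definition complex_field (x : pt) : C3 := \row_k (u k x +i* v k x)%C.

Lemma Re_complex_field k : Re_comp complex_field k = u k.
Proof. by apply/funext => x; rewrite /Re_comp mxE. Qed.

Lemma Im_complex_field k : Im_comp complex_field k = v k.
Proof. by apply/funext => x; rewrite /Im_comp mxE. Qed.

Lemma Re_complex_fieldE : Re_comp complex_field = u.
Proof. by apply/funext => k; exact: Re_complex_field. Qed.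

Lemma Im_complex_fieldE : Im_comp complex_field = v.
Proof. by apply/funext => k; exact: Im_complex_field. Qed.

Lemma complex_field_extension theta (U Gamma : set pt) :
  (forall k n, Cn n U (u k)) -> (forall k n, Cn n U (v k)) ->
  (forall x, U x -> laplace_eqs (cos theta) (sin theta) u x) ->
  (forall x, U x -> laplace_eqs (cos theta) (sin theta) v x) ->
  (forall k, {within U `|` Gamma, continuous (u k)}) ->
  (forall k, {within U `|` Gamma, continuous (v k)}) ->
  laplacian_extension theta U Gamma complex_field complex_field.
Proof.
move=> cu cv eu ev wu wv; split=> //.
  split=> [n k|x Ux]; first by rewrite Re_complex_field Im_complex_field.
  by apply: psiD_eq0; rewrite ?Re_complex_fieldE ?Im_complex_fieldE; [exact: eu|exact: ev].
by move=> k; rewrite Re_complex_field Im_complex_field.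
Qed.

Lemma complex_field_vanishing (U : set pt) : (forall k, vanishing (u k)) -> (forall k, vanishing (v k)) ->
  vanishes_at_infinity U complex_field.
Proof.
move=> vu vv e e0; have e6 : 0 < e / 6 by rewrite divr_gt0.
have H k : exists M : R, forall x, M < enorm x -> `|u k x| < e / 6 /\ `|v k x| < e / 6.
  have [M hM] := vu k _ e6; have [N hN] := vv k _ e6.
  by exists (Num.max M N) => x; rewrite gt_max => /andP[/hM ? /hN].
have /choice[M hM] := H.
exists (Num.max (M 0) (Num.max (M 1) (M 2))) => x _.
rewrite !gt_max => /and3P[m0 m1 m2]; apply: cnorm_lt => // k; rewrite !mxE.
by case: (ord3P k) => ->; exact: hM.
Qed.

End ComplexFields.

Lemma complex_field_sum (R : realType) (F : 'rV[R]_3 -> 'rV[R[i]%C]_3) (u v u' v' : 'I_3 -> 'rV[R]_3 -> R) t :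
  (forall k, Re_comp F k t = u k t + u' k t) -> (forall k, Im_comp F k t = v k t + v' k t) ->
  F t = complex_field u v t + complex_field u' v' t.
Proof.
move=> hu hv; apply/rowP => k; rewrite !mxE.
by apply/eqP; rewrite eq_complex /= -hu -hv !eqxx.
Qed.

Theorem theorem4p1 (R : realType) (Omega Gamma : set 'rV[R]_3)
    (theta mu eps : R) (phi : 'rV[R]_3 -> R) (p : dcube -> 'rV[R]_3)
    (f fw : 'rV[R]_3 -> 'rV[complex R]_3)
    (hOmega : jordan_domain Omega)
    (hGamma : Gamma = frontier Omega)
    (hfractal : fractal Gamma)
    (htheta : 0 <= theta < 2 * pi)
    (hmu : 0 < mu <= 1)
    (hdim : ((3^-1)%:E * minkowski_dim Gamma < mu%:E)%E)
    (hf : LipV mu Gamma f)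
    (heps : 0 < eps < 4^-1)
    (hphi : whitney_bump eps phi)
    (hp : nearest_points Omega Gamma p)
    (hfw : fw = truncated_ext Omega Gamma phi p f)
    (hV : exists2 g : 'rV[R]_3 -> 'rV[complex R]_3,
        Mstar theta mu Omega Gamma g &
        forall x, Omega x -> g x = V_field theta fw x) :
  exists fplus fminus : 'rV[R]_3 -> 'rV[complex R]_3,
    (forall t, Gamma t -> f t = fplus t + fminus t) /\
    (exists Fplus : 'rV[R]_3 -> 'rV[complex R]_3,
       laplacian_extension theta Omega Gamma fplus Fplus) /\
    (exists Fminus : 'rV[R]_3 -> 'rV[complex R]_3,
       laplacian_extension theta (~` (Omega `|` Gamma)) Gamma fminus Fminus /\
       vanishes_at_infinity (~` (Omega `|` Gamma)) Fminus).
Proof.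
subst Gamma fw; have [L [L0 OL GL]] := jordan_box hOmega.
have [_ _ oO cG _] := hOmega; have /andP[mu0 _] := hmu.
have [s [ms s3]] := minkowski_exponent mu0 hdim.
set fw := truncated_ext _ _ _ _ _ in hV *.
have p3 : 3 < 3 + (3 * mu - s) by rewrite ltrDl subr_gt0.
have cs1 := cos2Dsin2 theta.
have cphi := whitney_bump_C1c heps hphi; have phi0 := whitney_bump_ge0 hphi; have phi1 := whitney_bump_eq1 hphi.
have hR : part (@complex.Re R) by left.
have hI : part (@complex.Im R) by right.
have cR k : Cn 1 Omega (Re_comp fw k) := part_C1 f oO OL GL L0 hp heps hphi hR k.
have dR k j : dens _ L (grad_density Omega (Re_comp fw k) j) :=
  part_dens oO OL cG GL L0 hp heps hphi hmu hf ms s3 hR k j.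
have wR k : {within Omega `|` frontier Omega, continuous (Re_comp fw k)} :=
  @part_within _ _ _ _ _ _ _ _ oO OL GL L0 hp heps hphi hmu hf _ hR k.
have cI k : Cn 1 Omega (Im_comp fw k) := part_C1 f oO OL GL L0 hp heps hphi hI k.
have dI k j : dens _ L (grad_density Omega (Im_comp fw k) j) :=
  part_dens oO OL cG GL L0 hp heps hphi hmu hf ms s3 hI k j.
have wI k : {within Omega `|` frontier Omega, continuous (Im_comp fw k)} :=
  @part_within _ _ _ _ _ _ _ _ oO OL GL L0 hp heps hphi hmu hf _ hI k.
have k0 : - (4 * pi)^-1 != 0 :> R by rewrite oppr_eq0 invr_eq0 mulf_neq0// lt0r_neq0// pi_gt0.
(* [g] is tied to V on Omega alone, and the integrals over Omega see only these values. *)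
have [g [_ _ gZ] gV] := hV.
have tR x : frontier Omega x -> psi_scal (cos theta) (sin theta)
    (fun m => rotv (grad_density Omega (Re_comp fw m))) x = 0.
  move=> /gZ[ZR _]; apply: (psi_scal_zero oO L0 p3 dR k0 _ ZR) => xi Oxi.
  by rewrite (gV xi Oxi); exact: (kernel_integrand theta fw x Oxi).1.
have tI x : frontier Omega x -> psi_scal (cos theta) (sin theta)
    (fun m => rotv (grad_density Omega (Im_comp fw m))) x = 0.
  move=> /gZ[_ ZI]; apply: (psi_scal_zero oO L0 p3 dI k0 _ ZI) => xi Oxi.
  by rewrite (gV xi Oxi); exact: (kernel_integrand theta fw x Oxi).2.
pose outR := field_out phi Omega (cos theta) (sin theta) (Re_comp fw).
pose outI := field_out phi Omega (cos theta) (sin theta) (Im_comp fw).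
pose inR := field_in phi Omega (cos theta) (sin theta) (Re_comp fw).
pose inI := field_in phi Omega (cos theta) (sin theta) (Im_comp fw).
have oR m : continuous (outR m) := @field_out_continuous _ phi Omega L _ _ _ _ L0 p3 dR m.
have oI m : continuous (outI m) := @field_out_continuous _ phi Omega L _ _ _ _ L0 p3 dI m.
exists (complex_field inR inI), (complex_field outR outI); split; last split.
(* On Gamma the truncated extension is f, and everywhere it is the sum of the two fields. *)
- move=> t Gt; apply: etrans (esym (trunc_frontier p phi f Gt)) _.
  by apply: complex_field_sum => k; exact: field_split.
- exists (complex_field inR inI); apply: complex_field_extension.
  + by move=> k n; exact: (field_in_Cn (cos theta) (sin theta) cphi phi0 phi1 oO OL L0 p3 cR dR k n).
  + by move=> k n; exact: (field_in_Cn (cos theta) (sin theta) cphi phi0 phi1 oO OL L0 p3 cI dI k n).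
  + by move=> x Ox; exact: (field_in_laplace cphi phi0 phi1 oO OL GL L0 p3 cs1 cR dR tR Ox).
  + by move=> x Ox; exact: (field_in_laplace cphi phi0 phi1 oO OL GL L0 p3 cs1 cI dI tI Ox).
  (* The extension is continuous up to Gamma from inside, and the outer field is continuous on the
     whole space. *)
  + by move=> k; exact: (within_continuousB (wR k) (oR k)).
  + by move=> k; exact: (within_continuousB (wI k) (oI k)).
- exists (complex_field outR outI); split.
    apply: complex_field_extension.
    + by move=> k n; exact: (field_out_Cn phi (cos theta) (sin theta) oO L0 p3 dR k n).
    + by move=> k n; exact: (field_out_Cn phi (cos theta) (sin theta) oO L0 p3 dI k n).
    + by move=> x Ox; exact: (field_out_laplace cphi phi1 oO OL GL L0 p3 cs1 cR dR tR Ox).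
    + by move=> x Ox; exact: (field_out_laplace cphi phi1 oO OL GL L0 p3 cs1 cI dI tI Ox).
    + by move=> k; exact: (@continuous_subspaceT _ _ _ _ (oR k)).
    + by move=> k; exact: (@continuous_subspaceT _ _ _ _ (oI k)).
  apply: complex_field_vanishing => k.
    exact: (@field_out_vanishing _ phi _ _ _ (cos theta) (sin theta) _ OL L0 p3 dR k).
  exact: (@field_out_vanishing _ phi _ _ _ (cos theta) (sin theta) _ OL L0 p3 dI k).
Qed.
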